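(* Let $N\ge 1$, let $\mathcal G_N$ be the unipotent group $\exp(\mathfrak f_{\le N})$, let $\rho_N\colon\mathcal G_N\to\operatorname{GL}(V_N)$ be a faithful finite-dimensional representation, and consider the difference system over $\mathbf k(s)$ $$\sigma(Y)=\rho_N(a_N(s))\,Y,\qquad a_N(s)=x_N\!\left(\tfrac1{s+1}\right),\qquad x_N(t)=\exp\Big(\sum_{m=1}^N e_mt^m\Big).$$ Let $\theta_N\colon \mathbf k(s)\otimes\mathcal O(\mathcal G_N)\to\operatorname{Seq}(\mathbf k)$ be the evaluation morphism on the ordered product $\Phi_N$ (see context), and let $R_N=\theta_N(\mathbf k(s)\otimes\mathcal O(\mathcal G_N))\subset\operatorname{Seq}(\mathbf k)$. Then $\theta_N$ is injective, and $R_N$ is a Picard--Vessiot ring for the system $\sigma(Y)=\rho_N(a_N(s))\,Y$. Its difference Galois group is $$\operatorname{Gal}_\sigma(R_N/\mathbf k(s))=\rho_N(\mathcal G_N).$$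
   Context: $\mathbf k$ is an algebraically closed field of characteristic zero; the base difference field is $\mathbf k(s)$ with $\sigma(s)=s+1$. $\operatorname{Seq}(\mathbf k)$ is the ring of sequences $\langle a(0),a(1),\dots\rangle$ in $\mathbf k$, two sequences being identified if they differ at only finitely many places, with shift $\sigma\langle a(0),a(1),\ldots\rangle=\langle a(1),a(2),\ldots\rangle$. The field $\mathbf k(s)$ embeds in $\operatorname{Seq}(\mathbf k)$ by evaluation at sufficiently large integers. Groups. $\mathfrak f=\mathfrak f(e_1,e_2,\ldots)$ is the free Lie algebra over $\mathbf k$ on generators $e_m$ of weight $m$, with weight grading $\mathfrak f=\bigoplus_q\mathfrak f_q$; $\mathfrak f_{\le N}=\mathfrak f/\bigoplus_{q>N}\mathfrak f_q$, a finite-dimensional nilpotent Lie algebra, and $\mathcal G_N=\exp(\mathfrak f_{\le N})$ is the corresponding unipotent algebraic group. Difference structure on $\mathbf k(s)\otimes\mathcal O(\mathcal G_N)$: $\sigma$ shifts scalars by $s\mapsto s+1$ and acts on $f\in\mathcal O(\mathcal G_N)$ by $(\sigma f)(g)=f(a_N(s)g)$. Ordered product: $\Phi_N(0)=1$ and $\Phi_N(M)=x_N(1/M)\,x_N(1/(M-1))\cdots x_N(1)\in\mathcal G_N(\mathbf k)$ for $M\ge1$. The morphism $\theta_N$ is the $\mathbf k(s)$-linear ring morphism sending $f\in\mathcal O(\mathcal G_N)$ to the sequence $\langle f(\Phi_N(M))\rangle_{M\ge0}$; it commutes with $\sigma$. (Equivalently, $\mathcal O(\mathcal G_N)$ is the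 subalgebra of the quasi-shuffle algebra on letters $y_1,y_2,\ldots$ generated by Lyndon words of weight $\le N$, and $\theta_N$ sends a word $y_{m_1}\cdots y_{m_r}$ to the sequence of finite multiple harmonic sums $\sum_{M\ge n_1>\cdots>n_r\ge1}n_1^{-m_1}\cdots n_r^{-m_r}$.) A Picard--Vessiot ring for a system $\sigma(Y)=\mathcal A Y$, $\mathcal A\in\operatorname{GL}_n(\mathbf k(s))$, is a difference ring extension $R$ of $\mathbf k(s)$ with no nontrivial $\sigma$-ideals that is generated over $\mathbf k(s)$ by the entries of a fundamental solution matrix $Z\in \operatorname{GL}_n(R)$, $\sigma(Z)=\mathcal A Z$, and by $\det(Z)^{-1}$. Its difference Galois group is the group of $\sigma$-automorphisms of $R$ over $\mathbf k(s)$, regarded as a closed algebraic subgroup of $\operatorname{GL}_n$ over $\mathbf k$ via $Z\mapsto Zc$. Here the fundamental matrix in $R_N$ is $Y_N=\rho_N(\Phi_N)$. *)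

(* Defs.v *)
From HB Require Import structures.
From mathcomp Require Import all_boot all_order all_algebra.
From mathcomp Require Import boolp.
From mathcomp.multinomials Require Import mpoly.

Set Implicit Arguments.
Unset Strict Implicit.
Unset Printing Implicit Defensive.

Import GRing.Theory.
Local Open Scope ring_scope.
Local Open Scope quotient_scope.

HB.mixin Record Lmodule_isLieAlgebra (k : fieldType) V of GRing.Lmodule k V := {
  lie : V -> V -> V;
  lie_linearl : forall y, linear (lie^~ y);
  lie_linearr : forall x, linear (lie x);
  lie_alt : forall x, lie x x = 0;
  lie_jacobi : forall x y z,
    lie x (lie y z) + lie y (lie z x) + lie z (lie x y) = 0
}.

#[short(type="lieAlgType")]
HB.structure Definition LieAlgebra (k : fieldType) :=
  { V of Lmodule_isLieAlgebra k V & GRing.Lmodule k V }.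

Section LieTheory.
Variables (k : fieldType) (L : lieAlgType k).
Implicit Types x y z : L.

Lemma lieDl y : {morph (lie^~ y : L -> L) : x1 x2 / x1 + x2}.
Proof. by move=> x1 x2 /=; rewrite -[x1 in LHS]scale1r lie_linearl scale1r. Qed.
Lemma lieDr x : {morph (lie x : L -> L) : y1 y2 / y1 + y2}.
Proof. by move=> x1 x2 /=; rewrite -[x1 in LHS]scale1r lie_linearr scale1r. Qed.
Lemma lie0l y : lie 0 y = 0 :> L.
Proof. by apply: (addrI (lie 0 y)); rewrite -lieDl !addr0. Qed.
Lemma lie0r x : lie x 0 = 0 :> L.
Proof. by apply: (addrI (lie x 0)); rewrite -lieDr !addr0. Qed.
Lemma lieZl a x y : lie (a *: x) y = a *: lie x y.
Proof. by rewrite -[a *: x]addr0 lie_linearl lie0l addr0. Qed.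
Lemma lieZr a x y : lie x (a *: y) = a *: lie x y.
Proof. by rewrite -[a *: y]addr0 lie_linearr lie0r addr0. Qed.
Lemma lieBl x1 x2 y : lie (x1 - x2) y = lie x1 y - lie x2 y :> L.
Proof. by rewrite lieDl -scaleN1r lieZl scaleN1r. Qed.
Lemma lieBr x y1 y2 : lie x (y1 - y2) = lie x y1 - lie x y2 :> L.
Proof. by rewrite lieDr -scaleN1r lieZr scaleN1r. Qed.

Fixpoint lie_word (s : seq L) : L :=
  match s with
  | [::] => 0
  | [:: x] => x
  | x :: s' => lie x (lie_word s')
  end.

(* The Baker-Campbell-Hausdorff series log(exp x exp y), in Dynkin's form
     \sum_n (-1)^(n-1)/n \sum_(r_1+s_1>0, ..., r_n+s_n>0)
        [x^(r_1) y^(s_1) ... x^(r_n) y^(s_n)]   (right-normed bracket)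
          / ((\sum_i (r_i+s_i)) \prod_i r_i! s_i!).
   If L is nilpotent of class <= c, brackets of more than c factors vanish, so
   that restricting to n, r_i, s_i <= c drops only zero terms. *)
Definition bch (c : nat) x y : L :=
  \sum_(1 <= n < c.+1)
   \sum_(p : n.-tuple ('I_c.+1 * 'I_c.+1) | [forall i, 0 < (tnth p i).1 + (tnth p i).2]%N)
     ((-1) ^+ n.-1 / n%:R
       / (\sum_(rs <- p) (rs.1 + rs.2))%N%:R
       / (\prod_(rs <- p) ((rs.1)`! * (rs.2)`!))%N%:R)
     *: lie_word (flatten [seq nseq rs.1 x ++ nseq rs.2 y | rs : 'I_c.+1 * 'I_c.+1 <- p]).

End LieTheory.

Definition lin_span (k : fieldType) (V : lmodType k) (S : V -> Prop) (x : V) :=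
  exists (n : nat) (c : 'I_n -> k) (v : 'I_n -> V),
    (forall i, S (v i)) /\ x = \sum_i c i *: v i.

Section LinSpan.
Variables (k : fieldType) (V : lmodType k) (S : V -> Prop).

Lemma lin_span_gen x : S x -> lin_span S x.
Proof.
by move=> Sx; exists 1, (fun=> 1), (fun=> x); rewrite big_ord1 scale1r.
Qed.

Lemma lin_span0 : lin_span S 0.
Proof.
by exists 0, (fun=> 0), (fun=> 0); split; [case|rewrite big_ord0].
Qed.

Lemma lin_spanD x y : lin_span S x -> lin_span S y -> lin_span S (x + y).
Proof.
move=> [n [c [v [Sv ->]]]] [m [d [w [Sw ->]]]].
exists (n + m)%N,
  (fun i => match split i with inl i => c i | inr i => d i end),
  (fun i => match split i with inl i => v i | inr i => w i end).
split; first by move=> i; case: (split i).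
rewrite big_split_ord /=; congr (_ + _); apply: eq_bigr => i _.
  by rewrite (unsplitK (inl _ i)).
by rewrite (unsplitK (inr _ i)).
Qed.

Lemma lin_spanZ a x : lin_span S x -> lin_span S (a *: x).
Proof.
move=> [n [c [v [Sv ->]]]]; exists n, (fun i => a * c i), v; split=> //.
by rewrite scaler_sumr; apply: eq_bigr => i _; rewrite scalerA.
Qed.

Lemma lin_spanN x : lin_span S x -> lin_span S (- x).
Proof. by rewrite -scaleN1r; apply: lin_spanZ. Qed.

Lemma lin_span_ind (P : V -> Prop) :
  P 0 -> (forall x y, P x -> P y -> P (x + y)) ->
  (forall a x, P x -> P (a *: x)) -> (forall x, S x -> P x) ->
  forall x, lin_span S x -> P x.
Proof.
move=> P0 PD PZ PS x [n [c [v [Sv ->]]]].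
by elim/big_ind: _ => // i _; apply/PZ/PS.
Qed.

End LinSpan.

(* Formal expressions; the leaf [TGen m] stands for e_(m+1). *)
Inductive lie_term (k : Type) : Type :=
  | TGen of nat
  | TZero
  | TOpp of lie_term k
  | TAdd of lie_term k & lie_term k
  | TScale of k & lie_term k
  | TLie of lie_term k & lie_term k.
Arguments TGen {k}.
Arguments TZero {k}.

Section FreeLie.
Variable k : fieldType.
Local Notation term := (lie_term k).

HB.instance Definition _ := gen_eqMixin term.
HB.instance Definition _ := gen_choiceMixin term.

Inductive lie_cong : term -> term -> Prop :=
  | cong_refl t : lie_cong t t
  | cong_sym t u : lie_cong t u -> lie_cong u t
  | cong_trans t u v : lie_cong t u -> lie_cong u v -> lie_cong t v
  | cong_opp t t' : lie_cong t t' -> lie_cong (TOpp t) (TOpp t')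
  | cong_add t t' u u' : lie_cong t t' -> lie_cong u u' ->
      lie_cong (TAdd t u) (TAdd t' u')
  | cong_scale a t t' : lie_cong t t' -> lie_cong (TScale a t) (TScale a t')
  | cong_lie t t' u u' : lie_cong t t' -> lie_cong u u' ->
      lie_cong (TLie t u) (TLie t' u')
  | cong_addA t u v : lie_cong (TAdd t (TAdd u v)) (TAdd (TAdd t u) v)
  | cong_addC t u : lie_cong (TAdd t u) (TAdd u t)
  | cong_add0 t : lie_cong (TAdd TZero t) t
  | cong_addN t : lie_cong (TAdd (TOpp t) t) TZero
  | cong_scaleA a b t : lie_cong (TScale a (TScale b t)) (TScale (a * b) t)
  | cong_scale1 t : lie_cong (TScale 1 t) t
  | cong_scaleDr a t u :
      lie_cong (TScale a (TAdd t u)) (TAdd (TScale a t) (TScale a u))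
  | cong_scaleDl a b t :
      lie_cong (TScale (a + b) t) (TAdd (TScale a t) (TScale b t))
  | cong_linl a t u v :
      lie_cong (TLie (TAdd (TScale a t) u) v)
               (TAdd (TScale a (TLie t v)) (TLie u v))
  | cong_linr a t u v :
      lie_cong (TLie v (TAdd (TScale a t) u))
               (TAdd (TScale a (TLie v t)) (TLie v u))
  | cong_alt t : lie_cong (TLie t t) TZero
  | cong_jacobi t u v :
      lie_cong (TAdd (TAdd (TLie t (TLie u v)) (TLie u (TLie v t)))
                     (TLie v (TLie t u))) TZero.

Definition lie_congb (t u : term) : bool := `[< lie_cong t u >].

Lemma lie_congb_refl : reflexive lie_congb.
Proof. by move=> t; apply/asboolP/cong_refl. Qed.
Lemma lie_congb_sym : ssrbool.symmetric lie_congb.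
Proof. by move=> t u; apply/asboolP/asboolP; apply: cong_sym. Qed.
Lemma lie_congb_trans : transitive lie_congb.
Proof. by move=> u t v /asboolP tu /asboolP uv; apply/asboolP/(cong_trans tu). Qed.

Canonical lie_cong_equiv :=
  EquivRel lie_congb lie_congb_refl lie_congb_sym lie_congb_trans.

Definition freeLie := {eq_quot lie_congb}.
HB.instance Definition _ : EqQuotient _ lie_congb freeLie := EqQuotient.on freeLie.
HB.instance Definition _ := Choice.on freeLie.

Let pi (t : term) : freeLie := \pi_freeLie t.

Lemma freeLie_eqP t u : pi t = pi u <-> lie_cong t u.
Proof. by split=> [/eqmodP/asboolP|tu]; [|apply/eqmodP/asboolP]. Qed.

Let cong_repr t : lie_cong (repr (pi t)) t.
Proof. by apply/freeLie_eqP; rewrite /pi reprK. Qed.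

Definition fl_opp (x : freeLie) : freeLie := pi (TOpp (repr x)).
Definition fl_add (x y : freeLie) : freeLie := pi (TAdd (repr x) (repr y)).
Definition fl_scale a (x : freeLie) : freeLie := pi (TScale a (repr x)).
Definition fl_lie (x y : freeLie) : freeLie := pi (TLie (repr x) (repr y)).

Let opp_pi t : fl_opp (pi t) = pi (TOpp t).
Proof. exact/freeLie_eqP/cong_opp/cong_repr. Qed.
Let add_pi t u : fl_add (pi t) (pi u) = pi (TAdd t u).
Proof. by apply/freeLie_eqP/cong_add; apply: cong_repr. Qed.
Let scale_pi a t : fl_scale a (pi t) = pi (TScale a t).
Proof. exact/freeLie_eqP/cong_scale/cong_repr. Qed.
Let lie_pi t u : fl_lie (pi t) (pi u) = pi (TLie t u).
Proof. by apply/freeLie_eqP/cong_lie; apply: cong_repr. Qed.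

Let piP (P : freeLie -> Prop) : (forall t, P (pi t)) -> forall x, P x.
Proof. by move=> Ppi x; rewrite -[x]reprK; apply: Ppi. Qed.

Let fl_addA : associative fl_add.
Proof.
elim/piP => t; elim/piP => u; elim/piP => v.
by rewrite !add_pi; apply/freeLie_eqP/cong_addA.
Qed.
Let fl_addC : commutative fl_add.
Proof.
by elim/piP => t; elim/piP => u; rewrite !add_pi; apply/freeLie_eqP/cong_addC.
Qed.
Let fl_add0 : left_id (pi TZero) fl_add.
Proof. by elim/piP => t; rewrite add_pi; apply/freeLie_eqP/cong_add0. Qed.
Let fl_addN : left_inverse (pi TZero) fl_opp fl_add.
Proof. by elim/piP => t; rewrite opp_pi add_pi; apply/freeLie_eqP/cong_addN. Qed.

HB.instance Definition _ :=
  GRing.isZmodule.Build freeLie fl_addA fl_addC fl_add0 fl_addN.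

Let fl_scaleA a b x : fl_scale a (fl_scale b x) = fl_scale (a * b) x.
Proof.
by elim/piP: x => t; rewrite !scale_pi; apply/freeLie_eqP/cong_scaleA.
Qed.
Let fl_scale1 : left_id 1 fl_scale.
Proof. by elim/piP => t; rewrite scale_pi; apply/freeLie_eqP/cong_scale1. Qed.
Let fl_scaleDr : right_distributive fl_scale +%R.
Proof.
move=> a; elim/piP => t; elim/piP => u; rewrite [pi t + pi u]add_pi !scale_pi.
by rewrite [RHS]add_pi; apply/freeLie_eqP/cong_scaleDr.
Qed.
Let fl_scaleDl x : {morph fl_scale^~ x : a b / a + b}.
Proof.
move=> a b; elim/piP: x => t; rewrite !scale_pi [RHS]add_pi.
exact/freeLie_eqP/cong_scaleDl.
Qed.

HB.instance Definition _ := GRing.Zmodule_isLmodule.Build k freeLie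
  fl_scaleA fl_scale1 fl_scaleDr fl_scaleDl.

Let piD t u : pi (TAdd t u) = pi t + pi u. Proof. by rewrite -add_pi. Qed.
Let piZ a t : pi (TScale a t) = a *: pi t. Proof. by rewrite -scale_pi. Qed.

Let fl_linl y : linear (fl_lie^~ y).
Proof.
move=> a; elim/piP => t; elim/piP => u; elim/piP: y => v.
by rewrite -piZ -piD !lie_pi -piZ -piD; apply/freeLie_eqP/cong_linl.
Qed.
Let fl_linr x : linear (fl_lie x).
Proof.
move=> a; elim/piP => t; elim/piP => u; elim/piP: x => v.
by rewrite -piZ -piD !lie_pi -piZ -piD; apply/freeLie_eqP/cong_linr.
Qed.
Let fl_alt x : fl_lie x x = 0.
Proof. by elim/piP: x => t; rewrite lie_pi; apply/freeLie_eqP/cong_alt. Qed.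
Let fl_jacobi x y z :
  fl_lie x (fl_lie y z) + fl_lie y (fl_lie z x) + fl_lie z (fl_lie x y) = 0.
Proof.
elim/piP: x => t; elim/piP: y => u; elim/piP: z => v.
by rewrite !lie_pi -!piD; apply/freeLie_eqP/cong_jacobi.
Qed.

HB.instance Definition _ := Lmodule_isLieAlgebra.Build k freeLie
  fl_linl fl_linr fl_alt fl_jacobi.

(* the generator e_m; only the indices m >= 1 are meaningful *)
Definition fl_gen (m : nat) : freeLie := pi (TGen m.-1).

Lemma freeLie_ind (P : freeLie -> Prop) :
  (forall m, (0 < m)%N -> P (fl_gen m)) -> P 0 ->
  (forall x y, P x -> P y -> P (x + y)) ->
  (forall a x, P x -> P (a *: x)) ->
  (forall x y, P x -> P y -> P (lie x y)) -> forall x, P x.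
Proof.
move=> Pg P0 PD PZ PL; elim/piP.
elim=> [m||t Pt|t Pt u Pu|a t Pt|t Pt u Pu].
- exact: (Pg m.+1).
- exact: P0.
- by rewrite -opp_pi -[fl_opp _]/(- pi t) -scaleN1r; apply: PZ.
- by rewrite piD; apply: PD.
- by rewrite piZ; apply: PZ.
- by rewrite -lie_pi; apply: PL.
Qed.

Fixpoint lie_eval (L : lieAlgType k) (h : nat -> L) (t : term) : L :=
  match t with
  | TGen m => h m.+1
  | TZero => 0
  | TOpp t => - lie_eval h t
  | TAdd t u => lie_eval h t + lie_eval h u
  | TScale a t => a *: lie_eval h t
  | TLie t u => lie (lie_eval h t) (lie_eval h u)
  end.

Lemma lie_eval_cong (L : lieAlgType k) (h : nat -> L) t u :
  lie_cong t u -> lie_eval h t = lie_eval h u.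
Proof.
elim=> {t u} //=.
- by move=> t u v _ -> _ ->.
- by move=> t t' _ ->.
- by move=> t t' u u' _ -> _ ->.
- by move=> a t t' _ ->.
- by move=> t t' u u' _ -> _ ->.
- by move=> t u v; rewrite addrA.
- by move=> t u; rewrite addrC.
- by move=> t; rewrite add0r.
- by move=> t; rewrite addNr.
- by move=> a b t; rewrite scalerA.
- by move=> t; rewrite scale1r.
- by move=> a t u; rewrite scalerDr.
- by move=> a b t; rewrite scalerDl.
- by move=> a t u v; rewrite lie_linearl.
- by move=> a t u v; rewrite lie_linearr.
- by move=> t; rewrite lie_alt.
- by move=> t u v; rewrite lie_jacobi.
Qed.

Lemma freeLie_univ (L : lieAlgType k) (h : nat -> L) :
  exists! F : freeLie -> L,
    [/\ linear F, forall x y, F (lie x y) = lie (F x) (F y)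
      & forall m, (0 < m)%N -> F (fl_gen m) = h m].
Proof.
have Fpi t : lie_eval h (repr (pi t)) = lie_eval h t.
  exact/lie_eval_cong/cong_repr.
exists (fun x => lie_eval h (repr x)); split.
  split=> [a|x y|[//|m] _]; last exact: Fpi.
    by elim/piP=> t; elim/piP=> u; rewrite -piZ -piD !Fpi.
  by elim/piP: x => t; elim/piP: y => u; rewrite [lie _ _]lie_pi !Fpi.
move=> F [Flin FL Fg]; apply/funext => x.
have FD y z : F (y + z) = F y + F z by rewrite -[y]scale1r Flin !scale1r.
have F0 : F 0 = 0 by apply: (addrI (F 0)); rewrite -FD !addr0.
have FZ a y : F (a *: y) = a *: F y by rewrite -[_ *: y]addr0 Flin F0 addr0.
elim/freeLie_ind: x => [[//|m] _||x y Fx Fy|a x Fx|x y Fx Fy].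
- by rewrite Fpi Fg.
- by rewrite F0 Fpi.
- rewrite FD -Fx -Fy; elim/piP: x {Fx} => t; elim/piP: y {Fy} => u.
  by rewrite -piD !Fpi.
- by rewrite FZ -Fx; elim/piP: x {Fx} => t; rewrite -piZ !Fpi.
- rewrite FL -Fx -Fy; elim/piP: x {Fx} => t; elim/piP: y {Fy} => u.
  by rewrite [lie _ _]lie_pi !Fpi.
Qed.

Inductive lie_monomial : nat -> freeLie -> Prop :=
  | mono_gen m : (0 < m)%N -> lie_monomial m (fl_gen m)
  | mono_lie q r x y : lie_monomial q x -> lie_monomial r y ->
      lie_monomial (q + r) (lie x y).

Definition freeLie_weight (q : nat) : freeLie -> Prop := lin_span (lie_monomial q).

Definition freeLie_gt (N : nat) : freeLie -> Prop :=
  lin_span (fun x => exists2 q, (N < q)%N & freeLie_weight q x).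

Lemma freeLie_span x : lin_span (fun y => exists q, lie_monomial q y) x.
Proof.
elim/freeLie_ind: x => [m m0||x y|a x|x y sx sy].
- by apply: lin_span_gen; exists m; apply: mono_gen.
- exact: lin_span0.
- exact: lin_spanD.
- exact: lin_spanZ.
- elim/lin_span_ind: sx => [|x1 x2 s1 s2|a x1 s1|x1 [q qx1]].
  + by rewrite lie0l; apply: lin_span0.
  + by rewrite lieDl; apply: lin_spanD.
  + by rewrite lieZl; apply: lin_spanZ.
  elim/lin_span_ind: sy => [|y1 y2 s1 s2|a y1 s1|y1 [r ry1]].
  + by rewrite lie0r; apply: lin_span0.
  + by rewrite lieDr; apply: lin_spanD.
  + by rewrite lieZr; apply: lin_spanZ.
  by apply: lin_span_gen; exists (q + r)%N; apply: mono_lie.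
Qed.

Lemma freeLie_gt_ind N (P : freeLie -> Prop) :
  P 0 -> (forall x y, P x -> P y -> P (x + y)) ->
  (forall a x, P x -> P (a *: x)) ->
  (forall q x, (N < q)%N -> lie_monomial q x -> P x) ->
  forall x, freeLie_gt N x -> P x.
Proof.
move=> P0 PD PZ Pm; apply: lin_span_ind => // x [q Nq].
by apply: lin_span_ind => // y; apply: Pm.
Qed.

Lemma freeLie_gt_mono N q x : (N < q)%N -> lie_monomial q x -> freeLie_gt N x.
Proof. by move=> Nq qx; apply: lin_span_gen; exists q => //; apply: lin_span_gen. Qed.

Lemma freeLie_gt_lier N x y : freeLie_gt N y -> freeLie_gt N (lie x y).
Proof.
move=> gy; elim/freeLie_gt_ind: gy => [|y1 y2 s1 s2|a y1 s1|q y1 Nq qy].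
- by rewrite lie0r; apply: lin_span0.
- by rewrite lieDr; apply: lin_spanD.
- by rewrite lieZr; apply: lin_spanZ.
elim/lin_span_ind: (freeLie_span x) => [|x1 x2 s1 s2|a x1 s1|x1 [r rx]].
- by rewrite lie0l; apply: lin_span0.
- by rewrite lieDl; apply: lin_spanD.
- by rewrite lieZl; apply: lin_spanZ.
by apply: (@freeLie_gt_mono _ (r + q)); rewrite ?ltn_addl //; apply: mono_lie.
Qed.

Lemma lieNC x y : lie x y = - lie y x :> freeLie.
Proof.
apply/eqP; rewrite -addr_eq0; apply/eqP; have := lie_alt (x + y).
by rewrite lieDl !lieDr !lie_alt add0r addr0.
Qed.

Lemma freeLie_gt_liel N x y : freeLie_gt N x -> freeLie_gt N (lie x y).
Proof. by move=> gx; rewrite lieNC; apply/lin_spanN/freeLie_gt_lier. Qed.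

Section Truncation.
Variable N : nat.

Definition trunc_rel (x y : freeLie) : bool := `[< freeLie_gt N (x - y) >].

Lemma trunc_rel_refl : reflexive trunc_rel.
Proof. by move=> x; apply/asboolP; rewrite subrr; apply: lin_span0. Qed.
Lemma trunc_rel_sym : ssrbool.symmetric trunc_rel.
Proof. by move=> x y; apply/asboolP/asboolP => /lin_spanN; rewrite opprB. Qed.
Lemma trunc_rel_trans : transitive trunc_rel.
Proof.
move=> y x z /asboolP xy /asboolP yz; apply/asboolP.
by have := lin_spanD xy yz; rewrite addrA subrK.
Qed.

Canonical trunc_rel_equiv :=
  EquivRel trunc_rel trunc_rel_refl trunc_rel_sym trunc_rel_trans.

Definition freeLieN := {eq_quot trunc_rel}.
HB.instance Definition _ : EqQuotient _ trunc_rel freeLieN :=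
  EqQuotient.on freeLieN.
HB.instance Definition _ := Choice.on freeLieN.

Definition trunc (x : freeLie) : freeLieN := \pi_freeLieN x.

Lemma trunc_eqP x y : trunc x = trunc y <-> freeLie_gt N (x - y).
Proof. by split=> [/eqmodP/asboolP|xy]; [|apply/eqmodP/asboolP]. Qed.

Let gt_repr x : freeLie_gt N (repr (trunc x) - x).
Proof. by apply/trunc_eqP; rewrite /trunc reprK. Qed.

Let t_opp (x : freeLieN) : freeLieN := trunc (- repr x).
Let t_add (x y : freeLieN) : freeLieN := trunc (repr x + repr y).
Let t_scale a (x : freeLieN) : freeLieN := trunc (a *: repr x).
Let t_lie (x y : freeLieN) : freeLieN := trunc (lie (repr x) (repr y)).

Let t_oppE x : t_opp (trunc x) = trunc (- x).
Proof. by apply/trunc_eqP; rewrite -opprD; apply/lin_spanN/gt_repr. Qed.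
Let t_addE x y : t_add (trunc x) (trunc y) = trunc (x + y).
Proof. by apply/trunc_eqP; rewrite opprD addrACA; apply: lin_spanD; apply: gt_repr. Qed.
Let t_scaleE a x : t_scale a (trunc x) = trunc (a *: x).
Proof. by apply/trunc_eqP; rewrite -scalerBr; apply/lin_spanZ/gt_repr. Qed.
Let t_lieE x y : t_lie (trunc x) (trunc y) = trunc (lie x y).
Proof.
apply/trunc_eqP; set x' := repr _; set y' := repr _.
have -> : lie x' y' - lie x y = lie (x' - x) y' + lie x (y' - y).
  by rewrite lieBl lieBr addrA subrK.
by apply: lin_spanD; [apply/freeLie_gt_liel/gt_repr|apply/freeLie_gt_lier/gt_repr].
Qed.

Lemma truncP (P : freeLieN -> Prop) : (forall x, P (trunc x)) -> forall x, P x.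
Proof. by move=> Ppi x; rewrite -[x]reprK; apply: Ppi. Qed.

Let t_addA : associative t_add.
Proof. by elim/truncP=> x; elim/truncP=> y; elim/truncP=> z; rewrite !t_addE addrA. Qed.
Let t_addC : commutative t_add.
Proof. by elim/truncP=> x; elim/truncP=> y; rewrite !t_addE addrC. Qed.
Let t_add0 : left_id (trunc 0) t_add.
Proof. by elim/truncP=> x; rewrite t_addE add0r. Qed.
Let t_addN : left_inverse (trunc 0) t_opp t_add.
Proof. by elim/truncP=> x; rewrite t_oppE t_addE addNr. Qed.

HB.instance Definition _ :=
  GRing.isZmodule.Build freeLieN t_addA t_addC t_add0 t_addN.

Let t_scaleA a b x : t_scale a (t_scale b x) = t_scale (a * b) x.
Proof. by elim/truncP: x => x; rewrite !t_scaleE scalerA. Qed.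
Let t_scale1 : left_id 1 t_scale.
Proof. by elim/truncP=> x; rewrite t_scaleE scale1r. Qed.
Let t_scaleDr : right_distributive t_scale +%R.
Proof.
move=> a; elim/truncP=> x; elim/truncP=> y; rewrite [_ + _ in LHS]t_addE !t_scaleE.
by rewrite [RHS]t_addE scalerDr.
Qed.
Let t_scaleDl x : {morph t_scale^~ x : a b / a + b}.
Proof.
by move=> a b; elim/truncP: x => x; rewrite !t_scaleE [RHS]t_addE scalerDl.
Qed.

HB.instance Definition _ := GRing.Zmodule_isLmodule.Build k freeLieN
  t_scaleA t_scale1 t_scaleDr t_scaleDl.

Lemma truncD : {morph trunc : x y / x + y}.
Proof. by move=> x y; rewrite -t_addE. Qed.
Lemma truncZ a : {morph trunc : x / a *: x}.
Proof. by move=> x; rewrite -t_scaleE. Qed.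

Let t_linl y : linear (t_lie^~ y).
Proof.
move=> a; elim/truncP=> x1; elim/truncP=> x2; elim/truncP: y => y.
by rewrite -truncZ -truncD !t_lieE -truncZ -truncD lie_linearl.
Qed.
Let t_linr x : linear (t_lie x).
Proof.
move=> a; elim/truncP=> x1; elim/truncP=> x2; elim/truncP: x => y.
by rewrite -truncZ -truncD !t_lieE -truncZ -truncD lie_linearr.
Qed.
Let t_alt x : t_lie x x = 0.
Proof. by elim/truncP: x => x; rewrite t_lieE lie_alt. Qed.
Let t_jacobi x y z :
  t_lie x (t_lie y z) + t_lie y (t_lie z x) + t_lie z (t_lie x y) = 0.
Proof.
elim/truncP: x => x; elim/truncP: y => y; elim/truncP: z => z.
by rewrite !t_lieE -!truncD lie_jacobi.
Qed.

HB.instance Definition _ := Lmodule_isLieAlgebra.Build k freeLieN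
  t_linl t_linr t_alt t_jacobi.

Lemma trunc_lie x y : trunc (lie x y) = lie (trunc x) (trunc y).
Proof. by rewrite -t_lieE. Qed.

Definition gen (m : nat) : freeLieN := trunc (fl_gen m).

(* Finite dimension: monomials of weight <= N are brackets of depth <= N in
   e_1, ..., e_N. *)
Fixpoint monos (d : nat) : seq freeLieN :=
  if d is d'.+1
  then [seq gen m | m <- iota 1 N] ++ [seq lie x y | x <- monos d', y <- monos d']
  else [::].

Lemma mem_monos d x : (x \in monos d.+1) =
  (x \in [seq gen m | m <- iota 1 N])
  || (x \in [seq lie y z | y <- monos d, z <- monos d]).
Proof. exact: mem_cat. Qed.

Lemma monos_le d q x :
  lie_monomial q x -> (q <= N)%N -> (q <= d)%N -> trunc x \in monos d.
Proof.
move=> qx; have q0 : (0 < q)%N by elim: qx => // *; rewrite addn_gt0; apply/orP; left.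
elim: qx d q0 => [m m0|r s y z ry IHy sz IHz] [|d] q0 qN qd; rewrite ?leqn0 in qd.
- by move: m0; rewrite (eqP qd).
- by rewrite mem_monos -/(gen m) map_f // mem_iota m0 add1n ltnS.
- by rewrite (eqP qd) in q0.
have mono_gt0 n w : lie_monomial n w -> (0 < n)%N.
  by elim=> // *; rewrite addn_gt0; apply/orP; left.
have r0 := mono_gt0 _ _ ry; have s0 := mono_gt0 _ _ sz.
rewrite mem_monos; apply/orP; right; rewrite trunc_lie.
have rs1 : (r < r + s)%N by rewrite -[X in (X < _)%N]addn0 ltn_add2l.
have rs2 : (s < r + s)%N by rewrite -[X in (X < _)%N]add0n ltn_add2r.
apply: allpairs_f.
  by apply: IHy => //; [apply: leq_trans qN; apply: ltnW|rewrite -ltnS (leq_trans rs1)].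
by apply: IHz => //; [apply: leq_trans qN; apply: ltnW|rewrite -ltnS (leq_trans rs2)].
Qed.

Lemma freeLieN_span x : lin_span (fun y => y \in monos N) x.
Proof.
elim/truncP: x => x; elim/lin_span_ind: (freeLie_span x).
- exact: lin_span0.
- by move=> y z; rewrite truncD; apply: lin_spanD.
- by move=> a y; rewrite truncZ; apply: lin_spanZ.
move=> y [q qy]; case: (leqP q N) => [qN|Nq].
  by apply: lin_span_gen; apply: monos_le qy _ _.
suff -> : trunc y = 0 by apply: lin_span0.
by apply/trunc_eqP; rewrite subr0; apply: freeLie_gt_mono qy.
Qed.

Let onto (d : nat) : Prop :=
  exists2 f : 'rV[k]_d -> freeLieN, linear f & forall x, exists u, f u = x.

Let onto_ex : exists d, `[< onto d >].
Proof.
exists (size (monos N)); apply/asboolP.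
exists (fun u => \sum_(i < size (monos N)) u 0 i *: (monos N)`_i).
  move=> a u v; rewrite scaler_sumr -big_split /=; apply: eq_bigr => i _.
  by rewrite !mxE scalerA scalerDl.
move=> x; elim/lin_span_ind: (freeLieN_span x).
- by exists 0; apply: big1 => i _; rewrite mxE scale0r.
- move=> y z [u <-] [v <-]; exists (u + v); rewrite -big_split /=.
  by apply: eq_bigr => i _; rewrite mxE scalerDl.
- move=> a y [u <-]; exists (a *: u); rewrite scaler_sumr.
  by apply: eq_bigr => i _; rewrite mxE scalerA.
move=> y yM; have iy : (index y (monos N) < size (monos N))%N by rewrite index_mem.
exists (delta_mx 0 (Ordinal iy)); rewrite (bigD1 (Ordinal iy)) //= mxE !eqxx scale1r.
rewrite big1 ?addr0 ?nth_index // => j jy.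
by rewrite mxE eqxx /= (negPf jy) scale0r.
Qed.

Let dimN := ex_minn onto_ex.

Lemma freeLieN_vect : Vector.axiom dimN freeLieN.
Proof.
apply/cid2; rewrite /dimN; case: ex_minnP => d /asboolP[f flin fsurj] dmin.
have fB u v : f (u - v) = f u - f v.
  by rewrite addrC -scaleN1r flin scaleN1r addrC.
have finj : injective f.
  move=> u v fuv; apply/eqP; rewrite -subr_eq0; apply/negP => /negP w0.
  have {fuv} fw : f (u - v) = 0 by rewrite fB fuv subrr.
  move: (u - v) w0 fw => {u v} w w0 fw.
  have : (d <= \rank (w^C)%MS)%N.
    apply: dmin; apply/asboolP.
    exists (fun u => f (u *m row_base (w^C)%MS)).
      by move=> a u v; rewrite mulmxDl -scalemxAl flin.
    move=> x; have [u <-] := fsurj x.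
    have /sub_addsmxP[[a b] /= ->] : (u <= w + w^C)%MS.
      by apply: submx_full; apply: addsmx_compl_full.
    have /submxP[c cE] : (b *m w^C <= row_base w^C)%MS.
      by rewrite eq_row_base submxMl.
    exists c; rewrite -cE [a]mx11_scalar mul_scalar_mx flin fw.
    by rewrite scaler0 add0r.
  rewrite mxrank_compl rank_rV w0 /= subn1.
  case: d {f flin fsurj dmin fB fw} w w0 => [w|d w _]; last by rewrite ltnn.
  by rewrite [w]thinmx0 eqxx.
have [g gK] := choice fsurj; exists g.
  by move=> a x y; apply: finj; rewrite flin !gK.
by exists f => [x|u]; [apply: gK|apply: finj; rewrite gK].
Qed.

HB.instance Definition _ := Lmodule_hasFinDim.Build k freeLieN freeLieN_vect.

End Truncation.
End FreeLie.

Section Group.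
Variables (k : fieldType) (N : nat).

Local Notation dimN := (\dim {: freeLieN k N}).

(* A group element exp x is recorded by its logarithm x. *)
Record unip := Exp { Log : freeLieN k N }.

Definition unip1 : unip := Exp 0.
Definition unip_mul (g h : unip) : unip := Exp (bch N (Log g) (Log h)).

Definition log_coord (i : 'I_dimN) (g : unip) : k :=
  coord (vbasis {: freeLieN k N}) i (Log g).

(* The coordinate ring: polynomials in the linear coordinates of Log.  The base
   change of it to an extension F of k is {mpoly F[dimN]}. *)
Definition unip_fun := {mpoly k[dimN]}.
Definition fun_at (f : unip_fun) (g : unip) : k := f.@[log_coord^~ g].

Definition rep_at n (rho : 'M[unip_fun]_n) (g : unip) : 'M[k]_n :=
  map_mx (fun_at^~ g) rho.

Record faithful_rep n (rho : 'M[unip_fun]_n) : Prop := {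
  rep_unit : forall g, rep_at rho g \in unitmx;
  rep_mul : forall g h, rep_at rho (unip_mul g h) = rep_at rho g *m rep_at rho h;
  rep_inj : injective (rep_at rho)
}.

Definition x_N (t : k) : unip := Exp (\sum_(1 <= m < N.+1) t ^+ m *: gen k N m).

Fixpoint Phi (M : nat) : unip :=
  if M is M'.+1 then unip_mul (x_N (M'.+1%:R)^-1) (Phi M') else unip1.

End Group.

Definition ratfun (k : fieldType) := {fraction {poly k}}.
HB.instance Definition _ (k : fieldType) := GRing.Field.on (ratfun k).

Section RatFun.
Variable k : fieldType.
Local Notation K := (ratfun k).
Local Notation "p %:F" := (@FracField.tofrac {poly k} p : K).

Definition ratfun_cst (c : k) : K := c%:P%:F.
Definition s_var : K := 'X%:F.

Definition ratfun_num (x : K) : {poly k} := \n_(repr (x : {fraction {poly k}})).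
Definition ratfun_den (x : K) : {poly k} := \d_(repr (x : {fraction {poly k}})).

Definition ratfun_shift (x : K) : K :=
  (ratfun_num x \Po ('X + 1))%:F / (ratfun_den x \Po ('X + 1))%:F.

Lemma ratfun_den_neq0 x : ratfun_den x != 0.
Proof. exact: denom_ratioP. Qed.

Lemma ratfun_numden x : x = (ratfun_num x)%:F / (ratfun_den x)%:F.
Proof.
have dx := ratfun_den_neq0 x; apply/(canRL (mulfK _)); first by rewrite tofrac_eq0.
rewrite /ratfun_num /ratfun_den in dx *; rewrite -{1}[x]reprK; unlock FracField.tofrac.
rewrite -[LHS]FracField.pi_mul; apply/eqmodP => /=.
rewrite FracField.equivfE /FracField.mulf !numden_Ratio ?mulf_neq0 ?oner_neq0 // !mulr1.
by rewrite mulrC.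
Qed.

Lemma ratfun_eq (n d n' d' : {poly k}) : d != 0 -> d' != 0 ->
  (n%:F / d%:F = n'%:F / d'%:F) <-> n * d' = n' * d.
Proof.
move=> d0 d0'; split=> [/eqP|E]; last apply/eqP.
  by rewrite eqr_div ?tofrac_eq0 // -!tofracM tofrac_eq => /eqP.
by rewrite eqr_div ?tofrac_eq0 // -!tofracM tofrac_eq E.
Qed.

Let comp0 (p : {poly k}) : (p \Po ('X + 1) == 0) = (p == 0).
Proof. by apply: comp_poly2_eq0; rewrite -[1]polyC1 size_XaddC. Qed.

Lemma ratfun_shiftE (n d : {poly k}) : d != 0 ->
  ratfun_shift (n%:F / d%:F) = (n \Po ('X + 1))%:F / (d \Po ('X + 1))%:F.
Proof.
move=> d0; set x := n%:F / _; have /(ratfun_eq _ _ (ratfun_den_neq0 x) d0) E := esym (ratfun_numden x).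
by apply/ratfun_eq; rewrite ?comp0 ?ratfun_den_neq0 // -!rmorphM E.
Qed.

Lemma ratfun_shift_zmod : zmod_morphism ratfun_shift.
Proof.
move=> x y; rewrite [x in LHS]ratfun_numden [y in LHS]ratfun_numden.
have [dx dy] := (ratfun_den_neq0 x, ratfun_den_neq0 y).
rewrite -mulNr addf_div ?tofrac_eq0 // -tofracN -!tofracM -tofracD.
rewrite ratfun_shiftE ?mulf_neq0 // /ratfun_shift -mulNr addf_div ?tofrac_eq0 ?comp0 //.
by rewrite -tofracN -!tofracM -tofracD !(rmorphM, rmorphD, rmorphN).
Qed.

Lemma ratfun_shift_monoid : monoid_morphism ratfun_shift.
Proof.
split.
  have := ratfun_shiftE 1 (oner_neq0 _).
  by rewrite !rmorph1 divr1.
move=> x y; rewrite [x in LHS]ratfun_numden [y in LHS]ratfun_numden.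
have [dx dy] := (ratfun_den_neq0 x, ratfun_den_neq0 y).
rewrite mulf_div -!tofracM ratfun_shiftE ?mulf_neq0 // /ratfun_shift mulf_div.
by rewrite -!tofracM !rmorphM.
Qed.

HB.instance Definition _ :=
  GRing.isZmodMorphism.Build K K ratfun_shift ratfun_shift_zmod.
HB.instance Definition _ :=
  GRing.isMonoidMorphism.Build K K ratfun_shift ratfun_shift_monoid.

Lemma ratfun_cst_zmod : zmod_morphism ratfun_cst.
Proof. by move=> a b; rewrite /ratfun_cst !rmorphB. Qed.
Lemma ratfun_cst_monoid : monoid_morphism ratfun_cst.
Proof. by split=> [|a b]; rewrite /ratfun_cst ?rmorph1 ?rmorphM. Qed.
HB.instance Definition _ :=
  GRing.isZmodMorphism.Build k K ratfun_cst ratfun_cst_zmod.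
HB.instance Definition _ :=
  GRing.isMonoidMorphism.Build k K ratfun_cst ratfun_cst_monoid.

End RatFun.

Section Seq.
Variable k : fieldType.
Implicit Types a b c : nat -> k.

Definition seq_rel a b : bool :=
  `[< exists m : nat, forall M : nat, (m <= M)%N -> a M = b M >].

Lemma seq_rel_refl : reflexive seq_rel.
Proof. by move=> a; apply/asboolP; exists 0. Qed.
Lemma seq_rel_sym : ssrbool.symmetric seq_rel.
Proof.
by move=> a b; apply/asboolP/asboolP => -[m E]; exists m => M /E.
Qed.
Lemma seq_rel_trans : transitive seq_rel.
Proof.
move=> b a c /asboolP[m E] /asboolP[m' E']; apply/asboolP; exists (maxn m m') => M.
by rewrite geq_max => /andP[/E -> /E' ->].
Qed.

Canonical seq_rel_equiv :=
  EquivRel seq_rel seq_rel_refl seq_rel_sym seq_rel_trans.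

Definition Seq := {eq_quot seq_rel}.
HB.instance Definition _ : EqQuotient _ seq_rel Seq := EqQuotient.on Seq.
HB.instance Definition _ := Choice.on Seq.

Definition to_Seq a : Seq := \pi_Seq a.

Lemma to_SeqP a b :
  to_Seq a = to_Seq b <-> exists m : nat, forall M : nat, (m <= M)%N -> a M = b M.
Proof. by split=> [/eqmodP/asboolP|ab]; [|apply/eqmodP/asboolP]. Qed.

Lemma SeqP (P : Seq -> Prop) : (forall a, P (to_Seq a)) -> forall x, P x.
Proof. by move=> Ppi x; rewrite -[x]reprK; apply: Ppi. Qed.

Let Seq_repr a : exists m : nat, forall M : nat, (m <= M)%N -> repr (to_Seq a) M = a M.
Proof. by apply/to_SeqP; rewrite /to_Seq reprK. Qed.

Let s_opp (x : Seq) : Seq := to_Seq (fun M => - repr x M).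
Let s_add (x y : Seq) : Seq := to_Seq (fun M => repr x M + repr y M).
Let s_mul (x y : Seq) : Seq := to_Seq (fun M => repr x M * repr y M).
Definition Seq_shift (x : Seq) : Seq := to_Seq (fun M => repr x M.+1).

Let s_oppE a : s_opp (to_Seq a) = to_Seq (fun M => - a M).
Proof. by apply/to_SeqP; have [m E] := Seq_repr a; exists m => M /E ->. Qed.
Let s_addE a b : s_add (to_Seq a) (to_Seq b) = to_Seq (fun M => a M + b M).
Proof.
apply/to_SeqP; have [m E] := Seq_repr a; have [m' E'] := Seq_repr b.
by exists (maxn m m') => M; rewrite geq_max => /andP[/E -> /E' ->].
Qed.
Let s_mulE a b : s_mul (to_Seq a) (to_Seq b) = to_Seq (fun M => a M * b M).
Proof.
apply/to_SeqP; have [m E] := Seq_repr a; have [m' E'] := Seq_repr b.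
by exists (maxn m m') => M; rewrite geq_max => /andP[/E -> /E' ->].
Qed.
Lemma Seq_shiftE a : Seq_shift (to_Seq a) = to_Seq (fun M => a M.+1).
Proof.
apply/to_SeqP; have [m E] := Seq_repr a; exists m => M mM.
by apply: E; apply: leqW.
Qed.

Let eq_to_Seq a b : (forall M, a M = b M) -> to_Seq a = to_Seq b.
Proof. by move=> E; apply/to_SeqP; exists 0 => M _. Qed.

Let s_addA : associative s_add.
Proof.
elim/SeqP=> a; elim/SeqP=> b; elim/SeqP=> c; rewrite !s_addE.
by apply: eq_to_Seq => M; rewrite addrA.
Qed.
Let s_addC : commutative s_add.
Proof.
by elim/SeqP=> a; elim/SeqP=> b; rewrite !s_addE; apply: eq_to_Seq => M; rewrite addrC.
Qed.
Let s_add0 : left_id (to_Seq (fun=> 0)) s_add.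
Proof. by elim/SeqP=> a; rewrite s_addE; apply: eq_to_Seq => M; rewrite add0r. Qed.
Let s_addN : left_inverse (to_Seq (fun=> 0)) s_opp s_add.
Proof. by elim/SeqP=> a; rewrite s_oppE s_addE; apply: eq_to_Seq => M; rewrite addNr. Qed.

HB.instance Definition _ := GRing.isZmodule.Build Seq s_addA s_addC s_add0 s_addN.

Let s_mulA : associative s_mul.
Proof.
elim/SeqP=> a; elim/SeqP=> b; elim/SeqP=> c; rewrite !s_mulE.
by apply: eq_to_Seq => M; rewrite mulrA.
Qed.
Let s_mulC : commutative s_mul.
Proof.
by elim/SeqP=> a; elim/SeqP=> b; rewrite !s_mulE; apply: eq_to_Seq => M; rewrite mulrC.
Qed.
Let s_mul1 : left_id (to_Seq (fun=> 1)) s_mul.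
Proof. by elim/SeqP=> a; rewrite s_mulE; apply: eq_to_Seq => M; rewrite mul1r. Qed.
Let s_mulDl : left_distributive s_mul +%R.
Proof.
elim/SeqP=> a; elim/SeqP=> b; elim/SeqP=> c.
rewrite [to_Seq a + _]s_addE !s_mulE [RHS]s_addE.
by apply: eq_to_Seq => M; rewrite mulrDl.
Qed.
Let s_one_neq0 : to_Seq (fun=> 1) != 0.
Proof. by apply/eqP => /to_SeqP[m /(_ m (leqnn m))] /eqP; rewrite oner_eq0. Qed.

HB.instance Definition _ := GRing.Zmodule_isComNzRing.Build Seq
  s_mulA s_mulC s_mul1 s_mulDl s_one_neq0.

Lemma to_SeqD a b : to_Seq a + to_Seq b = to_Seq (fun M => a M + b M).
Proof. exact: s_addE. Qed.
Lemma to_SeqN a : - to_Seq a = to_Seq (fun M => - a M).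
Proof. exact: s_oppE. Qed.
Lemma to_SeqM a b : to_Seq a * to_Seq b = to_Seq (fun M => a M * b M).
Proof. exact: s_mulE. Qed.

Lemma Seq_shift_zmod : zmod_morphism Seq_shift.
Proof.
elim/SeqP=> a; elim/SeqP=> b.
by rewrite to_SeqN to_SeqD !Seq_shiftE to_SeqN to_SeqD.
Qed.
Lemma Seq_shift_monoid : monoid_morphism Seq_shift.
Proof.
split; first by rewrite [LHS]Seq_shiftE.
by elim/SeqP=> a; elim/SeqP=> b; rewrite to_SeqM !Seq_shiftE to_SeqM.
Qed.

HB.instance Definition _ :=
  GRing.isZmodMorphism.Build Seq Seq Seq_shift Seq_shift_zmod.
HB.instance Definition _ :=
  GRing.isMonoidMorphism.Build Seq Seq Seq_shift Seq_shift_monoid.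

(* In characteristic 0 the denominator vanishes at finitely many M only, so the
   totalized division there is immaterial. *)
Definition ratfun_Seq (x : ratfun k) : Seq :=
  to_Seq (fun M => (ratfun_num x).[M%:R] / (ratfun_den x).[M%:R]).

Section Char0.
Hypothesis k0 : [pchar k] =i pred0.

Let natr_inj : injective (fun M : nat => M%:R : k).
Proof.
suff H (a b : nat) : a%:R = b%:R :> k -> (a <= b)%N.
  by move=> a b E; apply/eqP; rewrite eqn_leq !H.
move=> E; rewrite leqNgt; apply/negP => ba.
have /eqP : (a - b)%:R = 0 :> k by rewrite natrB ?E ?subrr // ltnW.
by have /pcharf0P -> := k0; rewrite subn_eq0 leqNgt ba.
Qed.

Let nonroot (p : {poly k}) : p != 0 ->
  exists m : nat, forall M : nat, (m <= M)%N -> p.[M%:R] != 0.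
Proof.
move=> p0; apply: contrapT => /forallNP H.
have {}H m : exists M : nat, (m <= M)%N /\ root p M%:R.
  have /existsNP[M /not_implyP[mM /negP]] := H m; rewrite negbK => rM.
  by exists M.
have [f fmon froot] : exists2 f : nat -> nat,
    (forall i j, (i < j)%N -> (f i < f j)%N) & forall i, root p (f i)%:R.
  have [g gP] := choice H.
  exists (fun i => iter i.+1 (fun x => g x.+1) 0).
    move=> i j; elim: j => // j IH; rewrite ltnS leq_eqVlt => /predU1P[<-|/IH lt].
      by rewrite [X in (_ < X)%N]iterS; case: (gP (iter i.+1 (fun x => g x.+1) 0).+1).
    by apply: (ltn_trans lt); rewrite [X in (_ < X)%N]iterS; case: (gP (iter j.+1 (fun x => g x.+1) 0).+1).
  by move=> i; rewrite iterS; case: (gP (iter i (fun x => g x.+1) 0).+1).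
have := @max_poly_roots _ p [seq (f i)%:R | i <- iota 0 (size p)] p0.
rewrite size_map size_iota ltnn => /(_ _ _)/negP []//.
  by apply/allP => _ /mapP[i _ ->].
rewrite map_inj_uniq ?iota_uniq // => i j /natr_inj E.
by case: (ltngtP i j) => // /fmon; rewrite E ltnn.
Qed.

Lemma ratfun_SeqE (n d : {poly k}) : d != 0 ->
  ratfun_Seq (FracField.tofrac n / FracField.tofrac d)
  = to_Seq (fun M => n.[M%:R] / d.[M%:R]).
Proof.
move=> d0; set x := (X in ratfun_Seq X).
have dx := ratfun_den_neq0 x.
have /(ratfun_eq _ _ dx d0) E := esym (ratfun_numden x).
have [[m Hm] [m' Hm']] := (nonroot d0, nonroot dx).
apply/to_SeqP; exists (maxn m m') => M; rewrite geq_max => /andP[/Hm ? /Hm' ?].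
by apply/eqP; rewrite eqr_div // -!hornerM E.
Qed.

Lemma ratfun_Seq_zmod : zmod_morphism ratfun_Seq.
Proof.
move=> x y; rewrite [x in LHS]ratfun_numden [y in LHS]ratfun_numden.
have [dx dy] := (ratfun_den_neq0 x, ratfun_den_neq0 y).
rewrite -mulNr addf_div ?tofrac_eq0 // -tofracN -!tofracM -tofracD.
rewrite ratfun_SeqE ?mulf_neq0 // to_SeqN to_SeqD.
have [[m Hm] [m' Hm']] := (nonroot dx, nonroot dy).
apply/to_SeqP; exists (maxn m m') => M; rewrite geq_max => /andP[/Hm ? /Hm' ?].
by rewrite -mulNr addf_div // !hornerE.
Qed.

Lemma ratfun_Seq_monoid : monoid_morphism ratfun_Seq.
Proof.
split.
  have := ratfun_SeqE 1 (oner_neq0 _); rewrite !rmorph1 divr1 => ->.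
  by apply: eq_to_Seq => M; rewrite hornerE divr1.
move=> x y; rewrite [x in LHS]ratfun_numden [y in LHS]ratfun_numden.
have [dx dy] := (ratfun_den_neq0 x, ratfun_den_neq0 y).
rewrite mulf_div -!tofracM ratfun_SeqE ?mulf_neq0 // to_SeqM.
by apply: eq_to_Seq => M; rewrite !hornerM mulf_div.
Qed.

Lemma ratfun_Seq_shift x : Seq_shift (ratfun_Seq x) = ratfun_Seq (ratfun_shift x).
Proof.
have dx := ratfun_den_neq0 x.
rewrite Seq_shiftE ratfun_SeqE; last first.
  by rewrite comp_poly2_eq0 // -[1]polyC1 size_XaddC.
by apply: eq_to_Seq => M; rewrite !horner_comp !hornerE natr1.
Qed.

End Char0.
End Seq.

(* The candidates are subsets R of an ambient difference ring S, in which k(s)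
   is embedded by iota. *)
Section PicardVessiot.
Variables (k : fieldType) (S : comNzRingType) (sigma : {rmorphism S -> S}).
Variable iota : ratfun k -> S.

Definition is_subring (R : S -> Prop) : Prop :=
  [/\ R 1, forall x y, R x -> R y -> R (x - y)
    & forall x y, R x -> R y -> R (x * y)].

Record diff_extension (R : S -> Prop) : Prop := {
  de_subring : is_subring R;
  de_zmod : zmod_morphism iota;
  de_monoid : monoid_morphism iota;
  de_base : forall a, R (iota a);
  de_shift : forall a, sigma (iota a) = iota (ratfun_shift a);
  de_stable : forall x, R x -> R (sigma x);
  de_inj : forall x y, R x -> R y -> sigma x = sigma y -> x = y;
  de_surj : forall x, R x -> exists2 y, R y & sigma y = x
}.

Definition sigma_ideal (R I : S -> Prop) : Prop :=
  [/\ forall x, I x -> R x, I 0, forall x y, I x -> I y -> I (x + y),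
      forall a x, R a -> I x -> I (a * x) & forall x, I x -> I (sigma x)].

Definition sigma_simple (R : S -> Prop) : Prop :=
  forall I, sigma_ideal R I ->
    (forall x, I x -> x = 0) \/ (forall x, R x -> I x).

Record PV_ring (R : S -> Prop) n (A : 'M[ratfun k]_n) (Z : 'M[S]_n) : Prop := {
  pv_system : A \in unitmx;
  pv_extension : diff_extension R;
  pv_simple : sigma_simple R;
  pv_entries : forall i j, R (Z i j);
  pv_solution : map_mx sigma Z = map_mx iota A *m Z;
  pv_generated : exists d, [/\ R d, \det Z * d = 1 &
    forall T, is_subring T -> (forall a, T (iota a)) ->
      (forall i j, T (Z i j)) -> T d -> forall x, R x -> T x]
}.

(* Only the restriction of phi to R is constrained. *)
Record sigma_aut (R : S -> Prop) (phi : S -> S) : Prop := {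
  aut_stable : forall x, R x -> R (phi x);
  aut_inj : forall x y, R x -> R y -> phi x = phi y -> x = y;
  aut_surj : forall x, R x -> exists2 y, R y & phi y = x;
  aut_add : forall x y, R x -> R y -> phi (x + y) = phi x + phi y;
  aut_mul : forall x y, R x -> R y -> phi (x * y) = phi x * phi y;
  aut_base : forall a, phi (iota a) = iota a;
  aut_shift : forall x, R x -> phi (sigma x) = sigma (phi x)
}.

Definition aut_matrix n (Z : 'M[S]_n) (phi : S -> S) (c : 'M[k]_n) : Prop :=
  c \in unitmx /\ map_mx phi Z = Z *m map_mx (iota \o @ratfun_cst k) c.

(* The k-points of the difference Galois group, as a subset H of GL_n(k): every
   automorphism is Z |-> Z c for some c in GL_n(k), and H consists of these c. *)
Definition is_galois_group (R : S -> Prop) n (Z : 'M[S]_n)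
    (H : 'M[k]_n -> Prop) : Prop :=
  (forall phi, sigma_aut R phi -> exists c, aut_matrix Z phi c) /\
  (forall c, H c <-> exists2 phi, sigma_aut R phi & aut_matrix Z phi c).

End PicardVessiot.

Section System.
Variables (k : fieldType) (N : nat).

Local Notation dimN := (\dim {: freeLieN k N}).

Definition theta (F : {mpoly (ratfun k)[dimN]}) : Seq k :=
  mmap (@ratfun_Seq k) (fun i => to_Seq (fun M => log_coord i (Phi k N M))) F.

Lemma thetaE (k0 : [pchar k] =i pred0) (f : unip_fun k N) :
  theta (map_mpoly (@ratfun_cst k) f) = to_Seq (fun M => fun_at f (Phi k N M)).
Proof.
pose io : {rmorphism ratfun k -> Seq k} := HB.pack (@ratfun_Seq k)
  (GRing.isZmodMorphism.Build _ _ (@ratfun_Seq k) (ratfun_Seq_zmod k0))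
  (GRing.isMonoidMorphism.Build _ _ (@ratfun_Seq k) (ratfun_Seq_monoid k0)).
rewrite /theta.
have ioc c : io (@ratfun_cst k c) = to_Seq (fun=> c).
  rewrite /= /ratfun_cst.
  set y := FracField.tofrac _.
  have -> : y = FracField.tofrac c%:P / FracField.tofrac 1 by rewrite tofrac1 divr1.
  rewrite ratfun_SeqE ?oner_neq0 //.
  apply/to_SeqP; exists 0 => M _; by rewrite !hornerE divr1.
pose h i := to_Seq (fun M => log_coord i (Phi k N M)).
change (mmap io h (map_mpoly (@ratfun_cst k) f) = to_Seq (fun M => fun_at f (Phi k N M))).
have hm (m : 'X_{1.. \dim {: freeLieN k N}}) : mmap1 h m = to_Seq (fun M => mmap1 (fun i => log_coord i (Phi k N M)) m).
  have tX a e : to_Seq a ^+ e = to_Seq (fun M => a M ^+ e) :> Seq k.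
    elim: e => [|e IH]; first by rewrite expr0.
    by rewrite exprS IH to_SeqM; apply/to_SeqP; exists 0 => M _; rewrite exprS.
  rewrite /mmap1.
  have tP (r : seq 'I_(\dim {: freeLieN k N})) (G : 'I_(\dim {: freeLieN k N}) -> nat -> k) :
     \prod_(i <- r) to_Seq (G i) = to_Seq (fun M => \prod_(i <- r) G i M) :> Seq k.
    elim: r => [|i r IH].
      by rewrite big_nil; apply/to_SeqP; exists 0 => M _; rewrite big_nil.
    by rewrite big_cons IH to_SeqM; apply/to_SeqP; exists 0 => M _; rewrite big_cons.
  by under eq_bigr do rewrite tX; rewrite tP.
have E (c : k) m : mmap io h (map_mpoly (@ratfun_cst k) (c *: 'X_[m])) =
    to_Seq (fun M => c * mmap1 (fun i => log_coord i (Phi k N M)) m).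
  rewrite (map_mpolyZ (@ratfun_cst k)) map_mpolyX mmapZ mmapX hm ioc.
  by rewrite to_SeqM.
rewrite [in LHS](mpolyE f) (raddf_sum (map_mpoly (@ratfun_cst k))) (raddf_sum (mmap io h)).
rewrite (_ : (fun M => fun_at f _) = fun M => \sum_(m <- msupp f) f@_m * mmap1 (fun i => log_coord i (Phi k N M)) m); last first.
  by apply/funext => M.
elim: (msupp f) => [|m r IH].
  by rewrite big_nil; apply/to_SeqP; exists 0 => M _; rewrite big_nil.
rewrite big_cons; apply: etrans (congr2 +%R (E _ _) IH) _.
by rewrite to_SeqD; apply/to_SeqP; exists 0 => M _; rewrite big_cons.
Qed.

Definition R_N (x : Seq k) : Prop := exists F, theta F = x.

(* log coordinates of the k(s)-point a_N(s) = exp(\sum_m e_m (s+1)^-m) *)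
Definition a_N (i : 'I_dimN) : ratfun k :=
  \sum_(1 <= m < N.+1)
    (s_var k + 1)^-1 ^+ m
    * ratfun_cst (coord (vbasis {: freeLieN k N}) i (gen k N m)).

Definition A_N n (rho : 'M[unip_fun k N]_n) : 'M[ratfun k]_n :=
  map_mx (mmap (@ratfun_cst k) a_N) rho.

Definition Y_N n (rho : 'M[unip_fun k N]_n) : 'M[Seq k]_n :=
  \matrix_(i, j) to_Seq (fun M => rep_at rho (Phi k N M) i j).

End System.

(* Main.v *)
Require Import Defs.
From HB Require Import structures.
From mathcomp Require Import all_boot all_order all_algebra.
From mathcomp Require Import boolp classical_sets functions.
From mathcomp.multinomials Require Import mpoly.
From mathcomp Require Import ring.

Set Implicit Arguments.
Unset Strict Implicit.
Unset Printing Implicit Defensive.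

Import GRing.Theory.
Local Open Scope ring_scope.

(** Write G for the group, K for k(s) and B for K (x) O(G), a polynomial ring
    in the coordinates of the logarithm.  The proof replaces the structure
    theory of unipotent groups and of Picard-Vessiot extensions by two
    elementary facts about B.

    The first is that the shift of B (s |-> s + 1 together with left
    translation by a_N(s)) and all right translations by points of G act in a
    locally unipotent way: every f in B lies in the K-span of a finite list
    b_1, ..., b_r such that each of these operators fixes b_i up to the span of
    the b_j that follow it ([all_loc_unipotent]).  This comes from the faithful
    representation rho.  Restricting rho to one-parameter subgroups shows that
    rho (exp x) = exp (T x) with T linear, nilpotent on each x and, by the
    bidegree (1, 1) part of the Baker-Campbell-Hausdorff series, a morphism of
    Lie algebras ([rep_exp], [tangent_lie]).  Since the Lie algebra is spanned
    by weighted monomials of bounded weight, sorting words as in the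
    Poincare-Birkhoff-Witt theorem shows that long products of values of T
    vanish ([tangent_words]).  Hence the entries of p rho p', for constant
    matrices p and p', are locally unipotent by induction on how many factors
    T x annihilate p and p'.  The entries of rho generate B because the
    logarithm of a unipotent matrix is a polynomial in it ([faithful_log]).

    The second is that the shift-invariants of B are the constants k
    ([shift_invariants]).  By local unipotence it is enough to treat an
    invariant f which every right translation changes by a constant of k.  Then
    f = c + phi with c in K and phi an additive character of G, that is, a
    linear form lam on the Lie algebra which kills brackets.  Invariance means
    c(s) - c(s + 1) = sum_m lam(e_m) (s + 1)^-m, and looking at the poles of c
    along the integers gives lam(e_m) = 0 for all m
    ([shift_telescoper_trivial]).  As the e_m generate the Lie algebra, lam = 0,
    and then c is shift-invariant, hence in k.

    Consequently a nonzero shift-stable ideal of B contains 1: going down a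
    triangular list, one normalizes the leading coefficient of an element f to
    1 and replaces f by (shift f - f), until an invariant appears
    ([shift_stable_unit]).  Applied to the kernel of theta this gives
    injectivity; transported along theta it gives simplicity of R_N.

    For the Galois group, right translations of B transported to R_N provide
    the automorphisms rho(G).  Conversely an automorphism phi sends the
    coordinates of Phi(M) to those of some sequence gam(M) of points of G
    solving the same recursion, so that Phi(M)^-1 gam(M) is eventually a
    constant g, and phi is Z |-> Z rho(g) ([automorphism_translation]). *)

(** * Polynomials over a ring of characteristic zero *)

Section Vanishing.
Variables (R : idomainType) (char0 : [pchar R] =i pred0).

Lemma natr_inj_char0 : injective (fun M : nat => M%:R : R).
Proof.
suff H (a b : nat) : a%:R = b%:R :> R -> (a <= b)%N.
  by move=> a b E; apply/eqP; rewrite eqn_leq !H.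
move=> E; rewrite leqNgt; apply/negP => ba.
have /eqP : (a - b)%:R = 0 :> R by rewrite natrB ?E ?subrr // ltnW.
by have /pcharf0P -> := char0; rewrite subn_eq0 leqNgt ba.
Qed.

Lemma natrS_neq0 M : M.+1%:R != 0 :> R.
Proof. by have /pcharf0P -> := char0. Qed.

Lemma poly_nat_eq0 (p : {poly R}) : (forall M : nat, p.[M%:R] = 0) -> p = 0.
Proof.
move=> p0; apply/eqP; apply: contraT => pN0.
have := @max_poly_roots _ p [seq i%:R | i <- iota 0 (size p)] pN0.
rewrite size_map size_iota ltnn => -> //.
  by apply/allP => _ /mapP[i _ ->]; apply/rootP.
by rewrite map_inj_uniq ?iota_uniq //; apply: natr_inj_char0.
Qed.

Lemma base_expansion_inj n B (a b : 'I_n -> nat) :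
  (forall i, a i < B)%N -> (forall i, b i < B)%N ->
  (\sum_i a i * B ^ i = \sum_i b i * B ^ i)%N -> a =1 b.
Proof.
elim: n a b => [|n IH] a b aB bB; first by move=> _ [].
have B0 : (0 < B)%N by apply: leq_ltn_trans (aB ord0).
have tailE (c : 'I_n.+1 -> nat) :
    (\sum_i c i * B ^ i = (\sum_i c (lift ord0 i) * B ^ i) * B + c ord0)%N.
  rewrite addnC big_ord_recl expn0 muln1 big_distrl /=; congr (_ + _)%N.
  by apply: eq_bigr => i _; rewrite /bump /= expnS mulnA mulnAC.
rewrite !tailE => E.
have E0 : a ord0 = b ord0.
  by have := congr1 (modn^~ B) E; rewrite !modnMDl !modn_small.
have {}E : a \o lift ord0 =1 b \o lift ord0.
  apply: IH => [i|i|]; [exact: aB|exact: bB|].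
  by apply/eqP; rewrite -(eqn_pmul2r B0); apply/eqP; move: E; rewrite E0 => /addIn.
by move=> i; case: (unliftP ord0 i) => [j ->|->]; [apply: E|].
Qed.

(** Kronecker substitution: X_i |-> t^(B^i), with B larger than all exponents
    that occur, keeps distinct monomials distinct and leaves a polynomial in one
    variable with infinitely many zeros. *)
Lemma mpoly_nat_eq0 n (F : {mpoly R[n]}) :
  (forall v : 'I_n -> nat, F.@[fun i => (v i)%:R] = 0) -> F = 0.
Proof.
move=> F0; set B := msize F; pose e (m : 'X_{1..n}) := (\sum_i m i * B ^ i)%N.
pose p : {poly R} := \sum_(m <- msupp F) F@_m *: 'X^(e m).
have p0 : p = 0.
  apply: poly_nat_eq0 => M; rewrite -[RHS](F0 (fun i => (M ^ (B ^ i))%N)) mevalE.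
  rewrite /p horner_sum; apply: eq_bigr => m _; rewrite !hornerE.
  congr (_ * _); rewrite /e -natrX expn_sum natr_prod.
  by apply: eq_bigr => i _; rewrite -natrX -expnM mulnC.
have eI m m' : m \in msupp F -> m' \in msupp F -> e m = e m' -> m = m'.
  move=> mF m'F /base_expansion_inj E; apply/mnmP; apply: E => i.
    by apply: leq_ltn_trans (msize_mdeg_lt mF); rewrite mdegE (bigD1 i) //= leq_addr.
  by apply: leq_ltn_trans (msize_mdeg_lt m'F); rewrite mdegE (bigD1 i) //= leq_addr.
apply/mpolyP => m; rewrite mcoeff0; apply/eqP; rewrite mcoeff_eq0; apply/negP => mF.
have := congr1 (fun q : {poly R} => q`_(e m)) p0.
rewrite coef0 /p coef_sum (bigD1_seq m) ?msupp_uniq //= coefZ coefXn eqxx mulr1.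
rewrite big1_seq ?addr0 => [/eqP|m' /andP[m'm m'F]]; first by rewrite mcoeff_eq0 mF.
rewrite coefZ coefXn; case: eqP => [E|]; last by rewrite mulr0.
by rewrite (eI _ _ mF m'F E) eqxx in m'm.
Qed.

End Vanishing.

Section Mmap.
Variables (n : nat).

Lemma mmap_ext (R S : nzRingType) (f g : R -> S) (h h' : 'I_n -> S) (p : {mpoly R[n]}) :
  f =1 g -> h =1 h' -> mmap f h p = mmap g h' p.
Proof. by move=> fg /funext ->; apply: eq_bigr => m _; rewrite fg. Qed.

Lemma rmorph_mmap (R S S' : nzRingType) (phi : {rmorphism S -> S'}) (f : R -> S)
    (h : 'I_n -> S) (p : {mpoly R[n]}) :
  phi (mmap f h p) = mmap (phi \o f) (phi \o h) p.
Proof.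
rewrite /mmap rmorph_sum; apply: eq_bigr => m _; rewrite rmorphM rmorph_prod.
by congr (_ * _); apply: eq_bigr => i _; rewrite rmorphXn.
Qed.

Lemma mmap_X (R S : nzRingType) (f : {rmorphism R -> S}) (h : 'I_n -> S) i :
  mmap f h 'X_i = h i.
Proof. by rewrite mmapX mmap1U. Qed.

Lemma mmap_var (R : nzRingType) (p : {mpoly R[n]}) : mmap (@mpolyC n R) (fun i => 'X_i) p = p.
Proof.
rewrite [RHS]mpolyE; apply: eq_bigr => m _.
by rewrite mmap1_id mul_mpolyC.
Qed.

End Mmap.

Lemma poly_pchar0 (R : idomainType) : [pchar R] =i pred0 -> [pchar {poly R}] =i pred0.
Proof.
move=> char0 p; rewrite !inE; apply/andP => -[pp /eqP p0].
have := char0 p; rewrite !inE pp /=.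
by move/eqP: p0; rewrite -polyC_natr polyC_eq0 => ->.
Qed.

Lemma poly2_nat_eq0 (k : fieldType) (char0 : [pchar k] =i pred0) (p : {poly {poly k}}) :
  (forall s t : k, p.[t%:P].[s] = 0) -> p = 0.
Proof.
move=> p0; apply: (poly_nat_eq0 (poly_pchar0 char0)) => M.
by apply: (poly_nat_eq0 char0) => M'; rewrite -polyC_natr p0.
Qed.

(** * The Baker-Campbell-Hausdorff series up to bidegree (1, 1) *)

Lemma sum_tuple1 (T : finType) (V : nmodType) (P : pred (1.-tuple T)) (F : 1.-tuple T -> V) :
  \sum_(p | P p) F p = \sum_(z | P [tuple z]) F [tuple z].
Proof.
apply: (reindex (fun z : T => [tuple z])).
exists (fun p => tnth p ord0) => [z _|p _]; first by [].
apply/val_inj; case/tupleP: p => a p; rewrite [p]tuple0 /=.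
by rewrite (tnth_nth a).
Qed.

Lemma sum_tuple2 (T : finType) (V : nmodType) (P : pred (2.-tuple T)) (F : 2.-tuple T -> V) :
  \sum_(p | P p) F p = \sum_(z : T * T | P [tuple z.1; z.2]) F [tuple z.1; z.2].
Proof.
apply: (reindex (fun z : T * T => [tuple z.1; z.2])).
exists (fun p => (tnth p ord0, tnth p ord_max)) => [[z z'] _|p _] //=.
apply/val_inj; case/tupleP: p => a p; case/tupleP: p => b p; rewrite [p]tuple0 /=.
by rewrite !(tnth_nth a).
Qed.

Section Words.
Variables (k : fieldType) (L : lieAlgType k) (c : nat).
Implicit Types (x y : L) (p : seq ('I_c.+1 * 'I_c.+1)).

(** [true] stands for the first and [false] for the second argument of the
    series; with words spelled out in this way, rescaling the arguments
    multiplies a word by a product over its letters. *)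
Definition letters p : seq bool :=
  flatten [seq nseq rs.1 true ++ nseq rs.2 false | rs : 'I_c.+1 * 'I_c.+1 <- p].

Definition degx p : nat := (\sum_(rs <- p) rs.1)%N.
Definition degy p : nat := (\sum_(rs <- p) rs.2)%N.

Lemma word_letters x y p :
  flatten [seq nseq rs.1 x ++ nseq rs.2 y | rs : 'I_c.+1 * 'I_c.+1 <- p]
  = [seq if b then x else y | b <- letters p].
Proof.
rewrite /letters map_flatten -map_comp; congr flatten; apply: eq_map => rs /=.
by rewrite map_cat !map_nseq.
Qed.

Lemma prod_letters (a b : k) p :
  \prod_(l <- letters p) (if l then a else b) = a ^+ degx p * b ^+ degy p.
Proof.
rewrite /letters /degx /degy; elim: p => [|rs p IH].
  by rewrite !big_nil mulr1.
rewrite /= !big_cat /= IH !big_cons !exprD !big_nseq !iter_mulr_1.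
by rewrite mulrACA.
Qed.

Lemma lie_word_cons2 x y s : lie_word [:: x, y & s] = lie x (lie_word (y :: s)).
Proof. by []. Qed.

Lemma lie_word_scale (a : bool -> k) (v : bool -> L) w :
  lie_word [seq a l *: v l | l <- w] = (\prod_(l <- w) a l) *: lie_word (map v w).
Proof.
elim: w => [|l [|l' w] IH]; first by rewrite big_nil scaler0.
  by rewrite big_seq1.
rewrite !map_cons !lie_word_cons2 -!map_cons IH lieZl lieZr scalerA.
by rewrite [in RHS]big_cons.
Qed.

Definition dynkin_coef n p : k :=
  (-1) ^+ n.-1 / n%:R
       / (\sum_(rs <- p) (rs.1 + rs.2))%N%:R
       / (\prod_(rs <- p) ((rs.1)`! * (rs.2)`!))%N%:R.

Definition dynkin_word x y p : L := lie_word [seq if b then x else y | b <- letters p].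

Lemma bchE x y : bch c x y = \sum_(1 <= n < c.+1)
   \sum_(p : n.-tuple ('I_c.+1 * 'I_c.+1) | [forall i, 0 < (tnth p i).1 + (tnth p i).2]%N)
     dynkin_coef n p *: dynkin_word x y p.
Proof.
by apply: eq_bigr => n _; apply: eq_bigr => p _; rewrite word_letters.
Qed.

Lemma dynkin_wordZ a b x y p :
  dynkin_word (a *: x) (b *: y) p = (a ^+ degx p * b ^+ degy p) *: dynkin_word x y p.
Proof.
rewrite -prod_letters -lie_word_scale; congr lie_word.
by apply: eq_map => -[].
Qed.

Lemma valid_deg n (p : n.-tuple ('I_c.+1 * 'I_c.+1)) :
  [forall i, 0 < (tnth p i).1 + (tnth p i).2]%N -> (n <= degx p + degy p)%N.
Proof.
move=> /forallP vp; rewrite /degx /degy -big_split /= big_tuple.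
rewrite -[X in (X <= _)%N]card_ord -sum1_card; apply: leq_sum => i _; exact: vp.
Qed.

Lemma size_letters p : size (letters p) = (degx p + degy p)%N.
Proof.
rewrite size_flatten /shape -map_comp sumnE big_map /degx /degy -big_split /=.
by apply: eq_bigr => rs _; rewrite size_cat !size_nseq.
Qed.

Lemma dynkin_word_diag x p : (1 < size (letters p))%N -> dynkin_word x x p = 0.
Proof.
have E w : (1 < size w)%N -> lie_word [seq if b then x else x | b : bool <- w] = 0.
  elim: w => [|l [|l' [|l'' w]] IH] // _; first by rewrite /= !if_same lie_alt.
  by rewrite !map_cons lie_word_cons2 -!map_cons IH ?lie0r.
exact: E.
Qed.

End Words.

Section Dynkin.
Variables (k : fieldType) (char0 : [pchar k] =i pred0) (L : lieAlgType k) (N : nat).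
Hypothesis N1 : (1 <= N)%N.
Implicit Types (x y : L).

Lemma lie_antisym x y : lie x y = - lie y x :> L.
Proof.
apply/eqP; rewrite -addr_eq0; apply/eqP; have := lie_alt (x + y).
by rewrite lieDl !lieDr !lie_alt add0r addr0.
Qed.

Lemma inord1_val : (inord 1 : 'I_N.+1) = 1%N :> nat.
Proof. by rewrite inordK. Qed.

(** A bracket word with at least two letters, all multiples of x, is zero; the
    only surviving words are the two one-letter words. *)
Lemma bch_line a b x : bch N (a *: x) (b *: x) = (a + b) *: x :> L.
Proof.
rewrite bchE big_ltn ?ltnS // [X in _ + X]big1_seq ?addr0; last first.
  move=> n /andP[_]; rewrite mem_index_iota => /andP[n2 _].
  apply: big1 => p /valid_deg np.
  rewrite dynkin_wordZ dynkin_word_diag ?scaler0 // size_letters.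
  exact: leq_trans np.
rewrite sum_tuple1 (bigD1 (inord 1, ord0)) /=; last first.
  by apply/forallP => i; rewrite (tnth_nth (ord0, ord0)) ord1 /= inord1_val.
rewrite (bigD1 (ord0, inord 1)) /=; last first.
  rewrite -pair_eqE /= -!val_eqE /= inord1_val andbT.
  by apply/forallP => i; rewrite (tnth_nth (ord0, ord0)) ord1 /= inord1_val.
rewrite [X in _ + (_ + X)]big1 ?addr0.
  rewrite /dynkin_coef !dynkin_wordZ /degx /degy /dynkin_word /letters.
  rewrite !big_seq1 /= !inord1_val /= !(fact0, factS) /= !divr1 mul1r.
  by rewrite !expr0 !expr1 mulr1 !scale1r scalerDl.
move=> [r s] /andP[/andP[/forallP/(_ ord0)]].
rewrite (tnth_nth (ord0, ord0)) /= -!pair_eqE /= -!val_eqE /= inord1_val => rs0 n1 n2.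
rewrite dynkin_wordZ dynkin_word_diag ?scaler0 // size_letters /degx /degy !big_seq1 /=.
case: r s rs0 n1 n2 => [[|[|r]] ?] [[|[|s]] ?] //=.
Qed.

(** The inner variable carries the multiplicity of x and the outer one that of
    y: the value at (s, t) is mu (bch (s x) (t y)), see [bch_poly_eval]. *)
Definition bch_poly (mu : L -> k) x y : {poly {poly k}} :=
  \sum_(1 <= n < N.+1)
   \sum_(p : n.-tuple ('I_N.+1 * 'I_N.+1) | [forall i, 0 < (tnth p i).1 + (tnth p i).2]%N)
     ((dynkin_coef k n p * mu (dynkin_word x y p)) *: 'X^(degx p))%:P * 'X^(degy p).

Lemma bch_poly_eval (mu : {scalar L}) x y s t :
  (bch_poly mu x y).[t%:P].[s] = mu (bch N (s *: x) (t *: y)).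
Proof.
rewrite /bch_poly bchE linear_sum !horner_sum; apply: eq_bigr => n _.
rewrite linear_sum !horner_sum; apply: eq_bigr => p _.
rewrite dynkin_wordZ scalerA linearZ !hornerE /=.
by rewrite [in LHS](mulrAC (dynkin_coef _ _ _)) [LHS]mulrAC.
Qed.

Lemma coef_bch_poly (mu : {scalar L}) x y i j :
  (bch_poly mu x y)`_j`_i = \sum_(1 <= n < N.+1)
   \sum_(p : n.-tuple ('I_N.+1 * 'I_N.+1) |
          [forall i, 0 < (tnth p i).1 + (tnth p i).2]%N
          && ((degx p == i) && (degy p == j)))
     dynkin_coef k n p * mu (dynkin_word x y p).
Proof.
rewrite /bch_poly !coef_sum; apply: eq_bigr => n _.
rewrite !coef_sum [RHS]big_mkcondr; apply: eq_bigr => p _.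
rewrite coefCM coefXn [j == _]eq_sym; case: (degy p == j); last by rewrite mulr0 coef0 andbF.
rewrite mulr1 coefZ coefXn [i == _]eq_sym andbT.
by case: (degx p == i); rewrite ?mulr1 ?mulr0.
Qed.

Lemma bch_poly00 (mu : {scalar L}) x y : (bch_poly mu x y)`_0`_0 = 0.
Proof.
rewrite coef_bch_poly big1_seq // => n /andP[_]; rewrite mem_index_iota => /andP[n1 _].
apply: big1 => p /andP[/valid_deg np /andP[/eqP i0 /eqP j0]].
by move: np; rewrite i0 j0 leqNgt n1.
Qed.

(** The word xy counted as a single pair (1, 1) contributes [x, y] / 2.  The two
    ways of spreading the letters over two pairs contribute -1/4 each of [x, y]
    and [y, x], and cancel. *)
Lemma bch_poly11 (mu : {scalar L}) x y :
  (bch_poly mu x y)`_1`_1 = mu (lie x y) / 2%:R.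
Proof.
have two0 : 2%:R != 0 :> k by apply: natrS_neq0.
rewrite coef_bch_poly big_ltn ?ltnS //.
rewrite sum_tuple1 (big_pred1 (inord 1, inord 1)); last first.
  move=> [r s] /=; rewrite /degx /degy !big_seq1 -pair_eqE /= -!val_eqE /= inord1_val.
  case: (eqVneq (r : nat) 1%N) => [r1|]; last by rewrite andbF.
  case: (eqVneq (s : nat) 1%N) => [s1|]; rewrite ?andbF //= andbT.
  by apply/forallP => i; rewrite (tnth_nth (r, s)) ord1 /= r1.
rewrite {1}/dynkin_coef {1}/dynkin_word {1}/letters !big_seq1 /= !inord1_val /=.
rewrite [X in _ + X = _](_ : _ = 0) ?addr0; last first.
  have [N2|] := ltnP 1 N; last by move=> N2; rewrite big_geq.
  rewrite big_ltn ?ltnS // [X in _ + X]big1_seq ?addr0; last first.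
    move=> n /andP[_]; rewrite mem_index_iota => /andP[n3 _].
    apply: big1 => p /andP[/valid_deg np /andP[/eqP i0 /eqP j0]].
    by move: np; rewrite i0 j0 leqNgt n3.
  rewrite sum_tuple2.
  pose e10 : 'I_N.+1 * 'I_N.+1 := (inord 1, ord0).
  pose e01 : 'I_N.+1 * 'I_N.+1 := (ord0, inord 1).
  rewrite (bigD1 (e10, e01)) /=; last first.
    rewrite /degx /degy !big_cons !big_nil /= !inord1_val /= andbT.
    by apply/forallP => -[[|[|i]] ?]; rewrite (tnth_nth e10) //= ?inord1_val.
  rewrite (bigD1 (e01, e10)) /=; last first.
    rewrite /degx /degy !big_cons !big_nil /= !inord1_val /= andbT !xpair_eqE -!val_eqE /= inord1_val /=.
    by rewrite ?andbT; apply/forallP => -[[|[|i]] ?]; rewrite (tnth_nth e10) //= ?inord1_val.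
  rewrite [X in _ + (_ + X)]big1 ?addr0; last first.
    move=> [[r s] [r' s']] /=; rewrite /degx /degy !big_cons !big_nil /= !addn0.
    move=> /andP[/andP[/andP[/forallP vp]]].
    have := vp ord0; have := vp ord_max; rewrite !(tnth_nth e10) /= !xpair_eqE -!val_eqE /= inord1_val.
    case: r s r' s' {vp} => [[|[|r]] ?] [[|[|s]] ?] [[|[|r']] ?] [[|[|s']] ?] //=.
  rewrite /dynkin_coef /dynkin_word /letters !big_cons !big_nil /= !inord1_val /=.
  rewrite [lie y x]lie_antisym linearN expr1.
  by field; rewrite two0 oner_neq0.
by rewrite expr0 divr1; field; rewrite two0 oner_neq0.
Qed.

End Dynkin.

(** * Representations along one-parameter subgroups *)

Section OneParameter.
Variables (k : fieldType) (char0 : [pchar k] =i pred0) (N : nat).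
Hypothesis N1 : (1 <= N)%N.
Local Notation L := (freeLieN k N).
Local Notation coordL := (coord (vbasis {: L})).
Implicit Types (x y : L) (g h : unip k N).

(** The restriction of f to the one-parameter subgroup t |-> exp (t x), as a
    polynomial in t. *)
Definition line (f : unip_fun k N) x : {poly k} :=
  mmap (@polyC k) (fun i => coordL i x *: 'X) f.

Lemma fun_at_exp (f : unip_fun k N) x : fun_at f (Exp x) = mmap idfun (coordL^~ x) f.
Proof. by []. Qed.

Lemma line_eval f x t : (line f x).[t] = fun_at f (Exp (t *: x)).
Proof.
rewrite -/(horner_eval t (line f x)) rmorph_mmap fun_at_exp; apply: mmap_ext => [c|i] /=.
  by rewrite /horner_eval hornerC.
by rewrite /horner_eval !hornerE linearZ /= mulrC.
Qed.

Lemma lineE f x : line f x =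
  \sum_(m <- msupp f) (f@_m * mmap1 (coordL^~ x) m) *: 'X^(mdeg m).
Proof.
apply: eq_bigr => m _; rewrite -scalerA mul_polyC; congr (_ *: _).
rewrite /mmap1 -mul_polyC rmorph_prod /= mdegE -prodrXr -big_split /=.
by apply: eq_bigr => i _; rewrite exprZn -mul_polyC rmorphXn.
Qed.

Lemma size_line f x : (size (line f x) <= msize f)%N.
Proof.
rewrite lineE; apply: (leq_trans (size_sum _ _ _)); apply/bigmax_leqP_seq => m mf _.
by apply: (leq_trans (size_scale_leq _ _)); rewrite size_polyXn msize_mdeg_lt.
Qed.

(** Only the monomials of degree one contribute to the coefficient of t. *)
Lemma line_coef1_linear f : linear (fun x => (line f x)`_1 : k^o).
Proof.
move=> a x y; rewrite !lineE !coef_sum scaler_sumr -big_split; apply: eq_bigr => m _ /=.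
rewrite !coefZ !coefXn [1%N == _]eq_sym; have [/eqP/mdeg1P[i /eqP ->]|_] := eqVneq (mdeg m) 1%N.
  by rewrite !mmap1U !mulr1 linearP /= mulrDr /GRing.scale /= mulrCA.
by rewrite !mulr0 scaler0 addr0.
Qed.

Variables (n : nat) (rho : 'M[unip_fun k N]_n).

(** The representations of interest are the given faithful one and the
    two-dimensional ones attached to additive characters ([char_rep_unip]). *)
Record unip_rep : Prop := {
  rep_one : rep_at rho (unip1 k N) = 1%:M;
  rep_prod : forall g h, rep_at rho (unip_mul g h) = rep_at rho g *m rep_at rho h
}.

(** The derivative of rho (exp (t x)) at t = 0. *)
Definition tangent x : 'M[k]_n := \matrix_(i, j) (line (rho i j) x)`_1.

Lemma tangent_linear : linear tangent.
Proof.
by move=> a x y; apply/matrixP => i j; rewrite !mxE [LHS]line_coef1_linear.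
Qed.
HB.instance Definition _ := GRing.isLinear.Build k L 'M[k]_n *:%R tangent tangent_linear.

(** A bound for the degree of rho, hence for the degree of rho (exp (t x)) in t. *)
Definition rep_size : nat := (\max_i \max_j msize (rho i j))%N.

Lemma msize_rep i j : (msize (rho i j) <= rep_size)%N.
Proof.
exact: leq_trans (@leq_bigmax _ (fun j => msize (rho i j)) j)
  (@leq_bigmax _ (fun i => \max_j msize (rho i j))%N i).
Qed.

Hypothesis rhoP : unip_rep.

Let P x m : 'M[k]_n := \matrix_(i, j) (line (rho i j) x)`_m.

Let P0 x : P x 0 = 1%:M.
Proof.
rewrite -(rep_one rhoP); apply/matrixP => i j.
by rewrite !mxE -horner_coef0 line_eval scale0r.
Qed.

(** Differentiating rho (exp ((s + t) x)) = rho (exp (s x)) rho (exp (t x)) in t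
    at t = 0. *)
Let line_deriv x i j :
  (line (rho i j) x)^`() = \sum_l tangent x l j *: line (rho i l) x.
Proof.
apply/eqP; rewrite -subr_eq0; apply/eqP; apply: (poly_nat_eq0 char0) => M.
set s : k := M%:R; apply/eqP; rewrite !hornerE subr_eq0; apply/eqP.
have E : line (rho i j) x \Po ('X + s%:P)
       = \sum_l (line (rho i l) x).[s] *: line (rho l j) x.
  apply/eqP; rewrite -subr_eq0; apply/eqP; apply: (poly_nat_eq0 char0) => M'.
  apply/eqP; rewrite !hornerE subr_eq0 horner_comp !hornerE; apply/eqP.
  rewrite line_eval addrC -(bch_line N1) -/(unip_mul (Exp (s *: x)) (Exp (M'%:R *: x))).
  have := congr1 (fun Q : 'M_n => Q i j) (rep_prod rhoP (Exp (s *: x)) (Exp (M'%:R *: x))).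
  rewrite !mxE => ->; rewrite horner_sum; apply: eq_bigr => l _.
  by rewrite !mxE !hornerE !line_eval.
have := congr1 (fun p : {poly k} => p^`().[0]) E.
rewrite deriv_comp !derivE addr0 mulr1 horner_comp !hornerE => ->.
rewrite raddf_sum !horner_sum; apply: eq_bigr => l _ /=.
by rewrite !derivE !hornerE mxE horner_coef0 coef_deriv mulr1n mulrC.
Qed.

Let PS x m : P x m.+1 *+ m.+1 = P x m *m tangent x.
Proof.
apply/matrixP => i j; rewrite [RHS]mxE.
have := congr1 (fun p : {poly k} => p`_m) (line_deriv x i j).
rewrite coef_deriv mulmxnE mxE => ->; rewrite coef_sum; apply: eq_bigr => l _.
by rewrite coefZ !mxE mulrC.
Qed.

Let PE x m : P x m = (m`!%:R)^-1 *: tangent x ^+ m.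
Proof.
elim: m => [|m IH]; first by rewrite P0 fact0 invr1 scale1r expr0.
apply: (scalerI (natrS_neq0 char0 m)); rewrite scaler_nat PS IH.
rewrite exprSr -scalemxAl scalerA factS natrM invfM mulrA.
by rewrite divff ?mul1r // natrS_neq0.
Qed.

(** The powers of T x are, up to factorials, the coefficients of a polynomial in
    t. *)
Lemma tangent_nilp x r : (rep_size <= r)%N -> tangent x ^+ r = 0.
Proof.
move=> lr; have r0 : (r`!%:R : k)^-1 != 0.
  by rewrite invr_eq0; have /pcharf0P -> := char0; rewrite -lt0n fact_gt0.
apply: (scalerI r0); rewrite -PE scaler0; apply/matrixP => i j; rewrite !mxE.
by apply/nth_default/(leq_trans (size_line _ _))/(leq_trans (msize_rep _ _)).
Qed.

(** The equation P' = P T for P(t) = rho (exp (t x)) determines the coefficients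
    of P from P(0) = 1. *)
Lemma rep_exp x r : (rep_size <= r)%N ->
  rep_at rho (Exp x) = \sum_(m < r) (m`!%:R)^-1 *: tangent x ^+ m.
Proof.
move=> lr; apply/matrixP => i j; rewrite mxE -[x in LHS]scale1r -line_eval.
rewrite (@horner_coef_wide _ r); last first.
  exact/(leq_trans (size_line _ _))/(leq_trans (msize_rep _ _)).
rewrite summxE; apply: eq_bigr => m _.
by rewrite -PE mxE expr1n mulr1.
Qed.

Lemma rep_exp_sub1 x : rep_at rho (Exp x) - 1%:M
  = \sum_(m < rep_size) (m.+1`!%:R)^-1 *: tangent x ^+ m.+1.
Proof.
rewrite (@rep_exp _ rep_size.+1) // big_ord_recl fact0 invr1 scale1r expr0.
by rewrite addrAC subrr add0r.
Qed.

End OneParameter.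

(** * The differential of a representation is a Lie morphism *)

Section BiCoefficients.
Variables (k : fieldType) (n : nat).
Implicit Types A B D : 'M[{poly {poly k}}]_n.

(** The coefficient of s^i t^j, where s is the inner and t the outer variable. *)
Definition bicoef i j (p : {poly {poly k}}) : k := p`_j`_i.
Definition mxcoef i j A : 'M[k]_n := map_mx (bicoef i j) A.

Lemma bicoef_linear i j : zmod_morphism (bicoef i j).
Proof. by move=> p q; rewrite /bicoef !coefB. Qed.
HB.instance Definition _ i j :=
  GRing.isZmodMorphism.Build {poly {poly k}} k (bicoef i j) (bicoef_linear i j).

Lemma mxcoefM00 A B : mxcoef 0 0 (A *m B) = mxcoef 0 0 A *m mxcoef 0 0 B.
Proof.
apply/matrixP => a b; rewrite !mxE raddf_sum; apply: eq_bigr => c _.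
by rewrite /= !mxE /bicoef !coefM !big_ord1 !coefM !big_ord1.
Qed.

Lemma mxcoefM10 A B : mxcoef 1 0 (A *m B)
  = mxcoef 0 0 A *m mxcoef 1 0 B + mxcoef 1 0 A *m mxcoef 0 0 B.
Proof.
apply/matrixP => a b; rewrite !mxE raddf_sum -big_split; apply: eq_bigr => c _.
by rewrite /= !mxE /bicoef !coefM !big_ord1 !coefM !big_ord_recl !big_ord0 addr0.
Qed.

Lemma mxcoefM01 A B : mxcoef 0 1 (A *m B)
  = mxcoef 0 0 A *m mxcoef 0 1 B + mxcoef 0 1 A *m mxcoef 0 0 B.
Proof.
apply/matrixP => a b; rewrite !mxE raddf_sum -big_split; apply: eq_bigr => c _.
rewrite /= !mxE /bicoef !coefM !big_ord_recl !big_ord0 addr0 coefD.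
by rewrite !coefM !big_ord1.
Qed.

Lemma mxcoefM11 A B : mxcoef 1 1 (A *m B)
  = mxcoef 0 0 A *m mxcoef 1 1 B + mxcoef 1 0 A *m mxcoef 0 1 B
    + mxcoef 0 1 A *m mxcoef 1 0 B + mxcoef 1 1 A *m mxcoef 0 0 B.
Proof.
apply/matrixP => a b; rewrite !mxE raddf_sum -!big_split; apply: eq_bigr => c _.
rewrite /= !mxE /bicoef !coefM !big_ord_recl !big_ord0 addr0 coefD.
by rewrite !coefM !big_ord_recl !big_ord0 !addr0 /= !addrA.
Qed.

Definition expn_sum r D : 'M[{poly {poly k}}]_n :=
  \sum_(m < r) ((m`!%:R : k)^-1)%:P%:P *: D ^+ m.

Lemma mxcoefZ i j c A : mxcoef i j (c%:P%:P *: A) = c *: mxcoef i j A.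
Proof. by apply/matrixP => a b; rewrite !mxE /bicoef !coefCM. Qed.
Lemma mxcoef_sum i j r (F : 'I_r -> 'M[{poly {poly k}}]_n) :
  mxcoef i j (\sum_m F m) = \sum_m mxcoef i j (F m).
Proof.
by apply/matrixP => a b; rewrite !mxE summxE raddf_sum summxE; apply: eq_bigr => m _; rewrite !mxE.
Qed.
Lemma mxcoef1 i j : mxcoef i j 1%:M = ((i == 0%N) && (j == 0%N))%:R%:M.
Proof.
apply/matrixP => a b; rewrite !mxE /bicoef.
case: (a == b); rewrite ?mulr0n ?mulr1n ?coef0 // coef1.
by case: (j == 0%N); rewrite ?andbF ?andbT ?coef0 ?coef1.
Qed.

Section Nil.
Variables (r : nat) (D : 'M[{poly {poly k}}]_n).
Hypothesis D0 : mxcoef 0 0 D = 0.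

Lemma mxcoef_exp00 m : mxcoef 0 0 (D ^+ m.+1) = 0.
Proof. by rewrite exprS mxcoefM00 D0 mul0mx. Qed.
Lemma mxcoef_exp10 m : mxcoef 1 0 (D ^+ m.+2) = 0.
Proof. by rewrite exprS mxcoefM10 D0 mxcoef_exp00 mul0mx mulmx0 addr0. Qed.
Lemma mxcoef_exp01 m : mxcoef 0 1 (D ^+ m.+2) = 0.
Proof. by rewrite exprS mxcoefM01 D0 mxcoef_exp00 mul0mx mulmx0 addr0. Qed.
Lemma mxcoef_exp11 m : mxcoef 1 1 (D ^+ m.+3) = 0.
Proof.
by rewrite exprS mxcoefM11 D0 mxcoef_exp00 mxcoef_exp10 mxcoef_exp01 mul0mx !mulmx0 !addr0.
Qed.

Let expand i j : (forall m, mxcoef i j (D ^+ m.+3) = 0) ->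
  mxcoef i j (expn_sum r.+3 D)
  = mxcoef i j 1%:M + mxcoef i j D + 2%:R^-1 *: mxcoef i j (D *m D).
Proof.
move=> H; rewrite /expn_sum mxcoef_sum !big_ord_recl big1 => [|m _]; last first.
  by rewrite mxcoefZ H scaler0.
by rewrite !mxcoefZ expr0 expr1 !invr1 !scale1r addr0 addrA.
Qed.

(** Without a constant term, the powers D^m with m >= 3 have no terms of
    bidegree at most (1, 1). *)
Lemma mxcoef_exp_sum :
  [/\ mxcoef 0 0 (expn_sum r.+3 D) = 1%:M,
      mxcoef 1 0 (expn_sum r.+3 D) = mxcoef 1 0 D,
      mxcoef 0 1 (expn_sum r.+3 D) = mxcoef 0 1 D
    & mxcoef 1 1 (expn_sum r.+3 D) = mxcoef 1 1 D
        + 2%:R^-1 *: (mxcoef 1 0 D *m mxcoef 0 1 D + mxcoef 0 1 D *m mxcoef 1 0 D)].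
Proof.
split; rewrite expand ?mxcoef1 => [|m]; rewrite ?(mxcoef_exp00, mxcoef_exp10, mxcoef_exp01, mxcoef_exp11) //.
- by rewrite mxcoefM00 D0 mul0mx scaler0 !addr0.
- by rewrite mxcoefM10 D0 mul0mx mulmx0 addr0 scaler0 addr0 raddf0 add0r.
- by rewrite mxcoefM01 D0 mul0mx mulmx0 addr0 scaler0 addr0 raddf0 add0r.
- by rewrite mxcoefM11 D0 mul0mx mulmx0 addr0 raddf0 !add0r.
Qed.
End Nil.

(** The bidegree (1, 1) part of exp D = exp (s X) exp (t Y): the symmetric half
    of X Y comes from D^2 / 2, which leaves half the commutator. *)
Lemma exp_sum_prod11 r A B D X Y : (2%:R : k) != 0 ->
  mxcoef 0 0 A = 0 -> mxcoef 1 0 A = X -> mxcoef 0 1 A = 0 -> mxcoef 1 1 A = 0 ->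
  mxcoef 0 0 B = 0 -> mxcoef 1 0 B = 0 -> mxcoef 0 1 B = Y -> mxcoef 1 1 B = 0 ->
  mxcoef 0 0 D = 0 -> expn_sum r.+3 D = expn_sum r.+3 A *m expn_sum r.+3 B ->
  mxcoef 1 1 D = 2%:R^-1 *: (X *m Y - Y *m X).
Proof.
move=> two0 A0 A10 A01 A11 B0 B10 B01 B11 D0 E.
have [a0 a1 a2 a3] := mxcoef_exp_sum r A0.
have [b0 b1 b2 b3] := mxcoef_exp_sum r B0.
have [_ d1 d2 d3] := mxcoef_exp_sum r D0.
have D10 : mxcoef 1 0 D = X.
  by rewrite -d1 E mxcoefM10 a0 b0 a1 b1 A10 B10 mulmx0 add0r mulmx1.
have D01 : mxcoef 0 1 D = Y.
  by rewrite -d2 E mxcoefM01 a0 b0 a2 b2 A01 B01 mul1mx mul0mx addr0.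
have := congr1 (mxcoef 1 1) E; rewrite d3 mxcoefM11 a0 a1 a2 a3 b0 b1 b2 b3.
rewrite D10 D01 A10 A01 A11 B10 B01 B11 mul1mx mulmx1.
rewrite !(mul0mx, mulmx0, addr0, add0r, scaler0) => /(canRL (addrK _)) ->.
apply: (scalerI two0); rewrite scalerBr !scalerA divff // !scale1r.
by rewrite scaler_nat mulr2n opprD addrACA subrr add0r.
Qed.

End BiCoefficients.

Section LieMorphism.
Variables (k : fieldType) (char0 : [pchar k] =i pred0) (N : nat).
Hypothesis N1 : (1 <= N)%N.
Local Notation L := (freeLieN k N).
Variables (n : nat) (rho : 'M[unip_fun k N]_n).
Hypothesis rhoP : unip_rep rho.
Local Notation T := (tangent rho).

Let entry (i j : 'I_n) (z : L) : k := T z i j.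
Let entry_linear i j : scalar (entry i j).
Proof. by move=> a y z; rewrite /entry linearP !mxE. Qed.
HB.instance Definition _ i j := GRing.isLinear.Build k L k *%R (entry i j) (entry_linear i j).

(** Compare the coefficients of s t in the multiplicativity of rho on exp (s x)
    and exp (t y). *)
Lemma tangent_lie x y : T (lie x y) = T x *m T y - T y *m T x.
Proof.
have [r lr] : exists r, (rep_size rho <= r.+3)%N.
  by exists (rep_size rho); do 3!apply: leqW.
pose cc : k -> {poly {poly k}} := polyC \o polyC.
pose Db : 'M[{poly {poly k}}]_n := \matrix_(i, j) bch_poly N (entry i j) x y.
pose Dx : 'M[{poly {poly k}}]_n := 'X%:P *: map_mx cc (T x).
pose Dy : 'M[{poly {poly k}}]_n := 'X *: map_mx cc (T y).
pose ev s t : {rmorphism {poly {poly k}} -> k} := horner_eval s \o horner_eval t%:P.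
have ev_exp s t (D : 'M_n) : map_mx (ev s t) (expn_sum r.+3 D)
    = \sum_(m < r.+3) (m`!%:R)^-1 *: map_mx (ev s t) D ^+ m.
  rewrite raddf_sum; apply: eq_bigr => m _ /=.
  by rewrite map_mxZ rmorphXn /= /horner_eval !hornerC.
have E : expn_sum r.+3 Db = expn_sum r.+3 Dx *m expn_sum r.+3 Dy.
  apply/matrixP => i j; apply/eqP; rewrite -subr_eq0; apply/eqP.
  apply: (poly2_nat_eq0 char0) => s t; rewrite -[LHS]/(ev s t _) rmorphB; apply/eqP.
  rewrite subr_eq0; apply/eqP.
  suff : map_mx (ev s t) (expn_sum r.+3 Db) = map_mx (ev s t) (expn_sum r.+3 Dx *m expn_sum r.+3 Dy).
    by move=> /matrixP/(_ i j); rewrite !mxE.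
  rewrite [RHS]map_mxM.
  apply: etrans (ev_exp s t Db) _.
  apply: etrans _ (esym (congr2 mulmx (ev_exp s t Dx) (ev_exp s t Dy))).
  have -> : map_mx (ev s t) Db = T (bch N (s *: x) (t *: y)).
    by apply/matrixP => a b; rewrite mxE mxE /= /horner_eval bch_poly_eval.
  have -> : map_mx (ev s t) Dx = T (s *: x).
    by apply/matrixP => a b; rewrite linearZ !mxE /= /horner_eval !hornerE.
  have -> : map_mx (ev s t) Dy = T (t *: y).
    by apply/matrixP => a b; rewrite linearZ !mxE /= /horner_eval !hornerE.
  by rewrite -!(rep_exp char0 N1 rhoP) // -(rep_prod rhoP).
have Db0 : mxcoef 0 0 Db = 0.
  by apply/matrixP => a b; rewrite !mxE /bicoef bch_poly00.
have Dx0 : mxcoef 0 0 Dx = 0.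
  by apply/matrixP => a b; rewrite !mxE /bicoef coefCM coefXM.
have Dy0 : mxcoef 0 0 Dy = 0.
  by apply/matrixP => a b; rewrite !mxE /bicoef coefXM coef0.
have Dx10 : mxcoef 1 0 Dx = T x.
  by apply/matrixP => a b; rewrite 4!mxE /bicoef coefCM coefXM /= !coefC.
have Dx01 : mxcoef 0 1 Dx = 0.
  by apply/matrixP => a b; rewrite 4!mxE /bicoef coefCM coefXM [RHS]mxE.
have Dx11 : mxcoef 1 1 Dx = 0.
  by apply/matrixP => a b; rewrite 4!mxE /bicoef coefCM coefXM /= !coefC [RHS]mxE.
have Dy10 : mxcoef 1 0 Dy = 0.
  by apply/matrixP => a b; rewrite 4!mxE /bicoef coefXM coef0 [RHS]mxE.
have Dy01 : mxcoef 0 1 Dy = T y.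
  by apply/matrixP => a b; rewrite 4!mxE /bicoef coefXM /= !coefC.
have Dy11 : mxcoef 1 1 Dy = 0.
  by apply/matrixP => a b; rewrite 4!mxE /bicoef coefXM /= !coefC [RHS]mxE.
have Db11 : mxcoef 1 1 Db = 2%:R^-1 *: T (lie x y).
  by apply/matrixP => a b; rewrite mxE mxE /bicoef bch_poly11 // mxE mulrC.
have two0 : 2%:R != 0 :> k by apply: natrS_neq0.
have := exp_sum_prod11 two0 Dx0 Dx10 Dx01 Dx11 Dy0 Dy10 Dy01 Dy11 Db0 E.
by rewrite Db11 => /scalerI -> //; rewrite invr_eq0.
Qed.

End LieMorphism.

(** * Functions and determinants on the unipotent group *)

Section FunExt.
Variables (k : fieldType) (char0 : [pchar k] =i pred0) (N : nat).

Lemma log_coord_surj (v : 'I_(\dim {: freeLieN k N}) -> k) :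
  exists g : unip k N, forall i, log_coord i g = v i.
Proof.
exists (Exp (\sum_i v i *: (vbasis {: freeLieN k N})`_i)) => i.
by rewrite /log_coord /= coord_sum_free // (basis_free (vbasisP _)).
Qed.

(** Points whose logarithm has natural numbers as coordinates are enough. *)
Lemma unip_fun_ext (f f' : unip_fun k N) :
  (forall g, fun_at f g = fun_at f' g) -> f = f'.
Proof.
move=> E; apply/eqP; rewrite -subr_eq0; apply/eqP; apply: (mpoly_nat_eq0 char0) => v.
have [g gv] := log_coord_surj (fun i => (v i)%:R).
rewrite -(meval_eq _ gv) mevalB; apply/eqP; rewrite subr_eq0; apply/eqP; exact: E.
Qed.

Hypothesis N1 : (1 <= N)%N.
Variables (n : nat) (rho : 'M[unip_fun k N]_n).
Hypothesis rhoP : unip_rep rho.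

Lemma unip_mul_line (x : freeLieN k N) a b :
  unip_mul (Exp (a *: x)) (Exp (b *: x)) = Exp ((a + b) *: x).
Proof. by rewrite /unip_mul /= bch_line. Qed.

(** Along t |-> exp (t x) the determinant is a polynomial in t whose inverse,
    the value at -t, is again a polynomial; so it is constant. *)
Lemma rep_det : \det rho = 1.
Proof.
apply: unip_fun_ext => -[x]; pose p := \det (map_mx (fun f => line f x) rho).
have pE t : p.[t] = \det (rep_at rho (Exp (t *: x))).
  rewrite -/(horner_eval t p) -det_map_mx; congr (\det _).
  by apply/matrixP => i j; rewrite !mxE /= /horner_eval line_eval.
have p0 : p.[0] = 1 by rewrite pE scale0r (rep_one rhoP) det1.
have pq : p * (p \Po (- 'X)) = 1.
  apply/eqP; rewrite -subr_eq0; apply/eqP; apply: (poly_nat_eq0 char0) => M.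
  apply/eqP; rewrite !hornerE subr_eq0 horner_comp !hornerE !pE -det_mulmx.
  by rewrite -(rep_prod rhoP) unip_mul_line subrr scale0r (rep_one rhoP) det1.
have pc : (size p <= 1)%N.
  have pN0 : p != 0 by apply/eqP => pz; move/eqP: pq; rewrite pz mul0r eq_sym oner_eq0.
  have qN0 : p \Po (- 'X) != 0 by apply/eqP => pz; move/eqP: pq; rewrite pz mulr0 eq_sym oner_eq0.
  have := congr1 (fun r : {poly k} => size r) pq; rewrite size_mul // size_poly1.
  move: pN0 qN0; rewrite -!size_poly_gt0; move: (size p) (size (p \Po _)) => a b.
  by case: a b => [|[|a]] [|b] //; rewrite addnS.
have -> : fun_at (\det rho) (Exp x) = p.[1].
  rewrite pE scale1r /fun_at -[LHS]/(meval _ _) -det_map_mx; congr (\det _).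
have -> : fun_at 1 (Exp x) = 1 by rewrite /fun_at meval1.
by rewrite -p0 (size1_polyC pc) !hornerC.
Qed.

End FunExt.

(** * Long products of differentials vanish *)

Section LongWords.
Variables (k : fieldType) (char0 : [pchar k] =i pred0) (N : nat).
Hypothesis N1 : (1 <= N)%N.
Local Notation L := (freeLieN k N).
Variables (n : nat) (rho : 'M[unip_fun k N]_n).
Hypothesis rhoP : unip_rep rho.
Local Notation T := (tangent rho).

(** The weight is kept next to the element because it cannot be recovered from
    it: after truncation a monomial may become zero. *)
Definition homogeneous (z : nat * L) : Prop :=
  exists2 y : freeLie k, lie_monomial z.1 y & trunc N y = z.2.

Lemma mono_pos q (y : freeLie k) : lie_monomial q y -> (0 < q)%N.
Proof. by elim=> // *; rewrite addn_gt0; apply/orP; left. Qed.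

Lemma homogeneous_lie z w : homogeneous z -> homogeneous w ->
  homogeneous (z.1 + w.1, lie z.2 w.2)%N.
Proof.
move=> [y my <-] [y' my' <-]; exists (lie y y'); first exact: mono_lie.
exact: trunc_lie.
Qed.

Lemma homogeneous_heavy z : homogeneous z -> (N < z.1)%N -> z.2 = 0.
Proof.
move=> [y my <-] Nz; apply/trunc_eqP; rewrite subr0.
exact: freeLie_gt_mono my.
Qed.

Let letter_list : seq (nat * L) := [seq (q, x) | q <- iota 1 N, x <- monos k N N].

Let letter_listP z : homogeneous z -> (z.1 <= N)%N -> z \in letter_list.
Proof.
move=> [y my yz] zN; rewrite [z]surjective_pairing -yz; apply: allpairs_f.
  by rewrite mem_iota add1n ltnS zN (mono_pos my).
exact: monos_le my _ _.
Qed.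

Definition weight (s : seq (nat * L)) : nat := (\sum_(z <- s) z.1)%N.
Definition word_mx (s : seq (nat * L)) : 'M[k]_n := \prod_(z <- s) T z.2.

Lemma word_mx_cat s t : word_mx (s ++ t) = word_mx s * word_mx t.
Proof. exact: big_cat. Qed.

Let W := (N * (size letter_list * rep_size rho)).+1.
Let homs (s : seq (nat * L)) := forall z, z \in s -> homogeneous z.

(** A word of large weight in letters of weight at most N is long, so one of
    the finitely many letters occurs often. *)
Let pigeonhole s : homs s -> (forall z, z \in s -> (z.1 <= N)%N) -> (W <= weight s)%N ->
  exists2 z, z \in s & (rep_size rho <= count_mem z s)%N.
Proof.
move=> hs sN; rewrite /W ltnNge => /negP Ws; apply: contrapT => noz; case: Ws.
have : (weight s <= N * size s)%N.
  rewrite /weight mulnC -[size s]sum1_size big_distrl /= big_seq [leqRHS]big_seq.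
  by apply: leq_sum => z /sN; rewrite mul1n.
move/leq_trans; apply; rewrite leq_mul2l; apply/orP; right.
have -> : size s = (\sum_(z <- undup letter_list) count_mem z s)%N.
  rewrite -[in LHS](count_predT s) -size_filter.
  elim: s hs sN {noz} => [|z s IH] hs sN; first by rewrite big1.
  have zl : z \in undup letter_list.
    by rewrite mem_undup; apply: letter_listP; [apply: hs|apply: sN]; rewrite mem_head.
  rewrite /= big_split /= -IH; first last.
  - by move=> w ws; apply: sN; rewrite in_cons ws orbT.
  - by move=> w ws; apply: hs; rewrite in_cons ws orbT.
  rewrite (bigD1_seq z) ?undup_uniq //= eqxx big1 ?addn0 // => w wz.
  by rewrite eq_sym (negPf wz).
apply: (@leq_trans (\sum_(z <- undup letter_list) rep_size rho)%N).
  apply: leq_sum => z _; have [zs|zs] := boolP (z \in s).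
    by apply: ltnW; rewrite ltnNge; apply/negP => zc; apply: noz; exists z.
  by rewrite (count_memPn zs).
rewrite big_const_seq count_predT iter_addn_0 mulnC leq_mul2r size_undup.
by rewrite orbT.
Qed.

(** Exchanging two neighbouring letters changes the product by the product of a
    shorter word of the same weight, in which they are replaced by their bracket.
    By induction on the length the product is therefore invariant under
    permutations, and the occurrences of a frequent letter can be collected into
    a vanishing power. *)
Let word_mx_heavy m s : size s = m -> homs s -> (W <= weight s)%N -> word_mx s = 0.
Proof.
elim: m s => [|m IH] s sm hs Ws.
  by move: Ws; rewrite (size0nil sm) /weight big_nil.
have swap p x y t : size (p ++ x :: y :: t) = m.+1 -> homs (p ++ x :: y :: t) ->
    (W <= weight (p ++ x :: y :: t))%N ->
    word_mx (p ++ x :: y :: t) = word_mx (p ++ y :: x :: t).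
  move=> szm hh Wh.
  have /IH E : size (p ++ (x.1 + y.1, lie x.2 y.2)%N :: t) = m.
    by apply/eqP; rewrite -eqSS -szm !size_cat /= !addnS.
  have {E} : word_mx (p ++ (x.1 + y.1, lie x.2 y.2)%N :: t) = 0.
    apply: E.
      move=> z; rewrite mem_cat in_cons => /or3P[zp|/eqP ->|zt].
      - by apply: hh; rewrite mem_cat zp.
      - by apply: homogeneous_lie; apply: hh; rewrite mem_cat !in_cons eqxx ?orbT.
      - by apply: hh; rewrite mem_cat !in_cons zt !orbT.
    by move: Wh; rewrite /weight !big_cat !big_cons /= -addnA.
  rewrite !word_mx_cat /word_mx !big_cons /= (tangent_lie char0 N1 rhoP) => /eqP.
  by rewrite mulrBl mulrBr subr_eq0 -!mulrA => /eqP.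
have homs_perm s1 s2 : perm_eq s1 s2 -> homs s1 -> homs s2.
  by move=> /perm_mem E hs1 z; rewrite -E; apply: hs1.
have weight_perm s1 s2 : perm_eq s1 s2 -> weight s1 = weight s2.
  by move=> E; apply: perm_big.
have move_front p x t t' : size (p ++ t ++ x :: t') = m.+1 -> homs (p ++ t ++ x :: t') ->
    (W <= weight (p ++ t ++ x :: t'))%N ->
    word_mx (p ++ t ++ x :: t') = word_mx (p ++ x :: t ++ t').
  elim: t p => // y t IHt p szm hh Wh.
  have E : p ++ (y :: t) ++ x :: t' = (p ++ [:: y]) ++ t ++ x :: t' by rewrite -catA.
  have pp : perm_eq ((p ++ [:: y]) ++ t ++ x :: t') (p ++ y :: x :: t ++ t').
    by rewrite -catA perm_cat2l /= perm_cons -cat1s perm_catCA.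
  rewrite E IHt -?E // -catA /= swap //.
  - by rewrite -(perm_size pp) -E.
  - by apply: homs_perm pp _; rewrite -E.
  - by rewrite -(weight_perm _ _ pp) -E.
have perm_word s1 : forall p s2, perm_eq s1 s2 -> size (p ++ s1) = m.+1 -> homs (p ++ s1) ->
    (W <= weight (p ++ s1))%N -> word_mx (p ++ s1) = word_mx (p ++ s2).
  elim: s1 => [|x s1 IHs] p s2 ps szm hh Wh.
    by move: ps; rewrite perm_sym => /perm_nilP ->.
  have xs2 : x \in s2 by rewrite -(perm_mem ps) mem_head.
  case/splitPr: xs2 ps => t t' ps.
  have ps' : perm_eq s1 (t ++ t').
    by rewrite -(perm_cons x); apply: perm_trans ps _; rewrite -cat1s perm_catCA.
  have pp : perm_eq (p ++ x :: s1) (p ++ t ++ x :: t') by rewrite perm_cat2l.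
  rewrite move_front -?(perm_size pp) -?(weight_perm _ _ pp) //; last exact: homs_perm pp hh.
  by have := IHs (p ++ [:: x]) _ ps'; rewrite -!catA /=; apply.
have [sN|] := pselect (forall z, z \in s -> (z.1 <= N)%N); last first.
  move=> /existsNP[z /not_implyP[zs /negP]]; rewrite -ltnNge => Nz.
  have z0 := homogeneous_heavy (hs _ zs) Nz.
  case/splitPr: zs => t t'; rewrite word_mx_cat /word_mx big_cons z0 linear0.
  by rewrite mul0r mulr0.
have [z zs zc] := pigeonhole hs sN Ws.
have ps : perm_eq s (filter (pred1 z) s ++ filter (predC (pred1 z)) s).
  by rewrite perm_sym; apply/permPl; exact: perm_filterC.
have := perm_word s [::] _ ps; rewrite !cat0s => -> //.
have /all_pred1P -> : all (pred1 z) (filter (pred1 z) s) by apply: filter_all.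
rewrite word_mx_cat {1}/word_mx big_nseq iter_mulr_1 size_filter.
by rewrite (tangent_nilp char0 N1 rhoP) // mul0r.
Qed.

Lemma weight_ge s : homs s -> (size s <= weight s)%N.
Proof.
move=> hs; rewrite /weight -sum1_size big_seq [leqRHS]big_seq.
by apply: leq_sum => z /hs [y /mono_pos].
Qed.

(** Expand the letters into homogeneous ones, each of weight at least 1, and
    apply [word_mx_heavy]. *)
Lemma tangent_words : exists r, forall s : seq L, (r <= size s)%N ->
  \prod_(x <- s) T x = 0 :> 'M_n.
Proof.
exists W => s Ws.
suff H (s2 : seq L) s1 : homs s1 -> (W <= size s1 + size s2)%N ->
    word_mx s1 * \prod_(x <- s2) T x = 0.
  by have := H s [::]; rewrite /word_mx big_nil mul1r; apply.
elim: s2 s1 => [|x s2 IH] s1 hs1 Ws1.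
  rewrite addn0 in Ws1; rewrite big_nil mulr1; apply: (word_mx_heavy erefl hs1).
  exact: leq_trans Ws1 (weight_ge hs1).
rewrite /= in Ws1; rewrite big_cons mulrA; elim/truncP: x => x.
elim/lin_span_ind: (freeLie_span x) => [|y y' Hy Hy'|a y Hy|y [q qy]].
- by rewrite -[trunc N 0]/(0 : L) linear0 mulr0 mul0r.
- by rewrite truncD linearD mulrDr mulrDl Hy Hy' addr0.
- rewrite truncZ linearZ /= -[_ * _]/(word_mx s1 *m (a *: T (trunc N y)) *m _).
  by rewrite -scalemxAr -scalemxAl [X in a *: X]Hy scaler0.
have -> : word_mx s1 * T (trunc N y) = word_mx (s1 ++ [:: (q, trunc N y)]).
  by rewrite word_mx_cat {3}/word_mx big_seq1.
apply: IH; last by rewrite size_cat /= addn1 addSnnS.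
move=> z; rewrite mem_cat inE => /orP[/hs1 //|/eqP ->]; by exists y.
Qed.

End LongWords.

(** * The logarithm as a polynomial in a faithful representation *)

Section LogPoly.
Variables (k : fieldType) (g : {poly k}).
Let E : {poly k} := 'X + 'X^2 * g.

(** X + X^2 g has a compositional inverse modulo X^r.  It is built together with
    the corresponding approximations of all X^j, by descending induction on j,
    because E^j - X^j only involves higher powers. *)
Lemma comp_poly_approx r j : exists q : {poly k}, 'X^r %| (q \Po E) - 'X^j.
Proof.
suff H m : forall j, (r <= j + m)%N -> exists q : {poly k}, 'X^r %| (q \Po E) - 'X^j.
  by apply: (H r); apply: leq_addl.
elim: m => [|m IH] {}j rj.
  exists 0; rewrite comp_poly0 sub0r dvdpNr; apply: dvdp_exp2l.
  by rewrite addn0 in rj.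
have [h Eh] : exists h, E ^+ j = 'X^j + 'X^(j.+1) * h.
  elim: j {rj} => [|j [h Eh]]; first by exists 0; rewrite mulr0 addr0 !expr0.
  exists (g + h + 'X * g * h); rewrite exprSr Eh /E !exprS; ring.
have /choice[Q QP] : forall i : nat, exists q : {poly k}, 'X^r %| (q \Po E) - 'X^(j.+1 + i).
  by move=> i; apply: IH; apply: (leq_trans rj); rewrite addnS !addSn ltnS leq_add2r leq_addr.
exists ('X^j - \sum_(i < size h) h`_i *: Q i).
rewrite rmorphB rmorph_sum /= comp_Xn_poly Eh.
have -> : 'X^(j.+1) * h = \sum_(i < size h) h`_i *: 'X^(j.+1 + i).
  rewrite -{1}[h]coefK poly_def mulr_sumr; apply: eq_bigr => i _.
  by rewrite -scalerAr -exprD.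
rewrite addrAC (addrAC 'X^j) subrr add0r -sumrB.
elim/big_ind: _ => [|p p'|i _]; [exact: dvdp0|exact: dvdp_add|].
by rewrite comp_polyZ -scalerBr -mul_polyC dvdp_mull // -opprB dvdpNr.
Qed.

End LogPoly.

Section Logarithm.
Variables (k : fieldType) (char0 : [pchar k] =i pred0) (N : nat).
Hypothesis N1 : (1 <= N)%N.
Local Notation L := (freeLieN k N).
Local Notation dimN := (\dim {: L}).

(** T x is the logarithm of the unipotent matrix rho (exp x), and a polynomial q
    inverting exp - 1 modulo a large power of the variable serves for all x. *)
Lemma tangent_log n (rho : 'M[unip_fun k N]_n) : unip_rep rho ->
  exists q : {poly k}, forall x,
    tangent rho x = \sum_(j < size q) q`_j *: (rep_at rho (Exp x) - 1%:M) ^+ j.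
Proof.
case: n rho => [|n] rho rhoP.
  by exists 0 => x; apply/matrixP => -[].
pose r := rep_size rho.
pose g : {poly k} := \sum_(m < r) (m.+2`!%:R)^-1 *: 'X^m.
have [q qP] := comp_poly_approx g r.+1 1; exists q => x.
set D := tangent rho x.
have DE : rep_at rho (Exp x) - 1%:M = horner_mx D ('X + 'X^2 * g).
  have -> : rep_at rho (Exp x) - 1%:M = \sum_(m < r.+1) (m.+1`!%:R)^-1 *: D ^+ m.+1.
    rewrite (@rep_exp _ char0 _ N1 _ _ rhoP x r.+2); last by do 2!apply: leqW.
    by rewrite big_ord_recl fact0 invr1 scale1r expr0 addrAC subrr add0r.
  rewrite big_ord_recl invr1 scale1r expr1 rmorphD rmorphM /= rmorphXn /= horner_mx_X.
  congr (_ + _); rewrite rmorph_sum mulr_sumr; apply: eq_bigr => m _ /=.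
  by rewrite linearZ /= rmorphXn /= horner_mx_X -scalerAr -exprD.
rewrite DE; transitivity (horner_mx D (q \Po ('X + 'X^2 * g))).
  have /dvdpP[p pE] := qP.
  rewrite -[q \Po _](subrK 'X^1) pE rmorphD rmorphM /= !rmorphXn /= horner_mx_X expr1.
  by rewrite (tangent_nilp char0 N1 rhoP) ?leqnSn // mulr0 add0r.
rewrite comp_polyE rmorph_sum; apply: eq_bigr => j _ /=.
by rewrite linearZ /= rmorphXn.
Qed.

(** The coordinates of the logarithm of M, when M is in the image of rho: linear
    forms, written as traces against l, of the polynomial q in M - 1.  The ring S
    varies because the same formula is used for points over k, over sequences and
    over the function ring itself, [c] being the structure morphism of S. *)
Definition log_rec n (S : comNzRingType) (c : k -> S) (l : 'I_dimN -> 'M[k]_n)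
    (q : {poly k}) (M : 'M[S]_n) (i : 'I_dimN) : S :=
  \tr (map_mx c (l i) *m \sum_(j < size q) c q`_j *: (M - 1%:M) ^+ j).

Lemma rmorph_log_rec n (S S' : comNzRingType) (phi : {rmorphism S -> S'}) (c : k -> S)
    (l : 'I_dimN -> 'M[k]_n) q (M : 'M[S]_n) i :
  phi (log_rec c l q M i) = log_rec (phi \o c) l q (map_mx phi M) i.
Proof.
rewrite /log_rec -trace_map_mx map_mxM -map_mx_comp; congr (\tr (_ *m _)).
rewrite raddf_sum; apply: eq_bigr => j _ /=.
by rewrite map_mxZ rmorphXn /= map_mxB map_mx1.
Qed.

Lemma log_rec_ext n (S : comNzRingType) (c c' : k -> S) (l : 'I_dimN -> 'M[k]_n) q
    (M : 'M[S]_n) i :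
  c =1 c' -> log_rec c l q M i = log_rec c' l q M i.
Proof. by move=> /funext ->. Qed.

(** The product of 1 with itself is 1 by [bch_line], so rho (1) is an invertible
    idempotent. *)
Lemma faithful_unip_rep n (rho : 'M[unip_fun k N]_n) : faithful_rep rho -> unip_rep rho.
Proof.
move=> rhoF; split; last exact: rep_mul.
have E : unip_mul (unip1 k N) (unip1 k N) = unip1 k N.
  by have := bch_line (L := L) N1 0 0 0; rewrite /unip_mul /= addr0 scale0r => ->.
have := rep_mul rhoF (unip1 k N) (unip1 k N); rewrite E.
have u := rep_unit rhoF (unip1 k N).
by move=> /(congr1 (mulmx (invmx (rep_at rho (unip1 k N))))); rewrite mulKmx // mulVmx.
Qed.

(** T is injective because rho is, and any left inverse of T expresses the
    coordinates of x through T x. *)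
Lemma faithful_log n (rho : 'M[unip_fun k N]_n) : faithful_rep rho ->
  exists (l : 'I_dimN -> 'M[k]_n) (q : {poly k}), forall g i,
    log_coord i g = log_rec idfun l q (rep_at rho g) i.
Proof.
move=> rhoF; have rhoP := faithful_unip_rep rhoF.
have [q qP] := tangent_log rhoP.
pose f : 'Hom(L, 'M[k]_n) := linfun (tangent rho).
have f0 : lker f == 0%VS.
  apply/lker0P => x y; rewrite !lfunE /= => Exy.
  suff : Exp x = Exp y by move=> [].
  by apply: (rep_inj rhoF); rewrite !(rep_exp char0 N1 rhoP _ (leqnn _)) Exy.
pose c i (M : 'M[k]_n) := coord (vbasis {: L}) i ((f^-1)%VF M).
exists (fun i => \matrix_(a, b) c i (delta_mx b a)), q => -[x] i.
have -> : log_coord i (Exp x) = c i (tangent rho x).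
  by rewrite /c -[tangent rho x]lfunE -/f lker0_lfunK.
have cE M : c i M = \sum_a \sum_b M a b * c i (delta_mx a b).
  rewrite {1}[M]matrix_sum_delta /c !linear_sum; apply: eq_bigr => a _.
  by rewrite !linear_sum; apply: eq_bigr => b _; rewrite !linearZ.
rewrite /log_rec map_mx_id // -qP cE exchange_big /= /mxtrace; apply: eq_bigr => a _.
by rewrite mxE; apply: eq_bigr => b _; rewrite [in RHS]mxE mulrC.
Qed.

Section Reconstruct.
Variables (n : nat) (rho : 'M[unip_fun k N]_n) (l : 'I_dimN -> 'M[k]_n) (q : {poly k}).
Hypothesis lq : forall g i, log_coord i g = log_rec idfun l q (rep_at rho g) i.

(** The formula holds at every point of the group, hence identically; this is
    what allows it to be specialized to any ring in [log_rec_point]. *)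
Lemma log_rec_generic i : log_rec (@mpolyC _ _) l q rho i = 'X_i.
Proof.
apply: (unip_fun_ext char0) => g; rewrite /fun_at mevalXU lq.
rewrite (rmorph_log_rec (meval (fun j => log_coord j g))); apply: log_rec_ext => c /=.
by rewrite mevalC.
Qed.

Lemma log_rec_point (S : comNzRingType) (c : {rmorphism k -> S}) (x : 'I_dimN -> S) i :
  log_rec c l q (map_mx (mmap c x) rho) i = x i.
Proof.
have <- : mmap c x 'X_i = x i by rewrite mmap_X.
rewrite -log_rec_generic (rmorph_log_rec (mmap c x)); apply: log_rec_ext => a /=.
by rewrite mmapC.
Qed.

End Reconstruct.

Section Group.
Variables (n : nat) (rho : 'M[unip_fun k N]_n).
Hypothesis rhoF : faithful_rep rho.
Implicit Types g h : unip k N.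

Definition unip_inv g : unip k N := Exp (- Log g).

Lemma unip_mulVg g : unip_mul (unip_inv g) g = unip1 k N.
Proof.
case: g => x; rewrite /unip_inv /= -{2}[x]scale1r -scaleN1r (unip_mul_line N1).
by rewrite addrC subrr scale0r.
Qed.

Lemma unip_mulgV g : unip_mul g (unip_inv g) = unip1 k N.
Proof.
case: g => x; rewrite /unip_inv /= -{1}[x]scale1r -scaleN1r (unip_mul_line N1).
by rewrite subrr scale0r.
Qed.

Let rho1 : rep_at rho (unip1 k N) = 1%:M := rep_one (faithful_unip_rep rhoF).

(** The group law inherits its axioms from matrix multiplication. *)
Lemma unip_mulA g h f : unip_mul g (unip_mul h f) = unip_mul (unip_mul g h) f.
Proof. by apply: (rep_inj rhoF); rewrite !(rep_mul rhoF) mulmxA. Qed.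

Lemma unip_mul1g g : unip_mul (unip1 k N) g = g.
Proof. by apply: (rep_inj rhoF); rewrite (rep_mul rhoF) rho1 mul1mx. Qed.

Lemma unip_mulg1 g : unip_mul g (unip1 k N) = g.
Proof. by apply: (rep_inj rhoF); rewrite (rep_mul rhoF) rho1 mulmx1. Qed.

End Group.

End Logarithm.

(** * Sequences and rational functions *)

Section SeqMorphisms.
Variable k : fieldType.

Lemma to_Seq_zmod : zmod_morphism (@to_Seq k : (nat -> k) -> Seq k).
Proof. by move=> a b; rewrite to_SeqN to_SeqD. Qed.
Lemma to_Seq_monoid : monoid_morphism (@to_Seq k : (nat -> k) -> Seq k).
Proof. by split=> // a b; rewrite to_SeqM. Qed.
HB.instance Definition _ :=
  GRing.isZmodMorphism.Build (nat -> k) (Seq k) (@to_Seq k) to_Seq_zmod.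
HB.instance Definition _ :=
  GRing.isMonoidMorphism.Build (nat -> k) (Seq k) (@to_Seq k) to_Seq_monoid.

Definition const_seq (c : k) : nat -> k := fun=> c.
Lemma const_seq_zmod : zmod_morphism const_seq. Proof. by []. Qed.
Lemma const_seq_monoid : monoid_morphism const_seq. Proof. by []. Qed.
HB.instance Definition _ :=
  GRing.isZmodMorphism.Build k (nat -> k) const_seq const_seq_zmod.
HB.instance Definition _ :=
  GRing.isMonoidMorphism.Build k (nat -> k) const_seq const_seq_monoid.

Definition seq_at (M : nat) (a : nat -> k) : k := a M.
Lemma seq_at_zmod M : zmod_morphism (seq_at M). Proof. by []. Qed.
Lemma seq_at_monoid M : monoid_morphism (seq_at M). Proof. by []. Qed.
HB.instance Definition _ M :=
  GRing.isZmodMorphism.Build (nat -> k) k (seq_at M) (seq_at_zmod M).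
HB.instance Definition _ M :=
  GRing.isMonoidMorphism.Build (nat -> k) k (seq_at M) (seq_at_monoid M).

Definition cSeq : k -> Seq k := @to_Seq k \o const_seq.
HB.instance Definition _ := GRing.RMorphism.copy cSeq (@to_Seq k \o const_seq).

Lemma eq_Seq (a b : nat -> k) : a =1 b -> to_Seq a = to_Seq b.
Proof. by move=> /funext ->. Qed.

Lemma shift_fixed (x : Seq k) : Seq_shift x = x -> exists c, x = cSeq c.
Proof.
elim/SeqP: x => a; rewrite Seq_shiftE => /to_SeqP[m am]; exists (a m).
apply/to_SeqP; exists m => M; elim: M => [|M IH]; first by rewrite leqn0 => /eqP ->.
by rewrite leq_eqVlt => /predU1P[<- //|]; rewrite ltnS => mM; rewrite am ?IH.
Qed.

Variable char0 : [pchar k] =i pred0.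

(** [ratfun_Seq] as a function of the hypothesis under which it is a ring
    morphism, so that it can carry that structure. *)
Definition iota_Seq of [pchar k] =i pred0 : ratfun k -> Seq k := @ratfun_Seq k.
Local Notation iota := (iota_Seq char0).

HB.instance Definition _ := GRing.isZmodMorphism.Build (ratfun k) (Seq k) iota
  (ratfun_Seq_zmod char0).
HB.instance Definition _ := GRing.isMonoidMorphism.Build (ratfun k) (Seq k) iota
  (ratfun_Seq_monoid char0).

Lemma iota_poly (p : {poly k}) : iota (FracField.tofrac p) = to_Seq (fun M => p.[M%:R]).
Proof.
have -> : FracField.tofrac p = FracField.tofrac p / FracField.tofrac 1 by rewrite tofrac1 divr1.
rewrite /iota_Seq ratfun_SeqE ?oner_neq0 //.
by apply: eq_Seq => M; rewrite hornerC divr1.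
Qed.

Lemma iota_cst c : iota (ratfun_cst c) = cSeq c.
Proof. by rewrite iota_poly; apply: eq_Seq => M; rewrite hornerC. Qed.

Lemma iota_inj : injective iota. Proof. exact: fmorph_inj. Qed.

Lemma ratfun_shift_fixed (x : ratfun k) : ratfun_shift x = x -> exists c, x = ratfun_cst c.
Proof.
move=> xx; have [|c xc] := @shift_fixed (iota x).
  by rewrite /iota_Seq (ratfun_Seq_shift char0) xx.
by exists c; apply: iota_inj; rewrite iota_cst.
Qed.

Lemma ratfun_shift_cst (c : k) : ratfun_shift (ratfun_cst c) = ratfun_cst c.
Proof.
have -> : ratfun_cst c = FracField.tofrac c%:P / FracField.tofrac 1 by rewrite tofrac1 divr1.
rewrite ratfun_shiftE ?oner_neq0 // comp_polyC.
by rewrite -[1 \Po _]/((1%:P) \Po _) comp_polyC.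
Qed.

Lemma ratfun_pchar0 : [pchar (ratfun k)] =i pred0.
Proof. by move=> p; rewrite (fmorph_pchar (@ratfun_cst k)) char0. Qed.

End SeqMorphisms.

(** * The difference ring of functions on the group *)

Section FunctionRing.
Variables (k : fieldType) (char0 : [pchar k] =i pred0) (N : nat).
Hypothesis N1 : (1 <= N)%N.
Local Notation L := (freeLieN k N).
Local Notation dimN := (\dim {: L}).
Local Notation K := (ratfun k).
Local Notation B := {mpoly K[dimN]}.
Local Notation iota := (iota_Seq char0).
Local Notation cst := (@ratfun_cst k).
Local Notation cB := (@mpolyC dimN K \o cst).

Definition coord_seq (gam : nat -> unip k N) (i : 'I_dimN) : Seq k :=
  to_Seq (fun M => log_coord i (gam M)).

(** Evaluation along an arbitrary sequence of points of the group; theta is the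
    case of the ordered products, and constant sequences detect equality in B. *)
Definition ev_seq (gam : nat -> unip k N) : B -> Seq k := mmap iota (coord_seq gam).
Local Notation ev := ev_seq.
HB.instance Definition _ gam := GRing.RMorphism.copy (ev gam) (mmap iota (coord_seq gam)).

Lemma theta_ev_seq : @theta k N = ev (Phi k N). Proof. by []. Qed.

Lemma ev_const gam c : ev gam c%:MP = iota c. Proof. exact: mmapC. Qed.
Lemma ev_var gam i : ev gam 'X_i = coord_seq gam i. Proof. exact: mmap_X. Qed.

Lemma mmap_seq gam (f : unip_fun k N) :
  mmap (@cSeq k) (coord_seq gam) f = to_Seq (fun M => fun_at f (gam M)).
Proof.
have -> : (fun M => fun_at f (gam M))
    = mmap (@const_seq k) (fun i M => log_coord i (gam M)) f.
  apply/funext => M; rewrite -[RHS]/(seq_at M (mmap _ _ f)) rmorph_mmap.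
  exact: mmap_ext.
by rewrite (rmorph_mmap (@to_Seq k)).
Qed.

Lemma ev_map_mpoly gam (f : unip_fun k N) :
  ev gam (map_mpoly cst f) = to_Seq (fun M => fun_at f (gam M)).
Proof.
rewrite -mmap_seq /map_mpoly (rmorph_mmap (ev gam)); apply: mmap_ext => [c|i] /=.
  by rewrite ev_const iota_cst.
exact: ev_var.
Qed.

(** A constant sequence of points evaluates F to the rational function obtained
    by specializing the coordinates, and rational functions embed into
    sequences. *)
Lemma ev_separates (F F' : B) :
  (forall g, ev (fun=> g) F = ev (fun=> g) F') -> F = F'.
Proof.
move=> E; apply/eqP; rewrite -subr_eq0; apply/eqP.
apply: (mpoly_nat_eq0 (ratfun_pchar0 char0)) => v.
have [g gv] := log_coord_surj (fun i => (v i)%:R : k).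
apply: (iota_inj (char0 := char0)); rewrite rmorph0.
have <- : ev (fun=> g) (F - F') = 0 by rewrite rmorphB /= E subrr.
rewrite (rmorph_mmap iota); apply: mmap_ext => [c //|i] /=.
rewrite /coord_seq -(rmorph_nat cst) iota_cst.
by apply: eq_Seq => M; rewrite /const_seq gv.
Qed.

Lemma mpoly_morph_ext (S : nzRingType) (phi psi : {rmorphism B -> S}) :
  (forall c, phi c%:MP = psi c%:MP) -> (forall i, phi 'X_i = psi 'X_i) -> phi =1 psi.
Proof.
move=> Ec Ei F; rewrite -[F]mmap_var !(rmorph_mmap _ (@mpolyC _ _)).
exact: mmap_ext.
Qed.

Variables (n : nat) (rho : 'M[unip_fun k N]_n) (l : 'I_dimN -> 'M[k]_n) (q : {poly k}).

Definition rhoB : 'M[B]_n := map_mx (map_mpoly cst) rho.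

(** The coordinate X_i of the product a_N(s) g, as a function of g; it is formed
    through rho, where left translation is multiplication of matrices. *)
Definition shift_images (i : 'I_dimN) : B :=
  log_rec cB l q (map_mx (@mpolyC dimN K) (A_N rho) *m rhoB) i.
Definition shiftB : B -> B := mmap (@mpolyC dimN K \o @ratfun_shift k) shift_images.
HB.instance Definition _ := GRing.RMorphism.copy shiftB
  (mmap (@mpolyC dimN K \o @ratfun_shift k) shift_images).

(** The coordinate X_i of the product g h, as a function of g. *)
Definition trans_images h (i : 'I_dimN) : B :=
  log_rec cB l q (rhoB *m map_mx cB (rep_at rho h)) i.
Definition transB h : B -> B := mmap (@mpolyC dimN K) (trans_images h).
HB.instance Definition _ h := GRing.RMorphism.copy (transB h)
  (mmap (@mpolyC dimN K) (trans_images h)).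

Hypothesis rhoF : faithful_rep rho.
Hypothesis lq : forall g i, log_coord i g = log_rec idfun l q (rep_at rho g) i.

Definition rho_seq (gam : nat -> unip k N) : 'M[Seq k]_n :=
  \matrix_(i, j) to_Seq (fun M => rep_at rho (gam M) i j).

Lemma rho_seqE gam : rho_seq gam = map_mx (mmap (@cSeq k) (coord_seq gam)) rho.
Proof.
by apply/matrixP => i j; rewrite !mxE mmap_seq; apply: eq_Seq => M; rewrite mxE.
Qed.

Lemma eq_rho_seq gam del : gam =1 del -> rho_seq gam = rho_seq del.
Proof. by move=> /funext ->. Qed.

Lemma rho_seqM gam del :
  rho_seq gam *m rho_seq del = rho_seq (fun M => unip_mul (gam M) (del M)).
Proof.
apply/matrixP => i j; rewrite !mxE.
under eq_bigr do rewrite !mxE to_SeqM.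
rewrite -(raddf_sum (@to_Seq k)); apply: eq_Seq => M.
by rewrite (rep_mul rhoF) mxE fct_sumE.
Qed.

Lemma log_rec_seq gam i : log_rec (@cSeq k) l q (rho_seq gam) i = coord_seq gam i.
Proof. by rewrite rho_seqE (log_rec_point char0 lq). Qed.

Lemma det_rho_seq gam : \det (rho_seq gam) = 1.
Proof.
by rewrite rho_seqE det_map_mx (rep_det char0 N1 (faithful_unip_rep N1 rhoF)) rmorph1.
Qed.

Lemma iota_s_inv : iota (s_var k + 1)^-1 = to_Seq (fun M => M.+1%:R^-1).
Proof.
have -> : (s_var k + 1)^-1 = FracField.tofrac 1 / FracField.tofrac ('X + 1).
  by rewrite tofracD tofrac1; apply: esym; exact: mul1r.
rewrite /iota_Seq ratfun_SeqE // -?size_poly_eq0 -1?polyC1 ?size_XaddC //.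
by apply: eq_Seq => M; rewrite !hornerE natr1.
Qed.

Lemma iota_pole_sum (lam : nat -> k) :
  iota (\sum_(1 <= m < N.+1) (s_var k + 1)^-1 ^+ m * cst (lam m))
  = to_Seq (fun M => \sum_(1 <= m < N.+1) M.+1%:R^-1 ^+ m * lam m).
Proof.
pose F m : nat -> k := (fun M : nat => (M.+1%:R)^-1 : k) ^+ m * const_seq (lam m).
transitivity (to_Seq (\sum_(1 <= m < N.+1) F m)).
  rewrite !rmorph_sum; apply: eq_bigr => m _.
  by rewrite !rmorphM !rmorphXn /= iota_s_inv iota_cst.
apply: eq_Seq => M; rewrite fct_sumE; apply: eq_bigr => m _.
by rewrite -[F m M]/(seq_at M (F m)) rmorphM rmorphXn.
Qed.

Lemma iota_a_N i : iota (a_N i) = coord_seq (fun M => x_N N M.+1%:R^-1) i.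
Proof.
rewrite iota_pole_sum; apply: eq_Seq => M.
by rewrite /log_coord /= linear_sum; apply: eq_bigr => m _; rewrite linearZ.
Qed.

Lemma iota_A_N : map_mx iota (A_N rho) = rho_seq (fun M => x_N N M.+1%:R^-1).
Proof.
rewrite rho_seqE -map_mx_comp; apply: eq_map_mx => f /=.
rewrite (rmorph_mmap iota); apply: mmap_ext => [c|i] /=.
  exact: iota_cst.
exact: iota_a_N.
Qed.

Lemma ev_rhoB gam : map_mx (ev gam) rhoB = rho_seq gam.
Proof.
rewrite -map_mx_comp; apply/matrixP => i j; rewrite !mxE /= ev_map_mpoly.
by apply: eq_Seq => M; rewrite mxE.
Qed.

Lemma ev_cB gam c : ev gam (cB c) = cSeq c.
Proof. by rewrite /= ev_const iota_cst. Qed.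

Lemma ev_shift_images gam i :
  ev gam (shift_images i) = coord_seq (fun M => unip_mul (x_N N M.+1%:R^-1) (gam M)) i.
Proof.
rewrite /shift_images (rmorph_log_rec (ev gam)) map_mxM ev_rhoB -map_mx_comp.
have -> : map_mx (ev gam \o @mpolyC dimN K) (A_N rho) = map_mx iota (A_N rho).
  by apply: eq_map_mx => c /=; rewrite ev_const.
by rewrite iota_A_N rho_seqM (log_rec_ext _ _ _ _ (ev_cB gam)) log_rec_seq.
Qed.

Lemma ev_trans_images gam h i :
  ev gam (trans_images h i) = coord_seq (fun M => unip_mul (gam M) h) i.
Proof.
rewrite /trans_images (rmorph_log_rec (ev gam)) map_mxM ev_rhoB -map_mx_comp.
have -> : map_mx (ev gam \o cB) (rep_at rho h) = rho_seq (fun=> h).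
  by apply/matrixP => a b; rewrite mxE [RHS]mxE; apply: ev_cB.
by rewrite rho_seqM (log_rec_ext _ _ _ _ (ev_cB gam)) log_rec_seq.
Qed.

Lemma shiftB_const c : shiftB c%:MP = (ratfun_shift c)%:MP.
Proof. exact: mmapC. Qed.
Lemma transB_const h c : transB h c%:MP = c%:MP.
Proof. exact: mmapC. Qed.

(** The shift of B corresponds to the shift of sequences as soon as the
    sequence of points follows the recursion, in particular for the ordered
    products; started from a single point g, it computes the shift at g. *)
Lemma ev_shiftB gam gam' : (forall M, gam' M.+1 = unip_mul (x_N N M.+1%:R^-1) (gam M)) ->
  forall F, ev gam (shiftB F) = Seq_shift (ev gam' F).
Proof.
move=> gg; apply: (mpoly_morph_ext (phi := ev gam \o shiftB)
  (psi := @Seq_shift k \o ev gam')) => [c|i] /=.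
  by rewrite shiftB_const !ev_const /iota_Seq (ratfun_Seq_shift char0).
rewrite /shiftB mmap_X ev_shift_images ev_var /coord_seq Seq_shiftE.
by apply: eq_Seq => M; rewrite gg.
Qed.

Lemma ev_transB gam h F : ev gam (transB h F) = ev (fun M => unip_mul (gam M) h) F.
Proof.
move: F; apply: (mpoly_morph_ext (phi := ev gam \o transB h)) => [c|i] /=.
  by rewrite transB_const !ev_const.
by rewrite /transB mmap_X ev_trans_images ev_var.
Qed.

Lemma shiftB_rhoB : map_mx shiftB rhoB = map_mx (@mpolyC dimN K) (A_N rho) *m rhoB.
Proof.
apply/matrixP => i j; apply: ev_separates => g.
suff : map_mx (ev (fun=> g)) (map_mx shiftB rhoB)
     = map_mx (ev (fun=> g)) (map_mx (@mpolyC dimN K) (A_N rho) *m rhoB).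
  by move=> /matrixP/(_ i j); rewrite !mxE.
pose gam' M := if M is M'.+1 then unip_mul (x_N N M'.+1%:R^-1) g else g.
rewrite [RHS]map_mxM [in RHS]ev_rhoB -[in RHS]map_mx_comp -[LHS]map_mx_comp.
have -> : map_mx (ev (fun=> g) \o @mpolyC dimN K) (A_N rho) = map_mx iota (A_N rho).
  by apply: eq_map_mx => c /=; rewrite ev_const.
rewrite iota_A_N rho_seqM.
have -> : map_mx (ev (fun=> g) \o shiftB) rhoB = map_mx (@Seq_shift k) (map_mx (ev gam') rhoB).
  by apply/matrixP => a b; rewrite !mxE /= (@ev_shiftB _ gam').
rewrite ev_rhoB; apply/matrixP => a b; rewrite !mxE Seq_shiftE.
by apply: eq_Seq => M; rewrite mxE.
Qed.

Lemma transB_rhoB h : map_mx (transB h) rhoB = rhoB *m map_mx cB (rep_at rho h).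
Proof.
apply/matrixP => i j; apply: ev_separates => g.
suff : map_mx (ev (fun=> g)) (map_mx (transB h) rhoB)
     = map_mx (ev (fun=> g)) (rhoB *m map_mx cB (rep_at rho h)).
  by move=> /matrixP/(_ i j); rewrite !mxE.
rewrite [RHS]map_mxM [in RHS]ev_rhoB -[in RHS]map_mx_comp -[LHS]map_mx_comp.
have -> : map_mx (ev (fun=> g) \o cB) (rep_at rho h) = rho_seq (fun=> h).
  by apply/matrixP => a b; rewrite mxE [RHS]mxE; apply: ev_cB.
have -> : map_mx (ev (fun=> g) \o transB h) rhoB = map_mx (ev (fun=> unip_mul g h)) rhoB.
  by apply/matrixP => a b; rewrite !mxE /= ev_transB.
by rewrite ev_rhoB rho_seqM.
Qed.

Lemma shiftB_trans_images h i : shiftB (trans_images h i)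
  = log_rec cB l q (map_mx (@mpolyC dimN K) (A_N rho) *m rhoB *m map_mx cB (rep_at rho h)) i.
Proof.
have E : shiftB \o cB =1 cB by move=> c /=; rewrite shiftB_const ratfun_shift_cst.
rewrite /trans_images (rmorph_log_rec shiftB); apply: etrans (log_rec_ext _ _ _ _ E) _.
apply: (congr1 (fun Q => log_rec cB l q Q i)).
apply: etrans (map_mxM _ _ _) _.
apply: congr2; first exact: shiftB_rhoB.
by rewrite -[LHS]map_mx_comp (eq_map_mx _ E).
Qed.

Lemma transB_shift_images h i : transB h (shift_images i)
  = log_rec cB l q (map_mx (@mpolyC dimN K) (A_N rho) *m rhoB *m map_mx cB (rep_at rho h)) i.
Proof.
have E : transB h \o cB =1 cB by move=> c /=; rewrite transB_const.
rewrite /shift_images (rmorph_log_rec (transB h)); apply: etrans (log_rec_ext _ _ _ _ E) _.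
apply: (congr1 (fun Q => log_rec cB l q Q i)).
apply: etrans (map_mxM _ _ _) _; rewrite -mulmxA.
apply: congr2; last exact: transB_rhoB.
by rewrite -[LHS]map_mx_comp; apply: eq_map_mx => c /=; rewrite transB_const.
Qed.

(** Both sides send X_i to the coordinate of the product a_N(s) g h. *)
Lemma shift_transB h F : shiftB (transB h F) = transB h (shiftB F).
Proof.
move: F; apply: (mpoly_morph_ext (phi := shiftB \o transB h) (psi := transB h \o shiftB)) => [c|i] /=.
  by rewrite transB_const !shiftB_const transB_const.
have -> : transB h 'X_i = trans_images h i by exact: mmap_X.
have -> : shiftB 'X_i = shift_images i by exact: mmap_X.
by rewrite shiftB_trans_images transB_shift_images.
Qed.

Lemma rhoB_generic : rhoB = map_mx (mmap cB (fun i => 'X_i)) rho.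
Proof. by []. Qed.

End FunctionRing.

#[global] Opaque rhoB.

(** * Locally unipotent actions *)

Section Subring.
Variables (S : comNzRingType) (T : S -> Prop).
Hypothesis TP : is_subring T.

Lemma subring1 : T 1. Proof. by case: TP. Qed.
Lemma subringB x y : T x -> T y -> T (x - y). Proof. by case: TP => _ H _; apply: H. Qed.
Lemma subringM x y : T x -> T y -> T (x * y). Proof. by case: TP => _ _; apply. Qed.
Lemma subring0 : T 0. Proof. by rewrite -(subrr 1); apply: subringB subring1 subring1. Qed.
Lemma subringD x y : T x -> T y -> T (x + y).
Proof.
by move=> Tx Ty; rewrite -[y]opprK -[- y]sub0r; apply/subringB/subringB => //; apply: subring0.
Qed.
Lemma subringX x m : T x -> T (x ^+ m).
Proof. by move=> Tx; elim: m => [|m IH]; [exact: subring1|rewrite exprS; apply: subringM]. Qed.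
Lemma subring_sum I (r : seq I) (P : pred I) F :
  (forall i, T (F i)) -> T (\sum_(i <- r | P i) F i).
Proof. by move=> TF; elim/big_ind: _ => //; [exact: subring0|exact: subringD]. Qed.
Lemma subring_prod I (r : seq I) (P : pred I) F :
  (forall i, T (F i)) -> T (\prod_(i <- r | P i) F i).
Proof. by move=> TF; elim/big_ind: _ => //; [exact: subring1|exact: subringM]. Qed.

Lemma subring_mmap (R : nzRingType) d (f : R -> S) (h : 'I_d -> S) p :
  (forall c, T (f c)) -> (forall i, T (h i)) -> T (mmap f h p).
Proof.
move=> Tf Th; apply: subring_sum => m; apply: subringM => //.
by apply: subring_prod => i; apply: subringX.
Qed.

Lemma subring_mulmx a b c (A : 'M[S]_(a, b)) (D : 'M[S]_(b, c)) :
  (forall i j, T (A i j)) -> (forall i j, T (D i j)) -> forall i j, T ((A *m D) i j).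
Proof. by move=> TA TD i j; rewrite mxE; apply: subring_sum => m; apply: subringM. Qed.

Lemma subring_log_rec (k : fieldType) N n (c : k -> S) l q (M : 'M[S]_n) i :
  (forall a, T (c a)) -> (forall a b, T (M a b)) -> T (@log_rec k N n S c l q M i).
Proof.
move=> Tc TM; apply: subring_sum => a; apply: subring_mulmx => {a} a b.
  by rewrite mxE.
rewrite summxE; apply: subring_sum => j; rewrite mxE; apply: subringM => //.
have T1 x y : T ((1%:M : 'M[S]_n) x y).
  by rewrite mxE; case: (x == y); [exact: subring1|exact: subring0].
elim: {j}(j : nat) a b => [|j IH] a b; first exact: T1.
rewrite exprS; apply: subring_mulmx => // x y.
by rewrite !mxE; apply: subringB; [|have := T1 x y; rewrite mxE].
Qed.
End Subring.

Section Triangular.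
Variables (K : fieldType) (B : comNzRingType) (e : {rmorphism K -> B}) (I : Type).
Variables (act : I -> {rmorphism B -> B}) (scal : I -> K -> K).
Hypothesis act_scal : forall o c, act o (e c) = e (scal o c).
Implicit Types (s t : seq B) (F G : B).

Fixpoint kspan s F : Prop :=
  if s is b :: s' then exists c, kspan s' (F - e c * b) else F = 0.

(** Each entry is fixed by all the operators modulo the span of the later
    entries. *)
Fixpoint triangular s : Prop :=
  if s is b :: s' then (forall o, kspan s' (act o b - b)) /\ triangular s' else True.

Definition loc_unipotent F : Prop := exists2 s, triangular s & kspan s F.

Lemma kspan0 s : kspan s 0.
Proof. by elim: s => // b s IH; exists 0; rewrite rmorph0 mul0r subr0. Qed.

Lemma kspanD s F G : kspan s F -> kspan s G -> kspan s (F + G).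
Proof.
elim: s F G => [|b s IH] F G /=; first by move=> -> ->; rewrite addr0.
move=> [c Fc] [d Gd]; exists (c + d).
by rewrite rmorphD mulrDl opprD addrACA; apply: IH.
Qed.

Lemma kspanZ s a F : kspan s F -> kspan s (e a * F).
Proof.
elim: s F => [|b s IH] F /=; first by move=> ->; rewrite mulr0.
by move=> [c Fc]; exists (a * c); rewrite rmorphM -mulrA -mulrBr; apply: IH.
Qed.

Lemma kspanB s F G : kspan s F -> kspan s G -> kspan s (F - G).
Proof.
move=> sF sG; apply: kspanD => //; rewrite -mulN1r -(rmorph1 e) -rmorphN.
exact: kspanZ.
Qed.

Lemma kspan_sum s J (r : seq J) (F : J -> B) :
  (forall j, kspan s (F j)) -> kspan s (\sum_(j <- r) F j).
Proof. by move=> sF; elim/big_ind: _ => //; [exact: kspan0|exact: kspanD]. Qed.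

Lemma kspan_cons s b F : kspan s F -> kspan (b :: s) F.
Proof. by exists 0; rewrite rmorph0 mul0r subr0. Qed.

Lemma kspan_head s b : kspan (b :: s) b.
Proof. by exists 1; rewrite rmorph1 mul1r subrr; apply: kspan0. Qed.

Lemma kspan_catr s t F : kspan t F -> kspan (s ++ t) F.
Proof. by move=> tF; elim: s => // b s IH; apply: kspan_cons. Qed.

Lemma kspan_catl s t F : kspan s F -> kspan (s ++ t) F.
Proof.
elim: s F => [|b s IH] F /=; first by move=> ->; apply: kspan0.
by move=> [c /IH]; exists c.
Qed.

Lemma triangular_cat s t : triangular s -> triangular t -> triangular (s ++ t).
Proof.
elim: s => // b s IH /= [sb ts] tt; split; last exact: IH.
by move=> o; apply: kspan_catl.
Qed.

Lemma kspan_act s o F : triangular s -> kspan s F -> kspan s (act o F).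
Proof.
elim: s F => [|b s IH] F /=; first by move=> _ ->; rewrite rmorph0.
move=> [sb ts] [c /(IH _ ts)]; rewrite rmorphB rmorphM /= act_scal => Fc; exists (scal o c).
have -> : act o F - e (scal o c) * b
    = (act o F - e (scal o c) * act o b) + e (scal o c) * (act o b - b).
  by rewrite mulrBr addrA subrK.
exact/(kspanD Fc)/kspanZ.
Qed.

Lemma kspan_mull b t G : kspan t G -> kspan [seq b * c | c <- t] (b * G).
Proof.
elim: t G => [|c t IH] G /=; first by move=> ->; rewrite mulr0.
by move=> [d /IH]; rewrite mulrBr mulrCA => ?; exists d.
Qed.

(** All products of an entry of s and an entry of t, in row-major order; this
    order keeps the list triangular, since moving along either factor only
    produces later products. *)
Fixpoint tprod s t : seq B :=
  if s is b :: s' then [seq b * c | c <- t] ++ tprod s' t else [::].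

Lemma kspan_tprod s t F G : kspan s F -> kspan t G -> kspan (tprod s t) (F * G).
Proof.
move=> + tG; elim: s F => [|b s IH] F /=; first by move=> ->; rewrite mul0r.
move=> [c /IH sFG]; rewrite -[F](subrK (e c * b)) mulrDl addrC; apply: kspanD.
  by apply: kspan_catl; rewrite -mulrA; apply/kspanZ/kspan_mull.
exact: kspan_catr.
Qed.

Lemma triangular_tprod s t : triangular s -> triangular t -> triangular (tprod s t).
Proof.
move=> + tt; elim: s => // b s IH /= [sb ts].
suff H t' : (forall G, kspan t' G -> kspan t G) -> triangular t' ->
    triangular ([seq b * c | c <- t'] ++ tprod s t) by exact: H.
elim: t' => [|c t' IHt] sub_t /=; first by move=> _; apply: IH.
move=> [tc tt']; split; last first.
  by apply: IHt => // G t'G; apply/sub_t/kspan_cons.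
move=> o; rewrite rmorphM.
have -> : act o b * act o c - b * c = b * (act o c - c) + (act o b - b) * act o c.
  by rewrite mulrBr mulrBl [RHS]addrC addrA subrK.
apply: kspanD; first exact/kspan_catl/kspan_mull.
apply/kspan_catr/kspan_tprod => //.
by apply: kspan_act => //; apply/sub_t/kspan_head.
Qed.

Lemma loc_unipotentZ c F : loc_unipotent F -> loc_unipotent (e c * F).
Proof. by move=> [s ts sF]; exists s => //; apply: kspanZ. Qed.

Lemma loc_unipotent_subring : is_subring loc_unipotent.
Proof.
split=> [|F G [s ts sF] [t tt tG]|F G [s ts sF] [t tt tG]].
- exists [:: 1]; last exact: kspan_head.
  by split=> // o; rewrite rmorph1 subrr.
- exists (s ++ t); first exact: triangular_cat.
  by apply: kspanB; [apply: kspan_catl|apply: kspan_catr].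
- exists (tprod s t); [exact: triangular_tprod|exact: kspan_tprod].
Qed.

Lemma loc_unipotent_common (J : eqType) (r : seq J) (F : J -> B) :
  (forall j, loc_unipotent (F j)) ->
  exists2 s, triangular s & forall j, j \in r -> kspan s (F j).
Proof.
move=> lF; elim: r => [|j r [s ts sF]]; first by exists [::].
have [t tt tF] := lF j; exists (t ++ s); first exact: triangular_cat.
move=> i; rewrite inE => /predU1P[->|/sF]; [exact: kspan_catl|exact: kspan_catr].
Qed.

Lemma loc_unipotent_step s F : triangular s -> (forall o, kspan s (act o F - F)) ->
  loc_unipotent F.
Proof. by move=> ts sF; exists (F :: s) => //; apply: kspan_head. Qed.

End Triangular.

(** * Every function on the group is locally unipotent *)

Section RepTaylor.
Variables (k : fieldType) (char0 : [pchar k] =i pred0) (N : nat).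
Hypothesis N1 : (1 <= N)%N.
Local Notation L := (freeLieN k N).
Local Notation dimN := (\dim {: L}).
Variables (n : nat) (rho : 'M[unip_fun k N]_n).
Hypothesis rhoP : unip_rep rho.
Local Notation T := (tangent rho).

(** The coefficients of the polynomial rho - 1, so that rho - 1 is at any point,
    over any ring, a combination of these constant matrices. *)
Definition rep_coef (m : 'X_{1..dimN}) : 'M[k]_n := map_mx (mcoeff m) (rho - 1%:M).
Definition rep_deg : nat := (\max_i \max_j msize ((rho - 1%:M) i j))%N.

Lemma rep_expand (S : comNzRingType) (c : {rmorphism k -> S}) (x : 'I_dimN -> S) :
  map_mx (mmap c x) rho
  = 1%:M + \sum_(m : 'X_{1..dimN < rep_deg}) mmap1 x m *: map_mx c (rep_coef m).
Proof.
rewrite addrC; apply/(canRL (subrK _)).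
rewrite -(map_mx1 (mmap c x)) -map_mxB; apply/matrixP => i j.
rewrite mxE; apply: etrans (mmapE rep_deg _) _.
  exact: leq_trans (@leq_bigmax _ (fun j => msize ((rho - 1%:M) i j)) j)
    (@leq_bigmax _ (fun i => \max_j msize ((rho - 1%:M) i j))%N i).
rewrite summxE; apply: eq_bigr => m _; rewrite [RHS]mxE mulrC; congr (_ * _).
by rewrite [RHS]mxE; apply: congr1; rewrite [RHS]mxE.
Qed.

(** The products of values of T span a descending chain of spaces of matrices;
    this measures p by the first of them that p annihilates, and multiplying p by
    a coefficient of rho - 1 moves up the chain ([kills_right_coef]). *)
Definition kills_right j (p : 'M[k]_n) : Prop :=
  forall s : seq L, (j <= size s)%N -> p *m \prod_(x <- s) T x = 0.
Definition kills_left j (p : 'M[k]_n) : Prop :=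
  forall s : seq L, (j <= size s)%N -> (\prod_(x <- s) T x) *m p = 0.

Lemma prod_nseq (x : L) m : \prod_(y <- nseq m x) T y = T x ^+ m.
Proof. by rewrite big_nseq iter_mulr_1. Qed.

Lemma prod_words_cat (s t : seq L) :
  \prod_(x <- s ++ t) T x = (\prod_(x <- s) T x) *m (\prod_(x <- t) T x).
Proof. exact: big_cat. Qed.

Lemma mcoeff_sandwich (p p' : 'M[k]_n) (A : 'M[unip_fun k N]_n) m :
  map_mx (mcoeff m) (map_mx (@mpolyC dimN k) p *m A *m map_mx (@mpolyC dimN k) p')
  = p *m map_mx (mcoeff m) A *m p'.
Proof.
apply/matrixP => a b; rewrite !mxE raddf_sum; apply: eq_bigr => i _ /=.
rewrite !mxE mulrC mcoeffCM mulrC raddf_sum; congr (_ * _); apply: eq_bigr => j _ /=.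
by rewrite !mxE mcoeffCM.
Qed.

(** A polynomial which vanishes at all points has vanishing coefficients. *)
Lemma rep_coef_sandwich (p p' : 'M[k]_n) m :
  (forall x, p *m (rep_at rho (Exp x) - 1%:M) *m p' = 0) -> p *m rep_coef m *m p' = 0.
Proof.
move=> H; rewrite -mcoeff_sandwich (_ : _ *m _ *m _ = 0).
  by apply/matrixP => a b; rewrite !mxE mcoeff0.
apply/matrixP => a b; apply: (unip_fun_ext char0) => -[x].
set M := _ *m _ *m _.
have -> : fun_at (M a b) (Exp x) = map_mx (meval (fun i => log_coord i (Exp x))) M a b.
  by rewrite [RHS]mxE.
rewrite /M !map_mxM -!map_mx_comp map_mxB map_mx1.
have E c : (meval (fun i => log_coord i (Exp x)) \o @mpolyC dimN k) c = c by rewrite /= mevalC.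
by rewrite !(map_mx_id E) H !mxE /fun_at meval0.
Qed.

(** rho (exp x) - 1 is a combination of positive powers of T x. *)
Lemma kills_right_coef j p m : kills_right j.+1 p -> kills_right j (p *m rep_coef m).
Proof.
move=> kp s js; apply: rep_coef_sandwich => x.
rewrite (rep_exp_sub1 char0 N1 rhoP) mulmx_sumr mulmx_suml big1 // => i _.
rewrite -scalemxAr -scalemxAl -mulmxA -prod_nseq -prod_words_cat.
by rewrite kp ?scaler0 // size_cat size_nseq addSn ltnS (leq_trans js) ?leq_addl.
Qed.

Lemma kills_left_coef j p m : kills_left j.+1 p -> kills_left j (rep_coef m *m p).
Proof.
move=> kp s js; rewrite mulmxA; apply: rep_coef_sandwich => x.
rewrite (rep_exp_sub1 char0 N1 rhoP) mulmx_sumr mulmx_suml big1 // => i _.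
rewrite -scalemxAr -scalemxAl -prod_nseq -prod_words_cat.
by rewrite kp ?scaler0 // size_cat size_nseq addnS ltnS (leq_trans js) ?leq_addr.
Qed.

Lemma kills_right0 p : kills_right 0 p -> p = 0.
Proof. by move=> /(_ [::] isT); rewrite big_nil mulmx1. Qed.
Lemma kills_left0 p : kills_left 0 p -> p = 0.
Proof. by move=> /(_ [::] isT); rewrite big_nil mul1mx. Qed.

End RepTaylor.

Section LocallyUnipotent.
Variables (k : fieldType) (char0 : [pchar k] =i pred0) (N : nat).
Hypothesis N1 : (1 <= N)%N.
Local Notation L := (freeLieN k N).
Local Notation dimN := (\dim {: L}).
Local Notation K := (ratfun k).
Local Notation B := {mpoly K[dimN]}.
Local Notation cst := (@ratfun_cst k).
Local Notation cB := (@mpolyC dimN K \o cst).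
Variables (n : nat) (rho : 'M[unip_fun k N]_n) (l : 'I_dimN -> 'M[k]_n) (q : {poly k}).
Hypothesis rhoF : faithful_rep rho.
Hypothesis lq : forall g i, log_coord i g = log_rec idfun l q (rep_at rho g) i.
Let rhoP := faithful_unip_rep N1 rhoF.
Local Notation rhoB := (rhoB rho).
Local Notation shiftB := (shiftB rho l q).
Local Notation transB := (transB rho l q).

Definition act (o : option (unip k N)) : {rmorphism B -> B} :=
  if o is Some h then transB h else shiftB.
Definition act_scal (o : option (unip k N)) : K -> K :=
  if o is Some h then id else @ratfun_shift k.

Lemma act_const o c : act o c%:MP = (act_scal o c)%:MP.
Proof. by case: o => [h|] /=; rewrite ?transB_const ?shiftB_const. Qed.

Local Notation loc_unip := (loc_unipotent (@mpolyC dimN K) act).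
Local Notation kspan := (kspan (@mpolyC dimN K)).

Definition sandwich (p p' : 'M[k]_n) : 'M[B]_n := map_mx cB p *m rhoB *m map_mx cB p'.

Lemma sandwich_mull (p p' c : 'M[k]_n) :
  map_mx cB p *m map_mx cB c *m rhoB *m map_mx cB p' = sandwich (p *m c) p'.
Proof. by rewrite /sandwich (map_mxM cB p c). Qed.
Lemma sandwich_mulr (p p' c : 'M[k]_n) :
  map_mx cB p *m rhoB *m map_mx cB c *m map_mx cB p' = sandwich p (c *m p').
Proof.
rewrite /sandwich.
rewrite (map_mxM cB c p').
exact: esym (mulmxA (map_mx cB p *m rhoB) (map_mx cB c) (map_mx cB p')).
Qed.

Lemma shiftB_sandwich (p p' : 'M[k]_n) : map_mx shiftB (sandwich p p') - sandwich p p'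
  = \sum_(m : 'X_{1..dimN < rep_deg rho})
      (mmap1 (@a_N k N) m)%:MP *: sandwich (p *m rep_coef rho m) p'.
Proof.
have E : shiftB \o cB =1 cB by move=> c /=; rewrite shiftB_const ratfun_shift_cst.
have -> : map_mx shiftB (sandwich p p')
    = map_mx cB p *m (map_mx (@mpolyC dimN K) (A_N rho) *m rhoB) *m map_mx cB p'.
  apply: etrans (map_mxM _ _ _) _; apply: congr2; last by rewrite -[LHS]map_mx_comp (eq_map_mx _ E).
  apply: etrans (map_mxM _ _ _) _; apply: congr2; first by rewrite -[LHS]map_mx_comp (eq_map_mx _ E).
  exact: (shiftB_rhoB char0 rhoF lq).
rewrite {1}/A_N (rep_expand rho cst) map_mxD map_mx1 mulmxDl mul1mx mulmxDr mulmxDl addrAC subrr add0r.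
rewrite raddf_sum mulmx_suml mulmx_sumr mulmx_suml; apply: eq_bigr => m _ /=.
by rewrite map_mxZ -map_mx_comp -scalemxAl -scalemxAr -scalemxAl mulmxA sandwich_mull.
Qed.

Lemma transB_sandwich h (p p' : 'M[k]_n) : map_mx (transB h) (sandwich p p') - sandwich p p'
  = \sum_(m : 'X_{1..dimN < rep_deg rho})
      (cst (mmap1 (fun i => log_coord i h) m))%:MP *: sandwich p (rep_coef rho m *m p').
Proof.
have E : transB h \o cB =1 cB by move=> c /=; rewrite transB_const.
have -> : map_mx (transB h) (sandwich p p')
    = map_mx cB p *m (rhoB *m map_mx cB (rep_at rho h)) *m map_mx cB p'.
  apply: etrans (map_mxM _ _ _) _; apply: congr2; last by rewrite -[LHS]map_mx_comp (eq_map_mx _ E).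
  apply: etrans (map_mxM _ _ _) _; apply: congr2; first by rewrite -[LHS]map_mx_comp (eq_map_mx _ E).
  exact: (transB_rhoB char0 rhoF lq).
have -> : rep_at rho h = map_mx (mmap idfun (fun i => log_coord i h)) rho by [].
rewrite (rep_expand rho idfun) map_mxD map_mx1 mulmxDr mulmx1 mulmxDr mulmxDl addrAC subrr add0r.
rewrite raddf_sum mulmx_sumr mulmx_sumr mulmx_suml; apply: eq_bigr => m _ /=.
rewrite map_mxZ map_mx_id // -scalemxAr -scalemxAr -scalemxAl.
by rewrite (mulmxA (map_mx cB p) rhoB (map_mx cB _)) sandwich_mulr.
Qed.

(** The operators change p rho p' by combinations of (p c) rho p' and
    p rho (c p') with c a coefficient of rho - 1, for which j or j' is one
    smaller. *)
Lemma sandwich_loc_unipotent j j' p p' : kills_right rho j p -> kills_left rho j' p' ->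
  forall a b, loc_unip (sandwich p p' a b).
Proof.
suff H m : forall j j' p p', (j + j' <= m)%N -> kills_right rho j p -> kills_left rho j' p' ->
    forall a b, loc_unip (sandwich p p' a b) by exact: (H (j + j')%N).
have lu0 : loc_unip 0 by exists [::].
elim: m => [|m IH] {}j {}j' {}p {}p' jm kp kp' a b.
  move: jm kp; rewrite leqn0 addn_eq0 => /andP[/eqP -> _] /kills_right0 ->.
  by rewrite /sandwich map_mx0 !mul0mx mxE.
case: j jm kp => [|j] jm kp; first by rewrite (kills_right0 kp) /sandwich map_mx0 !mul0mx mxE.
case: j' jm kp' => [|j'] jm kp'; first by rewrite (kills_left0 kp') /sandwich map_mx0 mulmx0 mxE.
have [s ts sF] := loc_unipotent_common (enum {: 'X_{1..dimN < rep_deg rho}})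
  (fun m' => IH j j'.+1 (p *m rep_coef rho m') p' jm
     (kills_right_coef char0 N1 rhoP _ kp) kp' a b).
have jm' : (j.+1 + j' <= m)%N by rewrite -ltnS -addnS.
have [t tt tF] := loc_unipotent_common (enum {: 'X_{1..dimN < rep_deg rho}})
  (fun m' => IH j.+1 j' p (rep_coef rho m' *m p') jm' kp
     (kills_left_coef char0 N1 rhoP _ kp') a b).
apply: (@loc_unipotent_step _ _ _ _ _ (s ++ t)); first exact: triangular_cat.
have comb u (c : 'X_{1..dimN < rep_deg rho} -> K) (Z : 'X_{1..dimN < rep_deg rho} -> 'M[B]_n) :
    (forall m', m' \in enum {: 'X_{1..dimN < rep_deg rho}} -> kspan u (Z m' a b)) ->
    kspan u ((\sum_m' (c m')%:MP *: Z m') a b).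
  move=> uZ; rewrite summxE; apply: kspan_sum => m'; rewrite mxE.
  by apply/kspanZ/uZ; rewrite mem_enum.
case=> [h|] /=.
  apply: kspan_catr.
  have := transB_sandwich h p p' => /matrixP/(_ a b); rewrite mxE [X in X + _]mxE [X in _ + X]mxE => ->.
  exact: comb.
apply: kspan_catl.
have := shiftB_sandwich p p' => /matrixP/(_ a b); rewrite mxE [X in X + _]mxE [X in _ + X]mxE => ->.
exact: (comb s (fun m' => mmap1 (@a_N k N) m') (fun m' => sandwich (p *m rep_coef rho m') p') sF).
Qed.

(** Locally unipotent functions form a ring containing the entries of rho, and
    the coordinates are polynomials in these. *)
Lemma all_loc_unipotent F : loc_unip F.
Proof.
have sub := loc_unipotent_subring act_const.
have lc (c : K) : loc_unip c%:MP.
  by rewrite -[c%:MP]mulr1; apply: loc_unipotentZ; exact: subring1 sub.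
rewrite -[F]mmap_var; apply: (subring_mmap sub) => // i.
have -> : 'X_i = log_rec cB l q rhoB i by rewrite rhoB_generic (log_rec_point char0 lq).
apply: (subring_log_rec sub) => [c|a b]; first exact: (lc (cst c)).
have [r rP] := tangent_words char0 N1 rhoP.
have -> : rhoB = sandwich 1%:M 1%:M by rewrite /sandwich map_mx1 mul1mx mulmx1.
by apply: (@sandwich_loc_unipotent r r) => s rs; rewrite ?mulmx1 ?mul1mx rP.
Qed.

End LocallyUnipotent.

Section Poles.
Variables (k : fieldType) (char0 : [pchar k] =i pred0).
Local Notation K := (ratfun k).
Local Notation "p %:F" := (@FracField.tofrac {poly k} p : K).

(** * Telescoping sums of negative powers *)

Lemma exprVn_sub (F : fieldType) (x : F) m N : x != 0 -> (m <= N)%N ->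
  x^-1 ^+ m = x ^+ (N - m) / x ^+ N.
Proof.
move=> x0 mN; rewrite -{2}(subnK mN) exprD invfM mulrA divff ?expf_neq0 //.
by rewrite mul1r exprVn.
Qed.

Lemma ratfun_coprime (x : K) :
  exists n d : {poly k}, [/\ d != 0, coprimep n d & x = n%:F / d%:F].
Proof.
set n := ratfun_num x; set d := ratfun_den x; have d0 : d != 0 := ratfun_den_neq0 x.
pose g := gcdp n d.
have nE : n = n %/ g * g by rewrite divpK // dvdp_gcdl.
have dE : d = d %/ g * g by rewrite divpK // dvdp_gcdr.
have dg0 : d %/ g != 0 by apply: contraNneq d0 => E; rewrite dE E mul0r.
exists (n %/ g), (d %/ g); split=> //; first by apply: coprimep_div_gcd; rewrite d0 orbT.
rewrite [x in LHS]ratfun_numden -/n -/d; apply/ratfun_eq => //.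
by rewrite [in LHS]nE [in RHS]dE mulrAC -!mulrA.
Qed.

(** Otherwise d would vanish on an infinite set. *)
Lemma not_root_forward_orbit (d : {poly k}) (a : k) : d != 0 ->
  (forall M : nat, root d (a + M%:R) -> root d (a + M.+1%:R)) -> ~~ root d a.
Proof.
move=> d0 H; apply/negP => da; move/eqP: d0; apply.
have E : d \Po ('X + a%:P) = 0.
  apply: (poly_nat_eq0 char0) => M; rewrite horner_comp !hornerE addrC; apply/rootP.
  by elim: M => [|M IH]; [rewrite addr0|apply: H].
apply/eqP; rewrite -(@comp_poly2_eq0 _ d ('X + a%:P)) ?size_XaddC //.
exact/eqP.
Qed.

Lemma not_root_backward_orbit (d : {poly k}) (a : k) : d != 0 ->
  (forall M : nat, root d (a - M%:R) -> root d (a - M.+1%:R)) -> ~~ root d a.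
Proof.
move=> d0 H; have sz : size (- 'X : {poly k}) = 2%N by rewrite size_polyN size_polyX.
have dN0 : d \Po (- 'X) != 0 by rewrite comp_poly2_eq0.
have E b : root (d \Po (- 'X)) (- b) = root d b by rewrite /root horner_comp !hornerE opprK.
rewrite -E; apply: not_root_forward_orbit dN0 _ => M.
by rewrite -[- a + _]opprK -[- a + M.+1%:R]opprK !E !opprD !opprK; apply: H.
Qed.

(** Write c = n / d in lowest terms.  Away from -1 the right-hand side has no
    pole, so there a is a pole of c if and only if a + 1 is.  A pole of c at 0
    would therefore propagate to all of 0, 1, 2, ..., and a pole at -1 to all of
    -1, -2, ...; hence neither c(s) nor c(s + 1) has a pole at s = -1, and
    neither has the right-hand side. *)
Lemma shift_telescoper_trivial N (lam : nat -> k) (c : K) :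
  c - ratfun_shift c = \sum_(1 <= m < N.+1) (s_var k + 1)^-1 ^+ m * ratfun_cst (lam m) ->
  forall m, (1 <= m <= N)%N -> lam m = 0.
Proof.
have [n [d [d0 cnd ->]]] := ratfun_coprime c; rewrite ratfun_shiftE // => E.
pose t : {poly k} := 'X + 1.
have tE : t = 'X + 1%:P by [].
have t0 : t != 0 by rewrite -size_poly_eq0 tE size_XaddC.
have tr a : root t a = (a == -1) by rewrite /root !hornerE addr_eq0.
(* the numerator of the right-hand side over (s + 1)^N is Lam0 (s + 1) *)
pose Lam0 : {poly k} := \sum_(1 <= m < N.+1) lam m *: 'X^(N - m).
have Lam0E m : (1 <= m <= N)%N -> Lam0`_(N - m) = lam m.
  move=> /andP[m1 mN]; rewrite coef_sum (bigD1_seq m) ?iota_uniq ?mem_index_iota ?m1 ?ltnS //=.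
  rewrite coefZ coefXn eqxx mulr1 big1_seq ?addr0 // => i /andP[im].
  rewrite mem_index_iota => /andP[i1 iN]; rewrite coefZ coefXn.
  case: eqP => [e|]; last by rewrite mulr0.
  by rewrite -(subKn mN) e subKn ?eqxx in im.
have szLam : (size (Lam0 \Po t) <= N)%N.
  have sz0 : (size Lam0 <= N)%N.
    apply: (leq_trans (size_sum _ _ _)); apply/bigmax_leqP_seq => m.
    rewrite mem_index_iota => /andP[m1 mN] _; apply: (leq_trans (size_scale_leq _ _)).
    by rewrite size_polyXn ltn_subLR // -[N in (N < _)%N]add0n ltn_add2r.
  by rewrite size_comp_poly2 // tE size_XaddC.
suff Lam00 : Lam0 \Po t = 0.
  move/eqP: Lam00; rewrite comp_poly2_eq0 ?tE ?size_XaddC // => /eqP L0.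
  by move=> m /Lam0E <-; rewrite L0 coef0.
set d1 := d \Po t; set n1 := n \Po t.
have d10 : d1 != 0 by rewrite comp_poly2_eq0 ?tE ?size_XaddC.
have cnd1 : coprimep n1 d1 by apply: coprimep_comp_poly.
have {}E : (n * d1 - n1 * d) * t ^+ N = (Lam0 \Po t) * (d * d1).
  have tF0 : t%:F != 0 by rewrite tofrac_eq0.
  have sumE : \sum_(1 <= m < N.+1) (s_var k + 1)^-1 ^+ m * ratfun_cst (lam m)
      = (Lam0 \Po t)%:F / (t ^+ N)%:F.
    have -> : s_var k + 1 = t%:F by rewrite tofracD tofrac1.
    rewrite rmorph_sum /= rmorph_sum mulr_suml big_seq [RHS]big_seq; apply: eq_bigr => m.
    rewrite mem_index_iota => /andP[m1 mN].
    rewrite comp_polyZ comp_Xn_poly -mul_polyC rmorphM !rmorphXn /= -mulrA.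
    by rewrite (exprVn_sub tF0 (mN : (m <= N)%N)) mulrC.
  move: E; rewrite sumE -mulNr addf_div ?tofrac_eq0 // -!tofracN -!tofracM -tofracD.
  by move/ratfun_eq; rewrite mulNr; apply; rewrite ?mulf_neq0 ?expf_neq0.
(* poles of c away from -1 are poles of c(s + 1), and conversely *)
have dd1 : d %| d1 * t ^+ N.
  have cdn : coprimep d n by rewrite coprimep_sym.
  rewrite -(Gauss_dvdpr _ cdn) mulrA.
  have -> : n * d1 * t ^+ N = (Lam0 \Po t) * (d * d1) + n1 * d * t ^+ N by rewrite -E; ring.
  by rewrite dvdp_add // -?mulrA; [rewrite mulrCA dvdp_mulr|rewrite dvdp_mull // dvdp_mulr].
have d1d : d1 %| d * t ^+ N.
  have cdn : coprimep d1 n1 by rewrite coprimep_sym.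
  rewrite -(Gauss_dvdpr _ cdn) mulrA.
  have -> : n1 * d * t ^+ N = n * d1 * t ^+ N - (Lam0 \Po t) * (d * d1) by rewrite -E; ring.
  by rewrite dvdp_sub // -?mulrA; [rewrite dvdp_mull // dvdp_mulr|rewrite !dvdp_mull].
have rtN a : a != -1 -> ~~ root (t ^+ N) a.
  by rewrite -tr /root horner_exp => ta; apply: expf_neq0.
have rd1 a : root d1 a = root d (a + 1) by rewrite /root horner_comp !hornerE.
have fwd a : a != -1 -> root d a -> root d (a + 1).
  move=> /rtN ta; rewrite -dvdp_XsubCl => /dvdp_trans/(_ dd1).
  by rewrite dvdp_XsubCl rootM (negPf ta) orbF rd1.
have bwd a : a != -1 -> root d (a + 1) -> root d a.
  move=> /rtN ta; rewrite -rd1 -dvdp_XsubCl => /dvdp_trans/(_ d1d).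
  by rewrite dvdp_XsubCl rootM (negPf ta) orbF.
have rd0 : ~~ root d 0.
  apply: (not_root_forward_orbit d0) => M; rewrite !add0r -natr1; apply: fwd.
  by rewrite -addr_eq0 natr1 natrS_neq0.
have rdN1 : ~~ root d (-1).
  apply: (not_root_backward_orbit d0) => M rM; apply: bwd; last first.
    by rewrite -natr1 opprD addrA subrK.
  by rewrite -subr_eq0 opprK addrAC addNr add0r oppr_eq0 natrS_neq0.
have ct : coprimep (t ^+ N) (d * d1).
  rewrite coprimep_sym; apply: coprimep_expr; rewrite tE -[1%:P]opprK -polyCN coprimep_XsubC.
  by rewrite rootM negb_or rdN1 rd1 addNr.
have tLam : t ^+ N %| Lam0 \Po t.
  by rewrite -(Gauss_dvdpl _ ct) -E dvdp_mull.
apply/eqP; apply: contraT => L0; have := leq_trans (dvdp_leq L0 tLam) szLam.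
have -> : t = 'X - (-1)%:P by rewrite polyCN opprK.
by rewrite size_exp_XsubC ltnn.
Qed.
End Poles.

(** * Additive characters of the group *)

Section AdditiveCharacter.
Variables (k : fieldType) (char0 : [pchar k] =i pred0) (N : nat).
Hypothesis N1 : (1 <= N)%N.
Local Notation L := (freeLieN k N).

Variable phi : unip_fun k N.
Hypothesis phiM : forall g h, fun_at phi (unip_mul g h) = fun_at phi g + fun_at phi h.

(** An additive character is the off-diagonal entry of a representation by
    unipotent 2 x 2 matrices; there T takes values in commuting matrices, which
    explains [dphi_lie]. *)
Definition char_rep : 'M[unip_fun k N]_2 :=
  \matrix_(i, j) (if i == j then 1 else if i == 0 then phi else 0).

Lemma additive_unip1 : fun_at phi (unip1 k N) = 0.
Proof.
have E : unip_mul (unip1 k N) (unip1 k N) = unip1 k N.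
  by have := bch_line (L := L) N1 0 0 0; rewrite /unip_mul /= addr0 scale0r => ->.
have := phiM (unip1 k N) (unip1 k N); rewrite E => /eqP.
by rewrite -subr_eq subrr eq_sym => /eqP.
Qed.

Lemma char_rep_at g i j : rep_at char_rep g i j
  = if i == j then 1 else if i == 0 then fun_at phi g else 0.
Proof.
rewrite !mxE /fun_at; case: (i == j); first by rewrite meval1.
by case: (i == 0); rewrite // meval0.
Qed.

Lemma char_rep_unip : unip_rep char_rep.
Proof.
split=> [|g h]; apply/matrixP => i j.
  by rewrite char_rep_at additive_unip1 mxE; case: (i == j) (i == 0) => [] [].
rewrite [RHS]mxE !big_ord_recl big_ord0 !char_rep_at phiM.
by case: i j => [[|[|i]] ?] [[|[|j]] ?] //=; rewrite ?(mulr0, mul0r, mulr1, mul1r, addr0, add0r) // addrC.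
Qed.

Local Notation T := (tangent char_rep).
Definition dphi (x : L) : k := T x 0 1.

Lemma char_tangent x i j : T x i j = if (i == 0) && (j == 1) then dphi x else 0.
Proof.
case: ifP => [/andP[/eqP -> /eqP ->] //|]; rewrite !mxE.
have l1 : line (1 : unip_fun k N) x = 1 by rewrite /line rmorph1.
have l0 : line (0 : unip_fun k N) x = 0 by rewrite /line rmorph0.
by case: i j => [[|[|i]] ?] [[|[|j]] ?] //= _; rewrite ?l1 ?l0 ?coef1 ?coef0.
Qed.

Lemma char_tangentM x y : T x *m T y = 0.
Proof.
apply/matrixP => i j; rewrite mxE !big_ord_recl big_ord0 !char_tangent mxE.
by case: i j => [[|[|i]] ?] [[|[|j]] ?] //=; rewrite ?(mulr0, mul0r, addr0).
Qed.

Lemma dphi_linear : scalar dphi.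
Proof. by move=> a x y; rewrite /dphi linearP !mxE. Qed.
HB.instance Definition _ := GRing.isLinear.Build k L k *%R dphi dphi_linear.

Lemma dphi_lie x y : dphi (lie x y) = 0.
Proof. by rewrite /dphi (tangent_lie char0 N1 char_rep_unip) !char_tangentM subrr mxE. Qed.

(** The exponential series stops after the linear term because T x squares to
    zero. *)
Lemma dphiE x : fun_at phi (Exp x) = dphi x.
Proof.
have := char_rep_at (Exp x) 0 1; rewrite /= => <-.
rewrite (@rep_exp _ char0 _ N1 _ _ char_rep_unip x (rep_size char_rep).+2); last by do 2!apply: leqW.
rewrite !big_ord_recl big1 ?addr0 => [|m _]; last first.
  by rewrite exprS exprS mulrA [T x * T x]char_tangentM mul0r scaler0.
by rewrite expr0 expr1 !invr1 !scale1r mxE [X in X + _]mxE add0r.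
Qed.

End AdditiveCharacter.

(** The algebra is generated by the e_m, and those with m > N are zero. *)
Lemma lie_functional_eq0 (k : fieldType) N (lam : {scalar freeLieN k N}) :
  (forall x y, lam (lie x y) = 0) -> (forall m, (1 <= m <= N)%N -> lam (gen k N m) = 0) ->
  forall x, lam x = 0.
Proof.
move=> lamL lamG; elim/truncP => x; elim/lin_span_ind: (freeLie_span x) => [|y y' Hy Hy'|a y Hy|y [q qy]].
- by rewrite -[trunc N 0]/(0 : freeLieN k N) linear0.
- by rewrite truncD linearD Hy Hy' addr0.
- by rewrite truncZ linearZ /= Hy mulr0.
case: qy => [m m0|q' r y1 y2 _ _]; last by rewrite trunc_lie lamL.
have [mN|Nm] := leqP m N; first by rewrite lamG // m0.
rewrite (_ : trunc N (fl_gen k m) = 0) ?linear0 //.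
by apply/trunc_eqP; rewrite subr0; apply: freeLie_gt_mono (mono_gen k m0).
Qed.

(** * Invariant functions and injectivity of the evaluation *)

Lemma mul_split (R : comNzRingType) (x c b F : R) : x * c = 1 ->
  x * F = b + x * (F - c * b).
Proof. by move=> xc; rewrite mulrBr mulrA xc mul1r addrC subrK. Qed.

Lemma mul_cancel0 (R : comNzRingType) (x c F : R) : x * c = 1 -> x * F = 0 -> F = 0.
Proof. by move=> xc xF; rewrite -[F]mul1r -xc mulrAC xF mul0r. Qed.

Section Descent.
Variables (k : fieldType) (char0 : [pchar k] =i pred0) (N : nat).
Local Notation L := (freeLieN k N).
Local Notation dimN := (\dim {: L}).
Local Notation K := (ratfun k).
Local Notation B := {mpoly K[dimN]}.
Local Notation cst := (@ratfun_cst k).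
Local Notation iota := (iota_Seq char0).
Local Notation ev := (ev_seq char0).
Local Notation "p %:F" := (@FracField.tofrac {poly k} p : K).

Definition eval_pt (g : unip k N) : B -> K := meval (fun i => cst (log_coord i g)).
HB.instance Definition _ g := GRing.RMorphism.copy (eval_pt g)
  (meval (fun i => cst (log_coord i g))).

Lemma ev_eval_pt g F : ev (fun=> g) F = iota (eval_pt g F).
Proof.
rewrite /eval_pt /meval (rmorph_mmap iota); apply: mmap_ext => [c //|i] /=.
by rewrite iota_cst.
Qed.

Lemma eval_pt_ext F F' : (forall g, eval_pt g F = eval_pt g F') -> F = F'.
Proof. by move=> E; apply: (ev_separates (char0 := char0)) => g; rewrite !ev_eval_pt E. Qed.

Lemma eval_pt_const g c : eval_pt g c%:MP = c. Proof. exact: mevalC. Qed.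

Lemma eval_pt_base g (f : unip_fun k N) : eval_pt g (map_mpoly cst f) = cst (fun_at f g).
Proof.
apply: (iota_inj (char0 := char0)); rewrite -ev_eval_pt ev_map_mpoly iota_cst.
by [].
Qed.

Lemma common_denominator (s : seq 'X_{1..dimN}) (F : B) : uniq s ->
  exists2 Q : {poly k}, Q != 0 &
    exists p : 'X_{1..dimN} -> {poly k}, forall m, m \in s -> F@_m = (p m)%:F / Q%:F.
Proof.
move=> us; pose Q := \prod_(m <- s) ratfun_den (F@_m).
have Q0 : Q != 0.
  by rewrite /Q prodf_seq_neq0; apply/allP => m _; apply: ratfun_den_neq0.
exists Q => //.
exists (fun m => ratfun_num (F@_m) * (Q %/ ratfun_den (F@_m))) => m ms.
have d0 := ratfun_den_neq0 (F@_m).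
have QE : Q = Q %/ ratfun_den (F@_m) * ratfun_den (F@_m).
  by rewrite divpK // /Q (bigD1_seq m) //= dvdp_mulr.
rewrite [LHS]ratfun_numden; apply/ratfun_eq => //.
by rewrite {1}QE mulrA.
Qed.

(** Clear the denominators and specialize s to a number where the common
    denominator does not vanish: the values, being in k, are unchanged. *)
Lemma descent (F : B) : (forall g, exists c, eval_pt g F = cst c) ->
  exists f : unip_fun k N, F = map_mpoly cst f.
Proof.
move=> Fc; have [Q Q0 [p pE]] := common_denominator F (msupp_uniq F).
have [M QM] : exists M : nat, Q.[M%:R] != 0.
  apply: contrapT => /forallNP H; move/eqP: Q0; apply; apply: (poly_nat_eq0 char0) => M.
  by apply/eqP; rewrite -[_ == _]negbK; apply/negP/H.
pose f : unip_fun k N := \sum_(m <- msupp F) ((p m).[M%:R] / Q.[M%:R]) *: 'X_[m].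
exists f; apply: eval_pt_ext => g; rewrite eval_pt_base.
have [c cE] := Fc g; rewrite cE; congr cst.
have QF0 : Q%:F != 0 by rewrite tofrac_eq0.
have E : \sum_(m <- msupp F) p m * (mmap1 (fun i => log_coord i g) m)%:P = c%:P * Q.
  apply/eqP; rewrite -tofrac_eq tofracM -[c%:P%:F]cE; apply/eqP.
  rewrite /eval_pt mevalE mulr_suml rmorph_sum big_seq [RHS]big_seq; apply: eq_bigr => m mF.
  rewrite /= (pE m mF) tofracM mulrAC mulfVK // /mmap1 !rmorph_prod; congr (_ * _).
  by apply: eq_bigr => i _; rewrite !rmorphXn.
have := congr1 (fun r : {poly k} => r.[M%:R]) E.
rewrite !hornerE horner_sum => Ec.
apply: (mulIf QM); rewrite -Ec /fun_at /f raddf_sum mulr_suml; apply: eq_bigr => m _ /=.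
by rewrite hornerM hornerC mevalZ mevalX mulrAC divfK.
Qed.

End Descent.

Section Invariants.
Variables (k : fieldType) (char0 : [pchar k] =i pred0) (N : nat).
Hypothesis N1 : (1 <= N)%N.
Local Notation L := (freeLieN k N).
Local Notation dimN := (\dim {: L}).
Local Notation K := (ratfun k).
Local Notation B := {mpoly K[dimN]}.
Local Notation cst := (@ratfun_cst k).
Local Notation cB := (@mpolyC dimN K \o cst).
Local Notation iota := (iota_Seq char0).
Local Notation ev := (ev_seq char0).
Variables (n : nat) (rho : 'M[unip_fun k N]_n) (l : 'I_dimN -> 'M[k]_n) (q : {poly k}).
Hypothesis rhoF : faithful_rep rho.
Hypothesis lq : forall g i, log_coord i g = log_rec idfun l q (rep_at rho g) i.
Local Notation shiftB := (shiftB rho l q).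
Local Notation transB := (transB rho l q).

Lemma eval_pt_transB g h F : eval_pt g (transB h F) = eval_pt (unip_mul g h) F.
Proof.
by apply: (iota_inj (char0 := char0)); rewrite -!ev_eval_pt (ev_transB char0 rhoF lq).
Qed.

(** Such an f is f(1) plus an additive character phi.  Invariance at the neutral
    element is a telescoping identity for f(1) whose right-hand side is phi at
    a_N(s); it forces phi = 0 and f(1) to be shift-invariant. *)
Lemma invariant_of_additive (f : B) : shiftB f = f ->
  (forall h, exists c, transB h f - f = (cst c)%:MP) -> exists c, f = (cst c)%:MP.
Proof.
move=> sf tf; pose e := unip1 k N; pose f1 := eval_pt e f.
have tE g h : exists2 c, eval_pt h f - f1 = cst c
    & eval_pt (unip_mul g h) f - eval_pt g f = cst c.
  have [c cE] := tf h; exists c.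
    rewrite /f1 -[h in LHS](unip_mul1g N1 rhoF) -eval_pt_transB -rmorphB cE.
    exact: eval_pt_const.
  by rewrite -eval_pt_transB -rmorphB cE; exact: eval_pt_const.
have [phi phiE] : exists phi : unip_fun k N, f - f1%:MP = map_mpoly cst phi.
  apply: (descent char0) => g; have [c cE _] := tE e g; exists c.
  by rewrite rmorphB /= eval_pt_const.
have phi_at g : cst (fun_at phi g) = eval_pt g f - f1.
  by rewrite -(eval_pt_base char0) -phiE rmorphB /= eval_pt_const.
have phiM g h : fun_at phi (unip_mul g h) = fun_at phi g + fun_at phi h.
  have [c c1 c2] := tE g h; apply: (fmorph_inj cst); rewrite rmorphD /= !phi_at c1 -c2.
  by rewrite [RHS]addrC addrA subrK.
have fE : f = f1%:MP + map_mpoly cst phi by rewrite -phiE addrC subrK.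
pose lam m := dphi phi (gen k N m).
have phi_x t : fun_at phi (x_N N t) = \sum_(1 <= m < N.+1) t ^+ m * lam m.
  rewrite /x_N (dphiE char0 N1 phiM) linear_sum; apply: eq_bigr => m _.
  by rewrite linearZ.
have E : f1 - ratfun_shift f1
    = \sum_(1 <= m < N.+1) (s_var k + 1)^-1 ^+ m * cst (lam m).
  apply: (iota_inj (char0 := char0)); rewrite rmorphB /= iota_pole_sum.
  pose gam' M := if M is M'.+1 then unip_mul (x_N N M'.+1%:R^-1) e else e.
  have := @ev_shiftB _ char0 _ _ rho l q rhoF lq (fun=> e) gam' (fun M => erefl) f.
  rewrite sf ev_eval_pt -/f1 => ->.
  rewrite fE rmorphD /= ev_const ev_map_mpoly rmorphD /= Seq_shiftE.
  rewrite /iota_Seq (ratfun_Seq_shift char0) addrC addKr.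
  by apply: eq_Seq => M /=; rewrite (unip_mulg1 N1 rhoF) phi_x.
have lam0 : forall m, (1 <= m <= N)%N -> lam m = 0.
  exact: (shift_telescoper_trivial char0 E).
have dphi0 := lie_functional_eq0 (dphi_lie char0 N1 phiM) lam0.
have phi0 : phi = 0.
  apply: (unip_fun_ext char0) => -[x].
  by rewrite (dphiE char0 N1 phiM) dphi0 /fun_at meval0.
have [c cE] : exists c, f1 = cst c.
  apply: (ratfun_shift_fixed char0); apply/eqP; rewrite eq_sym -subr_eq0 E.
  rewrite big_seq big1 // => m; rewrite mem_index_iota => /andP[m1 mN].
  by rewrite lam0 ?m1 // rmorph0 mulr0.
by exists c; rewrite fE phi0 rmorph0 addr0 cE.
Qed.

(** Along a triangular list, (transB h F - F) is again invariant and lies in the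
    span of a shorter list, so it is a constant by induction. *)
Lemma shift_invariants (F : B) : shiftB F = F -> exists c, F = (cst c)%:MP.
Proof.
have [s ts] := all_loc_unipotent char0 N1 rhoF lq F.
elim: s F ts => [|b s IH] F /=; first by move=> _ -> _; exists 0; rewrite rmorph0.
move=> [tb ts] [c Fc] sF; apply: invariant_of_additive => // h.
apply: IH => //; last first.
  by rewrite rmorphB /= sF (shift_transB char0 rhoF lq) sF.
pose F' := F - c%:MP * b.
have -> : transB h F - F = c%:MP * (transB h b - b) + (transB h F' - F').
  have -> : transB h F' = transB h F - c%:MP * transB h b.
    by rewrite /F' rmorphB rmorphM /= transB_const.
  rewrite /F'; move: (transB h F) (transB h b) (c%:MP : B) => x y z.
  by rewrite mulrBr [RHS]addrC addrA addrAC; ring.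
apply: kspanD; first by apply: kspanZ; apply: (tb (Some h)).
by apply: kspanB => //; apply: (kspan_act (act_const rho l q) (Some h)).
Qed.

(** Normalize the first coefficient of F on a triangular list to 1; then
    (shiftB F - F) lies in the span of the rest of the list.  If it is zero, F is
    a nonzero constant by [shift_invariants]. *)
Lemma shift_stable_unit (I : B -> Prop) :
  (forall F G, I F -> I G -> I (F - G)) -> (forall c F, I F -> I (c%:MP * F)) ->
  (forall F, I F -> I (shiftB F)) -> forall F, I F -> F != 0 -> I 1.
Proof.
move=> IB IZ IS F; have [s ts sF] := all_loc_unipotent char0 N1 rhoF lq F.
elim: s F ts sF => [|b s IH] F /=; first by move=> _ -> _ /eqP.
move=> [tb ts] [c Fc] IF F0; have [c0|c0] := eqVneq c 0.
  by apply: (IH F) => //; rewrite c0 rmorph0 mul0r subr0 in Fc.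
pose G := c^-1%:MP * F; have IG : I G by apply: IZ.
have ci : c^-1%:MP * c%:MP = 1 :> B by rewrite -mpolyCM mulVf // mpolyC1.
have GE : G = b + c^-1%:MP * (F - c%:MP * b) by exact: mul_split.
have G0 : G != 0.
  by apply: contraNneq F0 => E; apply/eqP; apply: mul_cancel0 ci E.
clearbody G.
have [D0|D0] := eqVneq (shiftB G - G) 0; last first.
  apply: (IH (shiftB G - G)) => //; last by apply: IB => //; apply: IS.
  rewrite GE rmorphD opprD addrACA; apply: kspanD; first exact: (tb None).
  apply: kspanB; last exact: kspanZ.
  by apply: (kspan_act (act_const rho l q) None) => //; apply: kspanZ.
have [a aE] := shift_invariants (subr0_eq D0).
have a0 : cst a != 0 by apply: contraNneq G0 => E; rewrite aE E rmorph0.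
have a1 : (cst a)^-1%:MP * G = 1 :> B.
  rewrite aE.
  apply: etrans (esym (mpolyCM _ _ _)) _.
  apply: etrans (congr1 (@mpolyC dimN K) (mulVf a0)) _.
  exact: mpolyC1.
by rewrite -a1; apply: IZ.
Qed.

Lemma Phi_shift M : Phi k N M.+1 = unip_mul (x_N N M.+1%:R^-1) (Phi k N M).
Proof. by []. Qed.

Lemma theta_shiftB F : theta (shiftB F) = Seq_shift (theta F).
Proof. exact: (ev_shiftB char0 rhoF lq Phi_shift). Qed.

(** The kernel of theta is stable under the shift and does not contain 1. *)
Lemma theta_inj : injective (@theta k N).
Proof.
move=> F F' E; apply/eqP; rewrite -subr_eq0; apply: contraT => F0.
have thB G H : theta (G - H) = theta G - theta H :> Seq k by rewrite !theta_ev_seq rmorphB.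
have thM G H : theta (G * H) = theta G * theta H :> Seq k by rewrite !theta_ev_seq rmorphM.
have : theta (1 : B) = 0.
  apply: (@shift_stable_unit (fun G => theta G = 0) _ _ _ (F - F') _ F0) => [G H g0 h0|c G g0|G g0|].
  - by rewrite thB g0 h0 subrr.
  - by rewrite thM g0 mulr0.
  - by rewrite theta_shiftB g0 rmorph0.
  - by rewrite thB E subrr.
by rewrite theta_ev_seq rmorph1 => /eqP; rewrite oner_eq0.
Qed.

End Invariants.

(** * The Picard-Vessiot ring and its Galois group *)

Lemma ratfun_shift_surj (k : fieldType) (x : ratfun k) : exists y, ratfun_shift y = x.
Proof.
have dx := ratfun_den_neq0 x.
exists (FracField.tofrac (ratfun_num x \Po ('X - 1)) / FracField.tofrac (ratfun_den x \Po ('X - 1))).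
have E (p : {poly k}) : (p \Po ('X - 1)) \Po ('X + 1) = p.
  by rewrite -comp_polyA rmorphB /= comp_polyX rmorph1 addrK comp_polyXr.
rewrite ratfun_shiftE ?E -?ratfun_numden //.
apply: contraNneq dx => H; by rewrite -[ratfun_den x]E H comp_poly0.
Qed.

Lemma Seq_shift_inj (k : fieldType) : injective (@Seq_shift k).
Proof.
elim/SeqP=> a; elim/SeqP=> b; rewrite !Seq_shiftE => /to_SeqP[m E].
by apply/to_SeqP; exists m.+1 => -[//|M]; apply: E.
Qed.

Lemma to_Seq_mx_eq (k : fieldType) a b (u v : 'I_a -> 'I_b -> nat -> k) :
  (forall i j, to_Seq (u i j) = to_Seq (v i j)) -> exists M, forall i j, u i j M = v i j M.
Proof.
move=> E; have /choice[m mP] : forall p : 'I_a * 'I_b, exists m : nat,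
    forall M : nat, (m <= M)%N -> u p.1 p.2 M = v p.1 p.2 M.
  by move=> [i j]; apply/to_SeqP/E.
exists (\max_p m p)%N => i j; apply: (mP (i, j)); exact: leq_bigmax.
Qed.

Section PicardVessiotRing.
Variables (k : fieldType) (char0 : [pchar k] =i pred0) (N : nat).
Hypothesis N1 : (1 <= N)%N.
Local Notation L := (freeLieN k N).
Local Notation dimN := (\dim {: L}).
Local Notation K := (ratfun k).
Local Notation B := {mpoly K[dimN]}.
Local Notation cst := (@ratfun_cst k).
Local Notation cB := (@mpolyC dimN K \o cst).
Local Notation iota := (iota_Seq char0).
Local Notation ev := (ev_seq char0).
Variables (n : nat) (rho : 'M[unip_fun k N]_n) (l : 'I_dimN -> 'M[k]_n) (q : {poly k}).
Hypothesis rhoF : faithful_rep rho.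
Hypothesis lq : forall g i, log_coord i g = log_rec idfun l q (rep_at rho g) i.
Local Notation shiftB := (shiftB rho l q).
Local Notation transB := (transB rho l q).
Local Notation rhoB := (rhoB rho).
Local Notation rho_seq := (rho_seq rho).
Local Notation R := (@R_N k N).
Local Notation Y := (Y_N rho).
Local Notation A := (A_N rho).
Local Notation Phi := (Phi k N).
Local Notation sh := (@Seq_shift k).

Lemma thetaB (F G : B) : theta (F - G) = theta F - theta G :> Seq k.
Proof. by rewrite !(theta_ev_seq char0) rmorphB. Qed.
Lemma thetaD (F G : B) : theta (F + G) = theta F + theta G :> Seq k.
Proof. by rewrite !(theta_ev_seq char0) rmorphD. Qed.
Lemma thetaM (F G : B) : theta (F * G) = theta F * theta G :> Seq k.
Proof. by rewrite !(theta_ev_seq char0) rmorphM. Qed.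
Lemma theta1 : theta (1 : B) = 1 :> Seq k.
Proof. by rewrite (theta_ev_seq char0) rmorph1. Qed.
Lemma theta_const c : theta (c%:MP : B) = ratfun_Seq c.
Proof. by rewrite (theta_ev_seq char0) ev_const. Qed.

Lemma Y_rho_seq : Y = rho_seq Phi. Proof. by []. Qed.

Lemma Y_theta : Y = map_mx (@theta k N) rhoB.
Proof. by rewrite Y_rho_seq -(ev_rhoB char0). Qed.

(** The coordinates of the ordered products are polynomials in the entries of Y. *)
Lemma theta_in_subring (T : Seq k -> Prop) : is_subring T ->
  (forall a, T (ratfun_Seq a)) -> (forall i j, T (Y i j)) -> forall x, R x -> T x.
Proof.
move=> TP Tb TY _ [F <-]; apply: (subring_mmap TP) => [c|i]; first exact: Tb.
rewrite -[to_Seq _]/(coord_seq Phi i) -(log_rec_seq char0 lq).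
by apply: (subring_log_rec TP) => [c|a b]; [rewrite -(iota_cst char0); apply: Tb|apply: TY].
Qed.

Lemma R_subring : is_subring R.
Proof.
split=> [|x y [F <-] [G <-]|x y [F <-] [G <-]].
- by exists 1; rewrite theta1.
- by exists (F - G); rewrite thetaB.
- by exists (F * G); rewrite thetaM.
Qed.

Lemma R_Y i j : R (Y i j).
Proof. by exists (rhoB i j); rewrite Y_theta [RHS]mxE. Qed.

Lemma R_base a : R (ratfun_Seq a).
Proof. by exists a%:MP; rewrite theta_const. Qed.

Lemma det_Y : \det Y = 1.
Proof. by rewrite Y_rho_seq det_rho_seq. Qed.

Lemma det_A : \det A = 1.
Proof.
by rewrite /A_N det_map_mx (rep_det char0 N1 (faithful_unip_rep N1 rhoF)) rmorph1.
Qed.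

Lemma Y_solution : map_mx sh Y = map_mx iota A *m Y.
Proof.
rewrite iota_A_N Y_rho_seq (rho_seqM rhoF); apply/matrixP => i j; rewrite !mxE Seq_shiftE.
by apply: eq_Seq => M; rewrite !mxE.
Qed.

(** The image of the shift is a subring containing k(s), and it contains the
    entries of Y because Y is the shift of A'^-1 Y, where A' is the matrix with
    shift A. *)
Lemma R_shift_surj x : R x -> exists2 y, R y & sh y = x.
Proof.
pose T x := exists2 y, R y & sh y = x.
have TP : is_subring T.
  split=> [|u v [a Ra <-] [b Rb <-]|u v [a Ra <-] [b Rb <-]].
  - by exists 1; [exact: subring1 R_subring|rewrite rmorph1].
  - by exists (a - b); [exact: (subringB R_subring)|rewrite rmorphB].
  - by exists (a * b); [exact: (subringM R_subring)|rewrite rmorphM].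
apply: (theta_in_subring TP) => [a|].
  have [b bE] := ratfun_shift_surj a; exists (ratfun_Seq b); first exact: R_base.
  by rewrite (ratfun_Seq_shift char0) bE.
have [s sK] := choice (@ratfun_shift_surj k).
pose A' := map_mx s A.
have A'E : map_mx (@ratfun_shift k) A' = A by apply/matrixP => i j; rewrite [LHS]mxE [A' i j]mxE sK.
(* the adjugate of A' is its inverse, as det A = 1 *)
pose W := map_mx iota (\adj A') *m Y.
have WE : map_mx sh W = Y.
  apply: etrans (map_mxM _ _ _) _; rewrite Y_solution -map_mx_comp.
  have -> : map_mx (sh \o iota) (\adj A') = map_mx iota (\adj A).
    rewrite -A'E -map_mx_adj -map_mx_comp; apply: eq_map_mx => a /=.
    exact: (ratfun_Seq_shift char0).
  by rewrite mulmxA -map_mxM mul_adj_mx det_A map_mx1 mul1mx.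
move=> i j; exists (W i j); last by rewrite -[RHS](congr1 (fun Q : 'M_n => Q i j) WE) [RHS]mxE.
apply: (subring_mulmx R_subring) => [a b|]; last exact: R_Y.
by rewrite mxE; apply: R_base.
Qed.

Lemma R_extension : diff_extension (@Seq_shift k) (@ratfun_Seq k) R.
Proof.
split.
- exact: R_subring.
- exact: ratfun_Seq_zmod.
- exact: ratfun_Seq_monoid.
- exact: R_base.
- exact: ratfun_Seq_shift.
- by move=> _ [F <-]; exists (shiftB F); rewrite (theta_shiftB char0 rhoF lq).
- by move=> x y _ _ /Seq_shift_inj.
- exact: R_shift_surj.
Qed.

Lemma R_simple : sigma_simple (@Seq_shift k) R.
Proof.
move=> I [IR I0 ID IM IS]; have [|] := pselect (forall x, I x -> x = 0); first by left.
move=> /existsNP[x /not_implyP[Ix x0]]; right.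
have [F Fx] := IR x Ix.
have I1 : I (theta (1 : B)).
  apply: (@shift_stable_unit _ char0 _ N1 _ rho l q rhoF lq (fun G => I (theta G)) _ _ _ F) => /=.
  - move=> G H IG IH; rewrite thetaB; apply: ID => //; rewrite -mulN1r; apply: IM => //.
    by rewrite -[-1]sub0r; apply: (subringB R_subring); [exact: subring0 R_subring|exact: subring1 R_subring].
  - move=> c G IG; rewrite thetaM; apply: IM => //; rewrite theta_const; exact: R_base.
  - by move=> G IG; rewrite (theta_shiftB char0 rhoF lq); apply: IS.
  - by rewrite Fx.
  - by apply/eqP => F0; apply: x0; rewrite -Fx F0 (theta_ev_seq char0) rmorph0.
by move=> y Ry; rewrite -[y]mulr1; apply: IM => //; rewrite -theta1.
Qed.

Lemma R_PV_ring : PV_ring (@Seq_shift k) (@ratfun_Seq k) R A Y.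
Proof.
split.
- by rewrite unitmxE det_A unitr1.
- exact: R_extension.
- exact: R_simple.
- exact: R_Y.
- exact: Y_solution.
exists 1; split; first exact: subring1 R_subring.
  by rewrite det_Y mulr1.
by move=> T TP Tb TY _; apply: theta_in_subring.
Qed.

Lemma transB_comp g h F : transB g (transB h F) = transB (unip_mul g h) F.
Proof.
apply: (eval_pt_ext char0) => u.
apply: etrans (eval_pt_transB char0 rhoF lq u g _) _.
apply: etrans (eval_pt_transB char0 rhoF lq (unip_mul u g) h F) _.
apply: etrans _ (esym (eval_pt_transB char0 rhoF lq u (unip_mul g h) F)).
by rewrite (unip_mulA rhoF).
Qed.

Lemma transB_1 F : transB (unip1 k N) F = F.
Proof.
apply: (eval_pt_ext char0) => u.
by rewrite (eval_pt_transB char0 rhoF lq) (unip_mulg1 N1 rhoF).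
Qed.

(** An automorphism composed with theta is a morphism from a polynomial ring,
    determined by the sequences to which it sends the coordinates. *)
Lemma automorphism_point phi : sigma_aut (@Seq_shift k) (@ratfun_Seq k) R phi ->
  exists gam, forall F : B, phi (theta F) = ev gam F.
Proof.
move=> aut; pose psi (F : B) := phi (theta F).
have RF (F : B) : R (theta F) by exists F.
have psiD : {morph psi : F G / F + G} by move=> F G; rewrite /psi thetaD (aut_add aut).
have psi_zmod : zmod_morphism psi.
  move=> F G; apply: (addIr (psi G)); rewrite -psiD !subrK.
  by [].
have psi_monoid : monoid_morphism psi.
  split; last by move=> F G; rewrite /psi thetaM (aut_mul aut).
  by rewrite /psi -[1]/((1 : K)%:MP) theta_const (aut_base aut) -/(iota 1) rmorph1.
pose psiM : {rmorphism B -> Seq k} := HB.pack psi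
  (GRing.isZmodMorphism.Build _ _ psi psi_zmod)
  (GRing.isMonoidMorphism.Build _ _ psi psi_monoid).
have /choice[x xE] : forall i, exists a : nat -> k, psi 'X_i = to_Seq a.
  by move=> i; elim/SeqP: (psi 'X_i) => a; exists a.
have /choice[gam gamE] : forall M, exists g : unip k N, forall i, log_coord i g = x i M.
  by move=> M; apply: log_coord_surj.
exists gam; apply: (mpoly_morph_ext (phi := psiM)) => [c|i] /=.
  by rewrite /psi theta_const (aut_base aut) ev_const.
by rewrite xE ev_var; apply: eq_Seq => M; rewrite gamE.
Qed.

Lemma unip_inv_shift (g h : unip k N) : unip_mul (unip_inv (unip_mul g h)) g = unip_inv h.
Proof.
rewrite -[LHS](unip_mulg1 N1 rhoF) -(unip_mulgV N1 h).
rewrite (unip_mulA rhoF (unip_mul _ g)) -(unip_mulA rhoF (unip_inv _) g h).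
by rewrite (unip_mulVg N1) (unip_mul1g N1 rhoF).
Qed.

(** Both Phi and the sequence gam of [automorphism_point] satisfy
    u(M + 1) = a_N(M) u(M), so Phi^-1 gam is fixed by the shift. *)
Lemma automorphism_translation phi : sigma_aut (@Seq_shift k) (@ratfun_Seq k) R phi ->
  exists g, map_mx phi Y = Y *m map_mx (@cSeq k) (rep_at rho g).
Proof.
move=> aut; have [gam gamE] := automorphism_point aut.
have phiY : map_mx phi Y = rho_seq gam.
  by rewrite -(ev_rhoB char0) Y_theta -map_mx_comp; apply: eq_map_mx => F /=.
have shY : map_mx sh (rho_seq gam) = map_mx iota A *m rho_seq gam.
  apply: etrans (_ : map_mx (ev gam) (map_mx shiftB rhoB) = _).
    rewrite -phiY Y_theta; apply/matrixP => i j; rewrite mxE [in LHS]mxE [RHS]mxE.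
    by rewrite [in LHS]mxE [in RHS]mxE -gamE (theta_shiftB char0 rhoF lq) (aut_shift aut) //; exists (rhoB i j).
  rewrite (shiftB_rhoB char0 rhoF lq); apply: etrans (map_mxM _ _ _) _.
  rewrite ev_rhoB -map_mx_comp; congr (_ *m _); apply: eq_map_mx => c /=.
  exact: ev_const.
pose del M := unip_mul (unip_inv (Phi M)) (gam M).
have delE : rho_seq del = rho_seq (fun M => unip_inv (Phi M)) *m rho_seq gam.
  by rewrite rho_seqM.
have shdel : map_mx sh (rho_seq del) = rho_seq del.
  rewrite delE; apply: etrans (map_mxM _ _ _) _; rewrite shY iota_A_N mulmxA.
  congr (_ *m _).
  have -> : map_mx sh (rho_seq (fun M => unip_inv (Phi M))) = rho_seq (fun M => unip_inv (Phi M.+1)).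
    by apply/matrixP => i j; rewrite !mxE Seq_shiftE.
  by rewrite rho_seqM //; apply: eq_rho_seq => M; rewrite Phi_shift unip_inv_shift.
have /choice[c cE] : forall p : 'I_n * 'I_n, exists c, rho_seq del p.1 p.2 = cSeq c.
  move=> [i j]; apply: shift_fixed.
  by rewrite -[RHS](congr1 (fun Q : 'M_n => Q i j) shdel) [RHS]mxE.
have [M ME] : exists M, forall i j, rep_at rho (del M) i j = c (i, j).
  apply: (@to_Seq_mx_eq _ _ _ (fun i j M => rep_at rho (del M) i j) (fun i j _ => c (i, j))) => i j.
  by have := cE (i, j); rewrite mxE.
exists (del M); rewrite phiY Y_rho_seq.
have -> : map_mx (@cSeq k) (rep_at rho (del M)) = rho_seq del.
  by apply/matrixP => i j; rewrite mxE ME -(cE (i, j)).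
rewrite rho_seqM //; apply: eq_rho_seq => M'.
by rewrite /del (unip_mulA rhoF) (unip_mulgV N1) (unip_mul1g N1 rhoF).
Qed.

Lemma map_cst_matrix (c : 'M[k]_n) :
  map_mx (@ratfun_Seq k \o cst) c = map_mx (@cSeq k) c.
Proof. by apply: eq_map_mx => a; exact: (iota_cst char0). Qed.

(** Right translation by g, transported to R_N along the bijection theta. *)
Lemma translation_automorphism g :
  exists2 phi, sigma_aut (@Seq_shift k) (@ratfun_Seq k) R phi
    & aut_matrix (@ratfun_Seq k) Y phi (rep_at rho g).
Proof.
have [phi phiE] : exists phi, forall F : B, phi (theta F) = theta (transB g F).
  have /choice[phi phiE] : forall x : Seq k, exists y, forall F : B, theta F = x -> theta (transB g F) = y.
    move=> x; have [[F FE]|noF] := pselect (exists F : B, theta F = x).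
      exists (theta (transB g F)) => G GE.
      by rewrite (theta_inj char0 N1 rhoF lq (etrans GE (esym FE))).
    by exists 0 => F FE; case: noF; exists F.
  by exists phi => F; exact: esym (phiE _ F erefl).
have thI := theta_inj char0 N1 rhoF lq.
exists phi.
  split.
  - by move=> _ [F <-]; rewrite phiE; exists (transB g F).
  - move=> _ _ [F <-] [G <-]; rewrite !phiE => /thI E.
    by rewrite -[F]transB_1 -[G]transB_1 -(unip_mulVg N1 g) -!transB_comp E.
  - move=> _ [F <-]; exists (theta (transB (unip_inv g) F)); first by exists (transB (unip_inv g) F).
    by rewrite phiE transB_comp (unip_mulgV N1) transB_1.
  - by move=> _ _ [F <-] [G <-]; rewrite -thetaD !phiE rmorphD thetaD.
  - by move=> _ _ [F <-] [G <-]; rewrite -thetaM !phiE rmorphM thetaM.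
  - by move=> a; rewrite -theta_const phiE transB_const.
  - move=> _ [F <-].
    rewrite /= -(theta_shiftB char0 rhoF lq F); apply: etrans (phiE _) _.
    apply: etrans (congr1 (@theta k N) (esym (shift_transB char0 rhoF lq g F))) _.
    by apply: etrans (theta_shiftB char0 rhoF lq _) _; rewrite phiE.
split; first exact: rep_unit.
have E i j : transB g (rhoB i j) = (rhoB *m map_mx cB (rep_at rho g)) i j.
  have := transB_rhoB char0 rhoF lq g => /matrixP/(_ i j) <-.
  by rewrite [RHS]mxE.
transitivity (map_mx (@theta k N) (rhoB *m map_mx cB (rep_at rho g))).
  rewrite Y_theta; apply/matrixP => i j; rewrite [LHS]mxE [RHS]mxE [map_mx _ rhoB i j]mxE.
  by rewrite phiE E.
rewrite (theta_ev_seq char0) Y_theta (theta_ev_seq char0).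
apply: etrans (map_mxM (ev Phi) rhoB (map_mx cB (rep_at rho g))) _; congr (_ *m _).
rewrite map_cst_matrix -map_mx_comp; apply: eq_map_mx => c.
exact: ev_cB.
Qed.

Lemma R_galois_group : is_galois_group (@Seq_shift k) (@ratfun_Seq k) R Y
  (fun c : 'M[k]_n => exists g : unip k N, c = rep_at rho g).
Proof.
split=> [phi aut|c]; last split=> [[g ->]|[phi aut [_ phiY]]].
- have [g gE] := automorphism_translation aut; exists (rep_at rho g); split.
    exact: rep_unit.
  by rewrite map_cst_matrix.
- exact: translation_automorphism.
have [g gE] := automorphism_translation aut; exists g.
suff E : map_mx (@cSeq k) c = map_mx (@cSeq k) (rep_at rho g).
  apply/matrixP => i j; apply: (fmorph_inj (@cSeq k)).
  by have /matrixP/(_ i j) := E; rewrite mxE [RHS]mxE.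
have : \adj Y *m (Y *m map_mx (@cSeq k) c) = \adj Y *m (Y *m map_mx (@cSeq k) (rep_at rho g)).
  by rewrite -gE -map_cst_matrix -phiY.
by rewrite !mulmxA mul_adj_mx det_Y !mul1mx.
Qed.

End PicardVessiotRing.

Theorem theorem2 (k : closedFieldType) (char0 : [pchar k] =i pred0)
    (N : nat) (N_ge1 : (1 <= N)%N)
    (n : nat) (rho : 'M[unip_fun k N]_n) (rho_faithful : faithful_rep rho) :
  [/\ injective (@theta k N),
      PV_ring (@Seq_shift k) (@ratfun_Seq k) (@R_N k N) (A_N rho) (Y_N rho)
    & is_galois_group (@Seq_shift k) (@ratfun_Seq k) (@R_N k N) (Y_N rho)
        (fun c : 'M[k]_n => exists g : unip k N, c = rep_at rho g)].
Proof.
have [l [q lq]] := faithful_log char0 N_ge1 rho_faithful.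
split.
- exact: theta_inj lq.
- exact: R_PV_ring lq.
- exact: R_galois_group lq.
Qed.
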